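(* The Chabauty compactification $\overline{\mathrm{Cartan}(\mathrm{SL}_4(\mathbb{R}))}^{\mathcal{S}}$ coincides with the space $\mathcal{A}(\mathrm{SL}_4(\mathbb{R}))$.
   Context: Let $G=\mathrm{SL}_4(\mathbb{R})$. A Cartan subgroup of $G$ is a conjugate in $G$ of the group $A$ of diagonal matrices with positive diagonal entries and determinant $1$. $\mathcal{S}(G)$ is the space of closed subgroups of $G$ with the Chabauty topology, which is compact and metrizable: $H_n \to H$ if and only if every $h\in H$ is a limit of a sequence $h_n \in H_n$, and every limit of a sequence $(h_n)_{n\in P}$ with $P\subset\mathbb{N}$ infinite and $h_n\in H_n$ for all $n\in P$ belongs to $H$. $\mathrm{Cartan}(G)\subset\mathcal{S}(G)$ is the space of Cartan subgroups and $\overline{\mathrm{Cartan}(G)}^{\mathcal{S}}$ is its closure. $\mathcal{A}(G)$ is the set of closed connected abelian subgroups of $G$ of dimension $3$ (the real rank of $G$) contained in a Borel subgroup of $G$, i.e. in a conjugate of the group of upper triangular matrices of $G$. *)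

(* Defs.v *)
From HB Require Import structures.
From mathcomp Require Import all_boot all_order all_algebra finmap.
From mathcomp Require Import all_classical all_reals all_analysis.

Set Implicit Arguments.
Unset Strict Implicit.
Unset Printing Implicit Defensive.

Import Order.TTheory GRing.Theory Num.Theory.
Import numFieldNormedType.Exports.

Local Open Scope classical_set_scope.
Local Open Scope ring_scope.

Definition SL (R : realType) (n : nat) : set 'M[R]_n := [set g | \det g = 1].
Arguments SL : clear implicits.

(* SL_n is closed in the space of matrices, so a subgroup is closed in SL_n
   iff it is closed in 'M[R]_n. *)
Record closedSubgroup (R : realType) (n : nat) := ClosedSubgroup {
  csg_set :> set 'M[R]_n;
  csg_subSL : csg_set `<=` SL R n;
  csg_1 : csg_set 1%:M;
  csg_mul : forall g h, csg_set g -> csg_set h -> csg_set (g *m h);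
  csg_inv : forall g, csg_set g -> csg_set (invmx g);
  csg_closed : closed csg_set
}.

HB.instance Definition _ (R : realType) (n : nat) :=
  gen_eqMixin (closedSubgroup R n).
HB.instance Definition _ (R : realType) (n : nat) :=
  gen_choiceMixin (closedSubgroup R n).

Definition chabauty_subbase (R : realType) (n : nat) :
    set (set (closedSubgroup R n)) :=
  [set [set H : closedSubgroup R n | H `&` K = set0]
    | K in [set K : set 'M[R]_n | compact K]] `|`
  [set [set H : closedSubgroup R n | H `&` U !=set0]
    | U in [set U : set 'M[R]_n | open U]].
Arguments chabauty_subbase : clear implicits.

HB.instance Definition _ (R : realType) (n : nat) :=
  @isSubBaseTopological.Build (closedSubgroup R n)
    (set (closedSubgroup R n)) (chabauty_subbase R n) id.

Lemma chabauty_cvg_subbaseP (R : realType) n (H : closedSubgroup R n)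
    (F : set_system (closedSubgroup R n)) :
  Filter F -> F --> H <-> forall S, chabauty_subbase R n S -> S H -> F S.
Proof.
move=> FF; split.
  move=> FH S DS SH; apply: FH; apply: open_nbhs_nbhs; split => //.
  exists [set S]; last by rewrite bigcup_set1.
  move=> _ ->; exists [fset S]%fset.
    by move=> T; rewrite in_fset1 => TS; rewrite (eqP TS : T = S) inE.
  by rewrite set_fset1 bigcap_set1.
move=> FS A [B [[C CD BE] BH] BA].
move: BH; rewrite -BE => -[T CT TH].
have [E ED TE] := CD _ CT.
apply: filterS BA _.
rewrite -BE; apply: (filterS (P := T)); first by move=> x Tx; exists T.
rewrite -TE; apply: filter_bigI => S SE.
apply: FS; first by have := ED _ SE; rewrite inE.
by move: TH; rewrite -TE; apply.
Qed.

Lemma mx_compact_ball (R : realType) n (g : 'M[R]_n) :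
  exists2 K : set 'M[R]_n, compact K & ball g 1 `<=` K.
Proof.
pose B := [set v : 'rV[R]_(n * n) |
  forall i, v ord0 i \in `[mxvec g ord0 i - 1, mxvec g ord0 i + 1]].
exists [set vec_mx v | v in B].
  apply: continuous_compact; last first.
    apply: (@rV_compact _ _
      (fun i => `[mxvec g ord0 i - 1, mxvec g ord0 i + 1]%classic)).
    by move=> i; apply: segment_compact.
  apply: continuous_subspaceT => v A /= /nbhs_ballP[e /= e0 eA].
  apply/nbhs_ballP; exists e => //= w [_ vw]; apply: eA; split => // i j.
  by rewrite !mxE; exact: vw.
move=> h [_ gh]; exists (mxvec h); last by rewrite mxvecK.
move=> k; case/mxvec_indexP: k => i j; rewrite !mxvecE.
have := gh i j; rewrite /ball /= ltr_distlC => /andP[a b].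
by rewrite in_itv /= !ltW.
Qed.

(* Infinite sets P of indices are given by their increasing enumerations p. *)
Lemma chabauty_cvgP (R : realType) (n : nat) (Hs : nat -> closedSubgroup R n)
    (H : closedSubgroup R n) :
  Hs @ \oo --> H <->
  (forall h, csg_set H h -> exists2 u : nat -> 'M[R]_n,
     (forall k, csg_set (Hs k) (u k)) & u @ \oo --> h) /\
  (forall (p : nat -> nat) (u : nat -> 'M[R]_n) h,
     {homo p : i j / (i < j)%N} -> (forall k, csg_set (Hs (p k)) (u k)) ->
     u @ \oo --> h -> csg_set H h).
Proof.
rewrite chabauty_cvg_subbaseP; split=> [HsH|[Hlim Hsub] S]; last first.
  case=> -[K cK <-] /= HK.
    apply: contrapT => nK.
    have step N : exists2 k, (N <= k)%N & (Hs k `&` K) !=set0.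
      apply: contrapT => NN; apply: nK; exists N => // k /= Nk.
      by rewrite -subset0 => x Hx; apply: NN; exists k => //; exists x.
    have [q qN qH] : exists2 q : nat -> nat, (forall N, (N <= q N)%N) &
       forall N, (Hs (q N) `&` K) !=set0.
      have /choice[q qP] : forall N, exists k, (N <= k)%N /\ (Hs k `&` K) !=set0.
        by move=> N; have [k] := step N; exists k.
      by exists q => N; have [] := qP N.
    have /choice[v vP] := qH.
    have [h [Kh clh]] := cK (v @ \oo) _ (filterS (fun k _ => (vP k).2) filterT).
    have /choice[r rP] : forall Ne : nat * nat, exists k,
        (Ne.1 <= k)%N /\ ball h Ne.2.+1%:R^-1 (v k).
      move=> [N e]; have [||x [[k Nk <-] hv]] := clh (v @` [set k | (N <= k)%N])
         (ball h e.+1%:R^-1).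
      - by exists N => // k /= Nk; exists k.
      - by apply: nbhsx_ballx; rewrite invr_gt0.
      - by exists k.
    pose s := fix s k := if k is k'.+1 then r ((q (s k')).+1, k) else r (0%N, 0%N).
    have sS k : s k.+1 = r ((q (s k)).+1, k.+1) by [].
    suff : csg_set H h by move=> Hh; have : (H `&` K) h by []; rewrite HK.
    apply: (Hsub (q \o s) (v \o s)).
    - apply: homo_ltn; first exact: ltn_trans.
      move=> k; change (q (s k) < q (s k.+1))%N; rewrite sS.
      by apply: leq_trans (qN _); exact: (rP ((q (s k)).+1, k.+1)).1.
    - by move=> k; exact: (vP _).1.
    - apply/cvgrPdist_lt => e e0.
      have sb k : ball h k.+1%:R^-1 (v (s k)).
        by case: k => [|k]; [exact: (rP (_, _)).2|rewrite sS; exact: (rP (_, _)).2].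
      near=> k; have := sb k; rewrite -ball_normE /= => /lt_trans; apply.
      by near: k; exact: near_infty_natSinv_lt (PosNum e0).
  case: HK => h [Hh Uh].
  have [u uH uh] := Hlim h Hh.
  have := uh K (open_nbhs_nbhs (conj cK Uh)).
  by move=> [N _ NU]; exists N => // k /NU Uu; exists (u k).
split.
  move=> h Hh.
  have meet e : 0 < e -> \forall k \near \oo, (Hs k `&` ball h e) !=set0.
    move=> e0; apply: (HsH [set L : closedSubgroup R n | L `&` ball h e !=set0]).
      by right; exists (ball h e) => //=; apply: ball_open.
    by exists h; split => //; exact: ballxx.
  pose Q k x := csg_set (Hs k) x /\ forall j, (j <= k)%N ->
     (Hs k `&` ball h j.+1%:R^-1) !=set0 -> ball h j.+1%:R^-1 x.
  have /choice[u uQ] : forall k, exists x, Q k x.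
    move=> k.
    suff: forall m, exists x, csg_set (Hs k) x /\ forall j, (j <= m)%N ->
     (Hs k `&` ball h j.+1%:R^-1) !=set0 -> ball h j.+1%:R^-1 x by exact.
    elim=> [|m [x [Hx xP]]].
      have [[x [Hx hx]]|N] := pselect ((Hs k `&` ball h 1%:R^-1) !=set0).
        by exists x; split=> // j; rewrite leqn0 => /eqP ->.
      by exists 1%:M; split => [|j]; [exact: csg_1|rewrite leqn0 => /eqP ->].
    have [[y [Hy hy]]|N] := pselect ((Hs k `&` ball h m.+2%:R^-1) !=set0).
      exists y; split=> // j jm _; apply: le_ball hy.
      by rewrite lef_pV2 ?posrE// ler_nat.
    exists x; split => // j; rewrite leq_eqVlt => /orP[/eqP -> //|]; exact: xP.
  exists u => [k|]; first by have [] := uQ k.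
  apply/cvgrPdist_lt => e e0.
  have [m _ /(_ m (leqnn _))/= me] := near_infty_natSinv_lt (PosNum e0).
  near=> k.
  suff : ball h m.+1%:R^-1 (u k).
    by rewrite -ball_normE => /lt_trans; apply.
  apply: (uQ k).2; first by near: k; exact: nbhs_infty_ge.
  by near: k; apply: meet; rewrite invr_gt0.
move=> p u h pinc uH uh; apply: contrapT => nHh.
have [K cK hK] := mx_compact_ball h.
have : nbhs h (~` H) by apply: open_nbhs_nbhs; split => //; exact/closed_openC/csg_closed.
move=> /nbhs_ballP[e /= e0 eH].
pose C := K `&` closed_ball h (e / 2).
have cC : compact C.
  by apply: (compact_closedI cK); exact: closed_ball_closed.
have HC : H `&` C = set0.
  rewrite -subset0 => x [Hx [_ xh]]; apply: (eH x) => //.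
  by apply: closed_ball_subset xh; rewrite ?divr_gt0// gtr_pMr// invf_lt1// ltr1n.
have [N _ NC] : \forall k \near \oo, Hs k `&` C = set0.
  by apply: (HsH [set L : closedSubgroup R n | L `&` C = set0]) => //; left; exists C.
have pge k : (k <= p k)%N.
  by elim: k => // k IH; apply: leq_ltn_trans IH _; exact: pinc.
near \oo => k.
suff : (Hs (p k) `&` C) (u k).
  by rewrite NC//=; apply: leq_trans (pge k); near: k; exact: nbhs_infty_ge.
split; first exact: uH.
split; first (apply: hK; near: k; apply: uh; exact: nbhsx_ballx).
by near: k; apply: uh; apply: filterS (@subset_closure _ _) _; apply: nbhsx_ballx; rewrite divr_gt0.
Unshelve. all: by end_near. Qed.

Definition posdiag (R : realType) (n : nat) : set 'M[R]_n :=
  [set a | is_diag_mx a /\ (forall i, 0 < a i i) /\ \det a = 1].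
Arguments posdiag : clear implicits.

Definition upper_triangular (R : realType) (n : nat) : set 'M[R]_n :=
  [set b | SL R n b /\ forall i j : 'I_n, (j < i)%N -> b i j = 0].
Arguments upper_triangular : clear implicits.

Definition conjmx_set (R : realType) (n : nat) (g : 'M[R]_n) (X : set 'M[R]_n) :
  set 'M[R]_n := [set g *m x *m invmx g | x in X].

Definition Cartan (R : realType) (n : nat) : set (closedSubgroup R n) :=
  [set H : closedSubgroup R n |
    exists2 g, SL R n g & csg_set H = conjmx_set g (posdiag R n)].
Arguments Cartan : clear implicits.

Definition expmx (R : realType) (n : nat) (X : 'M[R]_n) : 'M[R]_n :=
  limn (series (fun k => k`!%:R^-1 *: X ^+ k)).

Lemma is_cvg_expmx (R : realType) n (X : 'M[R]_n) :
  cvgn (series (fun k => k`!%:R^-1 *: X ^+ k)).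
Proof.
have Xle k i j : `|(X ^+ k) i j| <= (n%:R * `|X|) ^+ k.
  have Xn a b : `|X a b| <= `|X|.
    by rewrite [leRHS]/Num.Def.normr/= mx_normrE; exact: (le_bigmax _ _ (a, b)).
  elim: k i j => [|k IH] i j.
    by rewrite !expr0 mxE; case: (i == j); rewrite ?normr1// normr0.
  rewrite exprS -[X * _]/(X *m _) mxE.
  apply: (le_trans (ler_norm_sum _ _ _)).
  apply: (@le_trans _ _ (\sum_(l < n) `|X| * (n%:R * `|X|) ^+ k)).
    by apply: ler_sum => l _; rewrite normrM ler_pM.
  by rewrite sumr_const card_ord exprS -[leLHS]mulr_natl mulrA.
suff H i j : cvgn (series (fun k => k`!%:R^-1 * (X ^+ k) i j)).
  apply/cvg_ex; exists (\matrix_(i, j) limn (series (fun k => k`!%:R^-1 * (X ^+ k) i j))).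
  apply/cvgrPdist_le => e e0; near=> k.
  rewrite /Num.Def.normr/= mx_normrE (bigmax_le _ (ltW e0))//= => i _.
  rewrite !mxE /series /= summxE (eq_bigr (fun k => k`!%:R^-1 * (X ^+ k) i.1 i.2)).
    2: by move=> l _; rewrite mxE.
  move: i; near: k; apply: filter_forall => i.
  exact: ((cvgrPdist_le _ _).1 (H i.1 i.2)).
apply: normed_cvg.
apply: series_le_cvg (is_cvg_series_exp_coeff (n%:R * `|X|)) => k //=.
- by rewrite /exp_coeff /= divr_ge0 // exprn_ge0// mulr_ge0.
- rewrite /exp_coeff /= normrM ger0_norm ?invr_ge0// mulrC.
  by apply: ler_wpM2r; rewrite ?invr_ge0.
Unshelve. all: by end_near. Qed.

Definition lie_algebra (R : realType) (n : nat) (H : set 'M[R]_n) :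
  set 'M[R]_n := [set X | forall t : R, H (expmx (t *: X))].

(* The dimension of a closed subgroup as a Lie group is that of its Lie
   algebra, which is always a linear subspace. *)
Definition has_dim (R : realType) (n : nat) (H : set 'M[R]_n) (d : nat) :=
  exists2 V : {vspace 'M[R]_n}, [set` V] = lie_algebra H & \dim V = d.

(* n.-1 is the real rank of SL_n. *)
Definition calA (R : realType) (n : nat) : set (closedSubgroup R n) :=
  [set H : closedSubgroup R n | [/\ connected H,
     forall g h, csg_set H g -> csg_set H h -> g *m h = h *m g,
     has_dim H n.-1 &
     exists2 g, SL R n g & H `<=` conjmx_set g (upper_triangular R n)]].
Arguments calA : clear implicits.

(* Main.v *)
Require Import Defs.
From HB Require Import structures.
From mathcomp Require Import all_boot all_order all_algebra.
From mathcomp Require Import all_classical all_reals all_analysis.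
From mathcomp Require Import ring lra.

Set Implicit Arguments.
Unset Strict Implicit.
Unset Printing Implicit Defensive.

Import Order.TTheory GRing.Theory Num.Theory.
Import numFieldNormedType.Exports.

Local Open Scope classical_set_scope.
Local Open Scope ring_scope.

(** A Cartan subgroup consists of the elements with determinant 1 and positive
    eigenvalues of an algebra [P^-1 D P], with [D] running over the diagonal
    matrices.  Everything is read off from limits of such algebras.

    Let [P_t] be a family of invertible matrices and [U] an ultrafilter on its
    index set.  The limits along [U] of elements of the algebras of [P_t] form a
    commutative algebra [V = dlim U P].  Its elements have real eigenvalues, so
    [V] is triangularizable, and it has dimension exactly [n] because each of the
    algebras has a basis with entries in [-1, 1] that contains an identity
    submatrix ([dlim_basis]).  The limit of the Cartan subgroups is then the group
    [posgrp] of the elements of [V] with determinant 1 and positive eigenvalues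
    ([posgrp_limP]).  This group is abelian, triangularizable, connected by
    rescaled segments, and its Lie algebra is the traceless part of [V]
    ([lie_posgrp]), of dimension [n - 1].  Hence every limit of Cartan subgroups
    is in [calA], for every [n] ([closure_Cartan_sub]).

    Conversely let [H] be in [calA R 4], with Lie algebra [W].  A basis of [W]
    consists of three commuting 4 x 4 matrices with real eigenvalues, and
    [asd_triple] shows that such a triple is a limit of simultaneously
    diagonalizable triples.  So [W] and the identity lie in one of the algebras
    [V], and by dimension [W] is the traceless part of [V].  Thus [H] and
    [posgrp] are connected closed subgroups with the same Lie algebra, which is
    also that of their intersection.  A connected closed subgroup has no proper
    closed subgroup with the same Lie algebra ([csg_eq]), so both are equal to
    the intersection, and [H] is a limit of Cartan subgroups.

    The size 4 enters only through [asd_triple]. The triple is first made lower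
    triangular.  When one of the matrices has two eigenvalues the space splits
    into smaller invariant pieces, where every commuting family with real
    eigenvalues is a limit of diagonalizable ones.  Otherwise one may subtract
    scalars and assume that the matrices are strictly triangular, and the proof
    exhibits an arbitrarily small perturbation that keeps the matrices commuting
    with real eigenvalues and gives one of them two eigenvalues
    ([asd_perturbation]). Finding the perturbation is a case analysis on the six
    entries below the diagonal: either the entry (2, 1) is nonzero somewhere, or
    commutation says that the vectors formed by four other entries are isotropic
    for a symplectic form on R^4. *)

(** * Commuting matrices with eigenvalues in the base field *)

Section SplitMatrices.
Variable F : fieldType.

(** The product of the matrices [X - c], for [c] in [s], written without the
    ring structure of square matrices so that it is available in every size. *)
Definition split_eval n (X : 'M[F]_n) (s : seq F) : 'M[F]_n :=
  foldr (fun a M => (X - a%:M) *m M) 1%:M s.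

(** All eigenvalues of [X] are in [F].  This form passes to invariant subspaces,
    to quotients and to conjugates without any choice of a basis. *)
Definition split_mx n (X : 'M[F]_n) := exists s, split_eval X s = 0.

Definition commuting_split n (L : seq 'M[F]_n) :=
  (forall X Y, X \in L -> Y \in L -> X *m Y = Y *m X) /\
  (forall X, X \in L -> split_mx X).

Lemma invmx_mul n (A B : 'M[F]_n) : A \in unitmx -> B \in unitmx ->
  invmx (A *m B) = invmx B *m invmx A.
Proof.
move=> Au Bu; have ABu : A *m B \in unitmx by rewrite unitmx_mul Au.
apply: (can_inj (mulKmx ABu)); rewrite mulmxV // -mulmxA (mulmxA B) mulmxV //.
by rewrite mul1mx mulmxV.
Qed.

Lemma split_evalE n (X : 'M[F]_n.+1) s :
  split_eval X s = horner_mx X (\prod_(a <- s) ('X - a%:P)).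
Proof.
elim: s => [|a s IH]; first by rewrite big_nil rmorph1.
by rewrite big_cons rmorphM rmorphB /= horner_mx_X horner_mx_C IH.
Qed.

Lemma split_eval_intertwine m n (V : 'M[F]_(m, n)) X A s :
  V *m X = A *m V -> V *m split_eval X s = split_eval A s *m V.
Proof.
move=> VX; elim: s => [|a s IH] /=; first by rewrite mul1mx mulmx1.
by rewrite mulmxA mulmxBr VX mul_mx_scalar -mul_scalar_mx -mulmxBl -!mulmxA IH.
Qed.

Lemma split_mx_sub m n (V : 'M[F]_(m, n)) X A :
  V *m X = A *m V -> row_free V -> split_mx X -> split_mx A.
Proof.
move=> VX fV [s Xs]; exists s; apply: (row_free_inj fV).
by rewrite -(split_eval_intertwine _ VX) Xs mulmx0 mul0mx.
Qed.

Lemma split_mx_trig n (X : 'M[F]_n) : is_trig_mx X -> split_mx X.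
Proof.
case: n X => [X _|n X tX]; first by exists [::]; rewrite thinmx0.
exists [seq X i i | i <- enum 'I_n.+1].
have := char_poly_trig tX; rewrite split_evalE big_map big_enum => <-.
exact: Cayley_Hamilton.
Qed.

(** Induction on [L]: multiplying a vector of [E] by the successive factors
    [X - a] of an annihilating product, the last nonzero vector is an
    eigenvector of [X].  The eigenvectors of [X] in [E] are stable under the
    rest of [L] since it commutes with [X]. *)
Lemma common_eigenvector_split n (L : seq 'M[F]_n) (E : 'rV[F]_n -> Prop) v :
    commuting_split L -> v != 0 -> E v ->
    (forall w X a, E w -> X \in L -> E (w *m (X - a%:M))) ->
  exists w, [/\ w != 0, E w & forall X, X \in L -> exists a, w *m X = a *: w].
Proof.
elim: L E v => [|X L IH] E v [cL sL] v0 Ev stE; first by exists v; split.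
have [a [w [w0 Ew wX]]] : exists a w, [/\ w != 0, E w & w *m X = a *: w].
  have [s] := sL X (mem_head _ _); move=> /(congr1 (mulmx v)); rewrite mulmx0.
  elim: s v v0 Ev => [|a s IHs] v v0 Ev /=.
    by rewrite mulmx1 => v00; rewrite v00 eqxx in v0.
  rewrite mulmxA.
  have [vXa _|nz] := eqVneq (v *m (X - a%:M)) 0; last first.
    by apply: IHs => //; apply: stE => //; exact: mem_head.
  exists a, v; split => //; apply/eqP; rewrite -subr_eq0 -mul_mx_scalar -mulmxBr.
  exact/eqP.
have [|||w' [w'0 [Ew' w'X] ew']] := IH (fun w => E w /\ w *m X = a *: w) w _ w0.
- by split=> [Y Z YL ZL|Y YL]; [apply: cL|apply: sL]; rewrite inE ?YL ?ZL orbT.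
- by split.
- move=> u Y b [Eu uX] YL; split; first by apply: stE => //; rewrite inE YL orbT.
  rewrite /= -mulmxA mulmxBl cL ?inE ?YL ?eqxx ?orbT// mul_scalar_mx -mul_mx_scalar.
  by rewrite -mulmxBr mulmxA uX scalemxAl.
exists w'; split=> // Y; rewrite inE => /orP[/eqP ->|]; last exact: ew'.
by exists a.
Qed.

(** The row space of [v] as the first row of an invertible matrix: this
    completes an eigenvector to a basis. *)
Lemma unitmx_row0 n (v : 'rV[F]_(1 + n)) : v != 0 ->
  exists2 P : 'M[F]_(1 + n), P \in unitmx & (v <= usubmx P)%MS.
Proof.
move=> v0; exists (row_ebase v); first exact: row_ebase_unit.
have vr : \rank v = 1%N by apply/eqP; rewrite eqn_leq rank_leq_row lt0n mxrank_eq0.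
rewrite -{1}(mulmx_ebase v) vr -mulmxA; apply: mulmx_sub.
rewrite -{1}[row_ebase v]vsubmxK.
have -> : pid_mx 1 = row_mx 1%:M 0 :> 'M[F]_(1, 1 + n).
  by rewrite -pid_mx_row.
by rewrite mul_row_col mul1mx mul0mx addr0.
Qed.

(** Put a common eigenvector first; the matrices become block triangular and
    induct to the quotient by this vector, on which they still commute and are
    split. *)
Lemma commuting_split_trigonalizable n (L : seq 'M[F]_n) : commuting_split L ->
  exists2 P : 'M[F]_n, P \in unitmx &
    forall X, X \in L -> is_trig_mx (P *m X *m invmx P).
Proof.
elim: n L => [|n IH] L cL.
  by exists 1%:M => [|X _]; rewrite ?unitmx1//; apply/is_trig_mxP => -[].
have [||w [w0 _ ew]] := @common_eigenvector_split _ L (fun=> True) (const_mx 1) cL _ I.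
  by apply/eqP => /matrixP/(_ 0 0)/eqP; rewrite !mxE oner_eq0.
  by [].
have [P Pu wP] := unitmx_row0 w0.
have Pw : (usubmx P <= w)%MS.
  have rw : \rank w = 1%N.
    by apply/eqP; rewrite eqn_leq rank_leq_row lt0n mxrank_eq0.
  have := (mxrank_leqif_sup wP).2; rewrite rw eq_sym eqn_leq rank_leq_row => <-.
  by rewrite -{1}rw mxrankS.
(* The first row of [P] is a common eigenvector, so [P X P^-1] is block lower
   triangular and [B X] is the action on the quotient; [S] intertwines them. *)
pose B X := drsubmx (P *m X *m invmx P).
have bB X : X \in L -> P *m X *m invmx P =
    block_mx (ulsubmx (P *m X *m invmx P)) 0 (dlsubmx (P *m X *m invmx P)) (B X).
  move=> XL; rewrite -[LHS]submxK; congr block_mx.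
  have [a wX] := ew X XL.
  have PX : usubmx P *m X = a *: usubmx P.
    by case/submxP: Pw => C ->; rewrite -mulmxA wX scalemxAr.
  rewrite /ursubmx -!mul_usub_mx PX -scalemxAl mul_usub_mx mulmxV //.
  by rewrite (scalar_mx_block 1 n) /block_mx col_mxKu linearZ /= row_mxKr scaler0.
pose S : 'M[F]_(1 + n, n) := rsubmx (invmx P).
have PS : dsubmx P *m S = 1%:M.
  rewrite /S mulmx_rsub mul_dsub_mx mulmxV //.
  by rewrite (scalar_mx_block 1 n) -/(drsubmx _) block_mxKdr.
have SB X : X \in L -> S *m B X = X *m S.
  move=> XL; have := congr1 (mulmx (invmx P)) (bB X XL).
  rewrite -!mulmxA mulKmx // -[in RHS](hsubmxK (invmx P)) mul_row_block.
  by move=> /(congr1 rsubmx); rewrite row_mxKr mulmx0 add0r -mulmx_rsub => <-.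
have injS : injective (mulmx S : 'M[F]_n -> _).
  by move=> C D /(congr1 (mulmx (dsubmx P))); rewrite !mulmxA PS !mul1mx.
have [|Q Qu tQ] := IH [seq B X | X <- L].
  split=> [_ _ /mapP[X XL ->] /mapP[Y YL ->]|_ /mapP[X XL ->]].
    apply: injS; rewrite !mulmxA !SB // -!mulmxA !SB // !mulmxA.
    by rewrite cL.1.
  have [s Xs] := cL.2 X XL; exists s; apply: injS.
  by rewrite (split_eval_intertwine _ (SB _ XL)) Xs mul0mx mulmx0.
pose QQ : 'M[F]_(1 + n) := block_mx 1%:M 0 0 Q.
have QQu : QQ \in unitmx by rewrite unitmxE det_ublock det1 mul1r -unitmxE.
exists (QQ *m P) => [|X XL]; first by rewrite unitmx_mul QQu.
have -> : QQ *m P *m X *m invmx (QQ *m P) = QQ *m (P *m X *m invmx P) *m invmx QQ.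
  by rewrite invmx_mul // !mulmxA.
rewrite bB // invmx_block_diag // invmx1 !mulmx_block.
rewrite !(mulmx0, mul0mx, mul1mx, mulmx1, addr0, add0r).
rewrite (@is_trig_block_mx _ 1 n 1 n) // mx11_is_trig eqxx /=; apply: tQ; exact: map_f. 
Qed.

(** If [X] has two eigenvalues, factor an annihilating polynomial of [X] as
    [p * q] with [p] a power of ['X - a] and [q] without root [a].  The kernels
    of [p(X)] and [q(X)] are complementary, nonzero, and stable under everything
    that commutes with [X]. *)
Lemma commuting_split_block n (L : seq 'M[F]_n) X (a b : F) (v w : 'rV[F]_n) :
    commuting_split L -> X \in L -> a != b -> v != 0 -> w != 0 ->
    v *m X = a *: v -> w *m X = b *: w ->
  exists r m (E : (r + m)%N = n) (Q : 'M[F]_(r + m, n)) (Q' : 'M[F]_(n, r + m)),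
    [/\ (0 < r)%N, (0 < m)%N, Q *m Q' = 1%:M, Q' *m Q = 1%:M & forall Y, Y \in L ->
      exists A B, Q *m Y = block_mx A 0 0 B *m Q].
Proof.
case: n L X v w => [|n] L X v w; first by rewrite thinmx0 eqxx.
move=> [cL sL] XL ab v0 w0 vX wX.
have [s Xs] := sL X XL; rewrite split_evalE in Xs.
pose p : {poly F} := \prod_(c <- s | c == a) ('X - c%:P).
pose q : {poly F} := \prod_(c <- s | c != a) ('X - c%:P).
have eig c (u : 'rV[F]_n.+1) (r : {poly F}) : u *m X = c *: u -> u *m horner_mx X r = r.[c] *: u.
  move=> uX; elim/poly_ind: r => [|r d IH]; first by rewrite rmorph0 mulmx0 horner0 scale0r.
  rewrite rmorphD rmorphM /= horner_mx_X horner_mx_C -mulmxE mulmxDr mulmxA IH.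
  by rewrite -scalemxAl uX scalerA mul_mx_scalar -scalerDl !hornerE.
have pq : \prod_(c <- s) ('X - c%:P) = p * q by rewrite (bigID (eq_op^~ a)).
have cpq : coprimep p q.
  rewrite /p /q; apply: (big_ind (fun r => coprimep r q)); first exact: coprime1p.
    by move=> x y; rewrite coprimepMl => -> ->.
  move=> c /eqP ->; rewrite coprimep_sym.
  apply: (big_ind (fun r => coprimep r _)); first exact: coprime1p.
    by move=> x y; rewrite coprimepMl => -> ->.
  by move=> d da; rewrite coprimep_XsubC root_XsubC eq_sym.
pose U := kermxpoly X p; pose W := kermxpoly X q.
have UW : (U + W :=: 1%:M)%MS.
  by apply: eqmx_trans (eqmx_sym (kermxpolyM X cpq)) _; rewrite -pq /kermxpoly Xs; exact: kermx0.
have dUW : (U :&: W = 0)%MS by exact: mxdirect_kermxpoly.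
have root_s c (u : 'rV[F]_n.+1) : u != 0 -> u *m X = c *: u -> c \in s.
  move=> u0 uX; have := eig c u (\prod_(c <- s) ('X - c%:P)) uX.
  rewrite Xs mulmx0 => /esym/eqP; rewrite scaler_eq0 (negPf u0) orbF.
  by rewrite -/(root _ _) root_prod_XsubC.
have vU : (v <= U)%MS.
  apply/sub_kermxP; rewrite (eig _ _ _ vX).
  suff -> : p.[a] = 0 by rewrite scale0r.
  by rewrite /p (big_rem a) ?(root_s _ v) //= eqxx !hornerE subrr mul0r.
have wW : (w <= W)%MS.
  apply/sub_kermxP; rewrite (eig _ _ _ wX).
  suff -> : q.[b] = 0 by rewrite scale0r.
  by rewrite /q (big_rem b) ?(root_s _ w) //= eq_sym ab !hornerE subrr mul0r.
have E : (\rank U + \rank W = n.+1)%N.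
  by have := mxrank_sum_cap U W; rewrite dUW mxrank0 addn0 UW mxrank1.
pose Q := col_mx (row_base U) (row_base W).
have QUW : (Q :=: 1%:M)%MS.
  apply: eqmx_trans UW; apply: eqmx_trans (eqmx_sym (addsmxE _ _)) _.
  by apply: adds_eqmx; exact: eq_row_base.
exists (\rank U), (\rank W), E, Q, (pinvmx Q).
have QQ : pinvmx Q *m Q = 1%:M by rewrite -[pinvmx Q]mul1mx mulmxKpV // QUW.
split=> //.
- by rewrite lt0n mxrank_eq0; apply: contraNneq v0 => U0; rewrite -submx0 -U0.
- by rewrite lt0n mxrank_eq0; apply: contraNneq w0 => W0; rewrite -submx0 -W0.
- have fQ : row_free Q by rewrite /row_free QUW mxrank1 E.
  by apply: (row_free_inj fQ); rewrite -mulmxA QQ mulmx1 mul1mx.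
move=> Y YL.
have st (r : {poly F}) : (row_base (kermxpoly X r) *m Y <= row_base (kermxpoly X r))%MS.
  by rewrite stablemx_row_base; apply: comm_mx_stable_kermxpoly; exact: cL.
have [/submxP[A AE] /submxP[B BE]] := (st p, st q).
exists A, B; rewrite mul_col_mx /Q AE BE mul_block_col !mul0mx addr0 add0r.
by [].
Qed.
End SplitMatrices.

(** * Limits of matrices *)

Lemma ultra_fmap (S T : Type) (U : set_system S) (f : S -> T) :
  UltraFilter U -> UltraFilter (f @ U).
Proof.
move=> UU; split; first exact: fmap_proper_filter.
move=> G GP fUG; apply/seteqP; split=> // A GA.
have [//|NA] := in_ultra_setVsetC (f @^-1` A) UU.
have GC : G (~` A) by exact: fUG.
by have /(@filter_ex _ G GP)[x []] : G (A `&` ~` A) by exact: filterI.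
Qed.

Section MatrixConvergence.
Variables (R : realType) (T : Type).
Implicit Types F : set_system T.

Lemma mx_norm_entry m n (X : 'M[R]_(m, n)) i j : `|X i j| <= `|X|.
Proof. by rewrite [leRHS]/Num.Def.normr/= mx_normrE; exact: (le_bigmax _ _ (i, j)). Qed.

Lemma mx_norm_le m n (X : 'M[R]_(m, n)) c : 0 <= c -> (forall i j, `|X i j| <= c) -> `|X| <= c.
Proof.
by move=> c0 Xc; rewrite /Num.Def.normr/= mx_normrE (bigmax_le _ c0)// => -[i j] _.
Qed.

Lemma cvg_mxP F {FF : Filter F} m n (f : T -> 'M[R]_(m, n)) (A : 'M[R]_(m, n)) :
  f @ F --> A <-> forall i j, (fun t => f t i j) @ F --> A i j.
Proof.
split=> [fA i j|fA].
  apply/cvgrPdist_lt => e e0; near=> t.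
  have := mx_norm_entry (A - f t) i j; rewrite !mxE => /le_lt_trans; apply.
  by near: t; exact: (cvgrPdist_lt _ _).1 fA e e0.
apply/cvgrPdist_le => e e0.
have : \forall t \near F, forall i j, `|A i j - f t i j| <= e.
  apply: filter_forall => i; apply: filter_forall => j.
  exact: ((cvgrPdist_le _ _).1 (fA i j) e e0).
apply: filterS => t H; apply: mx_norm_le; first exact: ltW.
by move=> i j; rewrite !mxE.
Unshelve. all: by end_near. Qed.

Lemma cvg_sumr F {FF : Filter F} (I : Type) (r : seq I) (P : pred I) (f : I -> T -> R) (a : I -> R) :
  (forall i, f i @ F --> a i) ->
  (fun t => \sum_(i <- r | P i) f i t) @ F --> \sum_(i <- r | P i) a i.
Proof.
move=> fa; elim: r => [|i r IH].
  by rewrite big_nil; under eq_fun do rewrite big_nil; exact: cvg_cst.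
rewrite big_cons; under eq_fun do rewrite big_cons.
by case: (P i) => //; apply: cvgD.
Qed.

Lemma cvg_prodr F {FF : Filter F} (I : Type) (r : seq I) (P : pred I) (f : I -> T -> R) (a : I -> R) :
  (forall i, f i @ F --> a i) ->
  (fun t => \prod_(i <- r | P i) f i t) @ F --> \prod_(i <- r | P i) a i.
Proof.
move=> fa; elim: r => [|i r IH].
  by rewrite big_nil; under eq_fun do rewrite big_nil; exact: cvg_cst.
rewrite big_cons; under eq_fun do rewrite big_cons.
by case: (P i) => //; apply: cvgM.
Qed.

Lemma cvg_mulmx F {FF : Filter F} m n p (f : T -> 'M[R]_(m, n)) (g : T -> 'M[R]_(n, p))
    (A : 'M[R]_(m, n)) (B : 'M[R]_(n, p)) :
  f @ F --> A -> g @ F --> B -> (fun t => f t *m g t) @ F --> A *m B.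
Proof.
move=> /cvg_mxP fA /cvg_mxP gB; apply/cvg_mxP => i j.
under eq_fun do rewrite mxE.
by rewrite mxE; apply: cvg_sumr => k; apply: cvgM.
Qed.

Lemma cvg_det F {FF : Filter F} n (f : T -> 'M[R]_n) (A : 'M[R]_n) :
  f @ F --> A -> (fun t => \det (f t)) @ F --> \det A.
Proof.
move=> /cvg_mxP fA; rewrite /determinant; apply: cvg_sumr => s.
apply: cvgM; first exact: cvg_cst.
exact: cvg_prodr.
Qed.

Lemma cvg_scalar_mx F {FF : Filter F} n (f : T -> R) (a : R) :
  f @ F --> a -> (fun t => (f t)%:M : 'M[R]_n) @ F --> (a%:M : 'M[R]_n).
Proof.
move=> fa; apply/cvg_mxP => i j; rewrite mxE; under eq_fun do rewrite mxE.
by case: (i == j) => //; rewrite mulr0n; under eq_fun do rewrite mulr0n; exact: cvg_cst.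
Qed.

Lemma cvg_adj F {FF : Filter F} n (f : T -> 'M[R]_n) (A : 'M[R]_n) :
  f @ F --> A -> (fun t => \adj (f t)) @ F --> \adj A.
Proof.
move=> /cvg_mxP fA; apply/cvg_mxP => i j; rewrite mxE; under eq_fun do rewrite mxE.
apply: cvgM; first exact: cvg_cst.
apply: cvg_det; apply/cvg_mxP => k l; rewrite !mxE; under eq_fun do rewrite !mxE.
exact: fA.
Qed.

Lemma ultra_fin (U : set_system T) {UU : UltraFilter U} (I : finType) (f : T -> I) :
  exists i, U [set t | f t = i].
Proof.
apply: contrapT => /forallNP Nf.
have : \forall t \near U, forall i, f t <> i.
  apply: filter_forall => i.
  by have [/Nf|] := in_ultra_setVsetC [set t | f t = i] UU.
by move=> /filter_ex[t /(_ (f t))].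
Qed.

(** Compactness of bounded sets of matrices.  Working along an ultrafilter
    replaces all extractions of subsequences. *)
Lemma ultra_mx_cvg (U : set_system T) {UU : UltraFilter U} m n (f : T -> 'M[R]_(m, n)) c :
  (\forall t \near U, `|f t| <= c) -> exists A : 'M[R]_(m, n), f @ U --> A.
Proof.
move=> fc.
have H i j : exists a : R, (fun t => f t i j) @ U --> a.
  have := @segment_compact R (- c) c.
  rewrite compact_ultra => /(_ _ (ultra_fmap (fun t => f t i j) UU))[|a [_ ca]].
    apply: (@filterS _ U _ _ _ _ fc) => t ft /=.
    by have := le_trans (mx_norm_entry (f t) i j) ft; rewrite ler_norml in_itv.
  by exists a.
have [A AP] : exists A : 'M[R]_(m, n), forall i j, (fun t => f t i j) @ U --> A i j.
  have /choice[g gP] : forall ij : 'I_m * 'I_n, exists a : R, (fun t => f t ij.1 ij.2) @ U --> a.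
    by move=> ij; exact: H.
  by exists (\matrix_(i, j) g (i, j)) => i j; rewrite mxE; exact: (gP (i, j)).
by exists A; apply/cvg_mxP.
Qed.

End MatrixConvergence.

(** * Limits of diagonalizable families *)

Section ApproximateDiagonalization.
Variable R : realType.

Definition dconj n (P : 'M[R]_n) (d : 'rV[R]_n) : 'M[R]_n :=
  invmx P *m diag_mx d *m P.

(** The limits along [F] of elements of the diagonalizable algebras
    [P_t^-1 D P_t]. *)
Definition dlim T (F : set_system T) n (P : T -> 'M[R]_n) : set 'M[R]_n :=
  [set X | exists d : T -> 'rV[R]_n, (fun t => dconj (P t) (d t)) @ F --> X].

(** The matrices of [L] are approximately simultaneously diagonalizable: they
    are limits of diagonal matrices in one and the same sequence of bases. *)
Definition asd n (L : seq 'M[R]_n) := exists2 P : nat -> 'M[R]_n,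
  (forall k, P k \in unitmx) & forall X, X \in L -> dlim \oo P X.

Definition subalg n (S : set 'M[R]_n) := [/\ S 1%:M,
  forall a X Y, S X -> S Y -> S (a *: X + Y) &
  forall X Y, S X -> S Y -> S (X *m Y)].

Lemma dconj_lin n (P : 'M[R]_n) a d e :
  dconj P (a *: d + e) = a *: dconj P d + dconj P e.
Proof. by rewrite /dconj linearP /= mulmxDr mulmxDl -scalemxAr -scalemxAl. Qed.

Lemma dconj1 n (P : 'M[R]_n) : P \in unitmx -> dconj P (const_mx 1) = 1%:M.
Proof. by move=> Pu; rewrite /dconj diag_const_mx mulmx1 mulVmx. Qed.

Lemma dconjM n (P : 'M[R]_n) d e : P \in unitmx ->
  dconj P d *m dconj P e = dconj P (\row_i (d 0 i * e 0 i)).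
Proof.
move=> Pu; rewrite /dconj !mulmxA -(mulmxA _ P) mulmxV // mulmx1.
by rewrite -[X in X *m P]mulmxA mulmx_diag.
Qed.

Lemma dlim_subalg T (F : set_system T) {FF : Filter F} n (P : T -> 'M[R]_n) :
  (forall t, P t \in unitmx) -> subalg (dlim F P).
Proof.
move=> Pu; split.
- exists (fun=> const_mx 1); under eq_fun do rewrite dconj1 //.
  exact: cvg_cst.
- move=> a X Y [d dX] [e eY]; exists (fun t => a *: d t + e t).
  under eq_fun do rewrite dconj_lin.
  by apply: cvgD => //; apply: cvgZr.
- move=> X Y [d dX] [e eY]; exists (fun t => \row_i (d t 0 i * e t 0 i)).
  under eq_fun do rewrite -dconjM //.
  exact: cvg_mulmx.
Qed.

(** Since [dlim] is an algebra, approximability passes to everything generated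
    by [L]; this is how lists of matrices are traded for convenient ones. *)
Lemma asd_generated n (L L' : seq 'M[R]_n) : asd L ->
  (forall S, subalg S -> (forall X, X \in L -> S X) -> forall Y, Y \in L' -> S Y) ->
  asd L'.
Proof. by move=> [P Pu LP] H; exists P => //; apply: H => //; exact: dlim_subalg. Qed.

Lemma asd_conj n (Q : 'M[R]_n) (L L' : seq 'M[R]_n) : Q \in unitmx -> asd L ->
  (forall X, X \in L' -> Q *m X *m invmx Q \in L) -> asd L'.
Proof.
move=> Qu [P Pu LP] H; exists (fun k => P k *m Q) => [k|X /H/LP[d dX]].
  by rewrite unitmx_mul Pu.
exists d; rewrite /dconj; under eq_fun do rewrite invmx_mul // !mulmxA.
have -> : X = invmx Q *m (Q *m X *m invmx Q) *m Q.
  by rewrite -!mulmxA mulVmx // mulmx1 mulKmx.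
under eq_fun do rewrite -2!(mulmxA (invmx Q)).
apply: cvg_mulmx; last exact: cvg_cst.
by apply: cvg_mulmx; first exact: cvg_cst.
Qed.

(** The sequence in [asd] can be traded for one basis for each [e]; in this form
    approximability is visibly stable under limits. *)
Lemma asd_eps n (L : seq 'M[R]_n) : asd L <-> forall e, 0 < e ->
  exists2 P : 'M[R]_n, P \in unitmx &
    forall X, X \in L -> exists d, `|X - dconj P d| < e.
Proof.
split=> [[P Pu LP] e e0|H].
  have : \forall k \near \oo, forall X, X \in L -> exists d, `|X - dconj (P k) d| < e.
    elim: L LP => [|X L IH] LP; first by apply: filterE.
    have [d dX] := LP X (mem_head _ _).
    have H1 := IH (fun Y YL => LP Y (mem_behead (s := X :: L) YL)).
    near=> k => Y; rewrite inE => /orP[/eqP ->|].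
      by exists (d k); near: k; exact: (cvgrPdist_lt _ _).1 dX e e0.
    by move: Y; near: k.
  by move=> [N _ /(_ N (leqnn N)) H]; exists (P N).
have /choice[P PP] : forall k : nat, exists P : 'M[R]_n, P \in unitmx /\
    forall X, X \in L -> exists d, `|X - dconj P d| < k.+1%:R^-1.
  by move=> k; have [|P] := H k.+1%:R^-1; [rewrite invr_gt0|exists P].
exists P => [k|X XL]; first by have [] := PP k.
have /choice[d dP] : forall k, exists d, `|X - dconj (P k) d| < k.+1%:R^-1.
  by move=> k; apply: (PP k).2.
exists d; apply/cvgrPdist_lt => e e0; near=> k.
apply: lt_trans (dP k) _; near: k; exact: near_infty_natSinv_lt (PosNum e0).
Unshelve. all: by end_near. Qed.

Lemma asd_lim3 n (X Y Z : nat -> 'M[R]_n) x y z :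
  X @ \oo --> x -> Y @ \oo --> y -> Z @ \oo --> z ->
  (forall k, asd [:: X k; Y k; Z k]) -> asd [:: x; y; z].
Proof.
move=> Xx Yy Zz H; apply/asd_eps => e e0.
have e2 : 0 < e / 2 by rewrite divr_gt0.
near \oo => k.
have [P Pu HP] := (asd_eps _).1 (H k) _ e2.
exists P => // W; rewrite !inE => Wx.
have [V VL WV] : exists2 V, V \in [:: X k; Y k; Z k] & `|W - V| < e / 2.
  case/or3P: Wx => /eqP ->.
  - exists (X k); rewrite ?inE ?eqxx ?orbT //; near: k; exact: (cvgrPdist_lt _ _).1 Xx _ e2.
  - exists (Y k); rewrite ?inE ?eqxx ?orbT //; near: k; exact: (cvgrPdist_lt _ _).1 Yy _ e2.
  - exists (Z k); rewrite ?inE ?eqxx ?orbT //; near: k; exact: (cvgrPdist_lt _ _).1 Zz _ e2.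
have [d dV] := HP V VL; exists d.
have -> : W - dconj P d = (W - V) + (V - dconj P d) by rewrite addrA subrK.
by apply: le_lt_trans (ler_normD _ _) _; rewrite (splitr e) ltrD.
Unshelve. all: by end_near. Qed.

Lemma dconj_block r m (P1 : 'M[R]_r) (P2 : 'M[R]_m) d1 d2 :
    P1 \in unitmx -> P2 \in unitmx ->
  dconj (block_mx P1 0 0 P2) (row_mx d1 d2) =
  block_mx (dconj P1 d1) 0 0 (dconj P2 d2).
Proof.
move=> P1u P2u; rewrite /dconj diag_mx_row invmx_block_diag; last first.
  by rewrite block_diag_mx_unit P1u.
by rewrite !mulmx_block !(mulmx0, mul0mx, addr0, add0r).
Qed.

(** Concatenate the two diagonalizing bases. *)
Lemma asd_block r m (L : seq 'M[R]_(r + m)) L1 L2 : asd L1 -> asd L2 ->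
  (forall X, X \in L -> exists A B, [/\ A \in L1, B \in L2 & X = block_mx A 0 0 B]) ->
  asd L.
Proof.
move=> [P Pu HP] [Q Qu HQ] H; exists (fun k => block_mx (P k) 0 0 (Q k)) => [k|X].
  by rewrite block_diag_mx_unit Pu Qu.
move=> /H[A [B [/HP[d dA] /HQ[e eB] ->]]].
exists (fun k => row_mx (d k) (e k)); under eq_fun do rewrite dconj_block //.
apply/cvg_mxP => i j; case: (split_ordP i) => i' ->; case: (split_ordP j) => j' ->;
  rewrite ?(block_mxEul, block_mxEur, block_mxEdl, block_mxEdr).
- under eq_fun do rewrite block_mxEul; exact: (cvg_mxP _ _).1.
- under eq_fun do rewrite block_mxEur; exact: cvg_cst.
- under eq_fun do rewrite block_mxEdl; exact: cvg_cst.
- under eq_fun do rewrite block_mxEdr; exact: (cvg_mxP _ _).1.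
Qed.

(** Stated as a property of [n] because it holds up to [n = 3] for families of
    any length, and is used by induction through [asd_split]. *)
Definition all_asd n := forall L : seq 'M[R]_n, commuting_split L -> asd L.

(** Split the space along two eigenvalues of [X] and approximate in each of the
    two pieces. *)
Lemma asd_split n (L : seq 'M[R]_n) X (a b : R) (v w : 'rV[R]_n) :
    (forall m, (0 < m < n)%N -> all_asd m) ->
    commuting_split L -> X \in L -> a != b -> v != 0 -> w != 0 ->
    v *m X = a *: v -> w *m X = b *: w -> asd L.
Proof.
move=> gd cL XL ab v0 w0 vX wX.
have [r [m [E [Q [Q' [r0 m0 QQ' Q'Q QL]]]]]] := commuting_split_block cL XL ab v0 w0 vX wX.
subst n.
have Qu : Q \in unitmx by case/mulmx1_unit: QQ'.
pose A Y := ulsubmx (Q *m Y *m invmx Q); pose B Y := drsubmx (Q *m Y *m invmx Q).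
have AB Y : Y \in L -> Q *m Y = block_mx (A Y) 0 0 (B Y) *m Q.
  move=> YL; have [A' [B' QY]] := QL Y YL.
  by rewrite /A /B QY mulmxK // block_mxKul block_mxKdr.
have AV Y : Y \in L -> usubmx Q *m Y = A Y *m usubmx Q.
  move=> YL; rewrite mul_usub_mx AB // -{1}[Q]vsubmxK mul_block_col col_mxKu.
  by rewrite mul0mx addr0.
have BV Y : Y \in L -> dsubmx Q *m Y = B Y *m dsubmx Q.
  move=> YL; rewrite mul_dsub_mx AB // -{1}[Q]vsubmxK mul_block_col col_mxKd.
  by rewrite mul0mx add0r.
have fu : row_free (usubmx Q).
  apply/row_freeP; exists (lsubmx (invmx Q)); rewrite mulmx_lsub mul_usub_mx.
  by rewrite mulmxV // scalar_mx_block -/(ulsubmx _) block_mxKul.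
have fd : row_free (dsubmx Q).
  apply/row_freeP; exists (rsubmx (invmx Q)); rewrite mulmx_rsub mul_dsub_mx.
  by rewrite mulmxV // scalar_mx_block -/(drsubmx _) block_mxKdr.
have cs k (V : 'M[R]_(k, r + m)) f : row_free V ->
    (forall Y, Y \in L -> V *m Y = f Y *m V) -> commuting_split [seq f Y | Y <- L].
  move=> fV fVL; split=> [_ _ /mapP[Y YL ->] /mapP[Z ZL ->]|_ /mapP[Y YL ->]].
    by apply: (row_free_inj fV); rewrite -!mulmxA -!fVL // !mulmxA -!fVL // -!mulmxA cL.1.
  exact: split_mx_sub (fVL _ YL) fV (cL.2 _ YL).
have rm : (0 < r < r + m)%N by rewrite r0 -{1}(addn0 r) ltn_add2l.
have mr : (0 < m < r + m)%N by rewrite m0 -{1}(add0n m) ltn_add2r.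
pose L' := [seq Q *m Y *m invmx Q | Y <- L].
apply: (@asd_conj _ Q L') => //; last by move=> Y YL; exact: (map_f (fun Y => Q *m Y *m invmx Q)).
apply: asd_block (gd r rm _ (cs _ _ _ fu AV)) (gd m mr _ (cs _ _ _ fd BV)) _.
move=> _ /mapP[Y YL ->]; exists (A Y), (B Y); rewrite !map_f //; split => //.
by rewrite AB // mulmxK.
Qed.

(** A diagonal entry of a triangular matrix is a root of its characteristic
    polynomial. *)
Lemma eigenvector_trig n (X : 'M[R]_n) i : is_trig_mx X ->
  exists2 v : 'rV[R]_n, v != 0 & v *m X = X i i *: v.
Proof.
case: n X i => [X []//|n X i tX].
have : eigenvalue X (X i i).
  rewrite eigenvalue_root_char (char_poly_trig tX) /root horner_prod.
  by rewrite (bigD1 i) //= !hornerE subrr mul0r.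
by case/eigenvalueP => v vX v0; exists v.
Qed.

End ApproximateDiagonalization.

(** * Sizes two and three *)

(* Both tactics compare matrices of size at most 4 entry by entry. *)
Ltac mx_cases := apply/matrixP => -[[|[|[|[|//]]]] ?] -[[|[|[|[|//]]]] ?] //;
  rewrite !mxE ?big_ord_recl ?big_ord0 /= ?mxE /=.
Ltac trig_cases := apply/is_trig_mxP => -[[|[|[|[|//]]]] ?] -[[|[|[|[|//]]]] ?] //= _; rewrite mxE.

Section SmallSizes.
Variable R : realType.

Definition strict_trig n (X : 'M[R]_n) := forall i j : 'I_n, (i <= j)%N -> X i j = 0.

Lemma strict_trigW n (X : 'M[R]_n) : strict_trig X -> is_trig_mx X.
Proof. by move=> sX; apply/is_trig_mxP => i j /ltnW; exact: sX. Qed.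

Lemma trigD n (X Y : 'M[R]_n) a : is_trig_mx X -> is_trig_mx Y -> is_trig_mx (X + a *: Y).
Proof.
move=> /is_trig_mxP tX /is_trig_mxP tY; apply/is_trig_mxP => i j ij.
by rewrite !mxE tX // tY // mulr0 addr0.
Qed.

Lemma asd_trig_split n (L : seq 'M[R]_n) X i j :
    (forall m, (0 < m < n)%N -> all_asd R m) ->
    (forall X Y, X \in L -> Y \in L -> X *m Y = Y *m X) ->
    (forall X, X \in L -> is_trig_mx X) -> X \in L -> X i i != X j j -> asd L.
Proof.
move=> gd cL tL XL ij.
have [v v0 vX] := eigenvector_trig i (tL X XL).
have [w w0 wX] := eigenvector_trig j (tL X XL).
apply: (asd_split gd _ XL ij v0 w0 vX wX); split => // Y YL.
exact/split_mx_trig/tL.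
Qed.

Lemma subalg0 n (S : set 'M[R]_n) : subalg S -> S 0.
Proof.
by move=> [S1 SD _]; have := SD (-1) _ _ S1 S1; rewrite scaleN1r addNr.
Qed.

Lemma subalgL n (S : set 'M[R]_n) a X Y : subalg S -> S X -> S Y -> S (a *: X + Y).
Proof. by move=> [_ SL _]; exact: SL. Qed.

Lemma subalgM n (S : set 'M[R]_n) X Y : subalg S -> S X -> S Y -> S (X *m Y).
Proof. by move=> [_ _ SM]; exact: SM. Qed.

Lemma subalgZ n (S : set 'M[R]_n) a X : subalg S -> S X -> S (a *: X).
Proof. by move=> Sa SX; rewrite -[_ *: _]addr0; apply: subalgL => //; exact: subalg0. Qed.

Lemma subalgD n (S : set 'M[R]_n) X Y : subalg S -> S X -> S Y -> S (X + Y).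
Proof. by move=> Sa SX SY; rewrite -[X]scale1r; apply: subalgL. Qed.

Lemma asd_nil n : asd (nil : seq 'M[R]_n).
Proof. by exists (fun=> 1%:M) => // k; exact: unitmx1. Qed.

(** Reduction to strictly triangular matrices: after a common triangularization,
    either some matrix has two distinct diagonal entries and the space splits,
    or subtracting the diagonal entry leaves a strictly triangular matrix. *)
Lemma asd_strict n (L : seq 'M[R]_n.+1) :
    (forall m, (0 < m < n.+1)%N -> all_asd R m) -> commuting_split L ->
    (forall L' : seq 'M[R]_n.+1, size L' = size L -> (forall X, X \in L' -> strict_trig X) ->
      (forall X Y, X \in L' -> Y \in L' -> X *m Y = Y *m X) -> asd L') ->
  asd L.
Proof.
move=> gd cL H; have [P Pu tP] := commuting_split_trigonalizable cL.
pose h X := P *m X *m invmx P; pose L1 := [seq h X | X <- L].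
suff aL1 : asd L1 by apply: (asd_conj Pu aL1) => X XL; exact: (map_f h).
have c1 X Y : X \in L1 -> Y \in L1 -> X *m Y = Y *m X.
  move=> /mapP[X' XL ->] /mapP[Y' YL ->].
  rewrite /h !mulmxA -(mulmxA _ (invmx P)) mulVmx // mulmx1.
  rewrite -(mulmxA _ (invmx P) P) mulVmx // mulmx1.
  by rewrite -!(mulmxA P) (cL.1 X' Y').
have t1 X : X \in L1 -> is_trig_mx X by move=> /mapP[X' XL ->]; exact: tP.
have [[X [i [j [XL ij]]]]|N] :=
    pselect (exists X i j, X \in L1 /\ X i i != X j j).
  exact: (asd_trig_split gd c1 t1 XL ij).
pose k (X : 'M[R]_n.+1) := X - (X 0 0)%:M.
have : asd [seq k X | X <- L1].
  apply: H; first by rewrite !size_map.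
    move=> _ /mapP[X XL ->] i j; rewrite leq_eqVlt => /orP[/eqP/val_inj ->|ij].
      rewrite !mxE eqxx mulr1n; apply/eqP; rewrite subr_eq0; apply/negPn/negP => ?.
      by apply: N; exists X, j, 0.
    have /is_trig_mxP tX := t1 X XL; rewrite !mxE tX // sub0r.
    by rewrite -val_eqE /= (ltn_eqF ij) mulr0n oppr0.
  move=> _ _ /mapP[X XL ->] /mapP[Y YL ->].
  apply: comm_mxB; last exact: comm_mx_scalar.
  by apply/comm_mx_sym/comm_mxB; [exact: c1|exact: comm_mx_scalar].
move=> /asd_generated; apply => S Sa SL X XL.
have -> : X = (X 0 0) *: 1%:M + k X by rewrite /k scalemx1 addrC subrK.
by apply: subalgL => //; [case: Sa|apply: SL; exact: (map_f k)].
Qed.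

(** Adding a small multiple of [Z] to [X] keeps the triple commuting and
    triangular, and gives the perturbed matrix two eigenvalues, so that the
    space splits for every nonzero perturbation. *)
Lemma asd_perturbation n (X Y W Z : 'M[R]_n) i j :
    (forall m, (0 < m < n)%N -> all_asd R m) ->
    strict_trig X -> strict_trig Y -> strict_trig W -> is_trig_mx Z ->
    X *m Y = Y *m X -> X *m W = W *m X -> Y *m W = W *m Y ->
    Z *m Y = Y *m Z -> Z *m W = W *m Z -> Z i i != Z j j -> asd [:: X; Y; W].
Proof.
move=> gd sX sY sW tZ XY XW YW ZY ZW ij.
pose t k : R := k.+1%:R^-1.
have t0 : t @ \oo --> (0 : R).
  apply/cvgrPdist_lt => e e0; near=> k; rewrite sub0r normrN ger0_norm ?invr_ge0 //.
  near: k; exact: near_infty_natSinv_lt (PosNum e0).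
apply: (@asd_lim3 _ _ (fun k => X + t k *: Z) (fun=> Y) (fun=> W)).
- rewrite -[X in _ --> X]addr0 -(scale0r Z); apply: cvgD; first exact: cvg_cst.
  exact: cvgZl.
- exact: cvg_cst.
- exact: cvg_cst.
move=> k; apply: (@asd_trig_split _ _ (X + t k *: Z) i j) => //.
- have c1 V : X *m V = V *m X -> Z *m V = V *m Z -> (X + t k *: Z) *m V = V *m (X + t k *: Z).
    by move=> XV ZV; rewrite mulmxDl mulmxDr XV -scalemxAl ZV scalemxAr.
  move=> A B; rewrite !inE => /or3P[] /eqP -> /or3P[] /eqP -> //; rewrite ?c1 //.
- move=> A; rewrite !inE => /or3P[] /eqP ->; [|exact: strict_trigW..].
  by apply: trigD => //; exact: strict_trigW.
- by rewrite mem_head.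
- rewrite !mxE !sX // !add0r (inj_eq (mulfI _)) //.
  by rewrite invr_eq0.
Unshelve. all: by end_near. Qed.

Lemma all_asd1 : all_asd R 1.
Proof.
move=> L cL; apply: asd_strict => //.
  by move=> [|[]].
move=> L' _ sL _; apply: asd_generated (asd_nil 1) _ => S Sa _ X XL.
suff -> : X = 0 by exact: subalg0.
by apply/matrixP => i j; rewrite mxE (sL X XL) // !ord1.
Qed.

Definition E10 : 'M[R]_2 := \matrix_(i, j) nth 0 (nth [::] [:: [:: 0; 0]; [:: 1; 0]] i) j.

Lemma all_asd2 : all_asd R 2.
Proof.
have gd m : (0 < m < 2)%N -> all_asd R m by case: m => [|[|]] // _; exact: all_asd1.
move=> L cL; apply: asd_strict => // L' _ sL _.
have : asd [:: E10; 0; 0].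
  apply: (@asd_perturbation _ _ _ _ (delta_mx 1 1) 0 1) => //; rewrite ?(mulmx0, mul0mx) //.
  - by move=> [[|[]]//?] [[|[]]//?] //= _; rewrite mxE.
  - by move=> ? ?; rewrite mxE.
  - by move=> ? ?; rewrite mxE.
  - by apply/is_trig_mxP => -[[|[]]//?] [[|[]]//?] //= _; rewrite mxE.
  - by rewrite !mxE /= eq_sym oner_eq0.
move=> /asd_generated; apply => S Sa SL X XL.
suff -> : X = X 1 0 *: E10 by apply: subalgZ => //; apply: SL; rewrite mem_head.
apply/matrixP => -[[|[]]//?] [[|[]]//?] //; rewrite !mxE /= ?mulr0 ?mulr1; try (by rewrite (sL X XL)).
by congr (X _ _); apply: val_inj.
Qed.

Definition lt3 (a b d : R) : 'M[R]_3 := \matrix_(i < 3, j < 3)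
  (nth 0 (nth [::] [:: [:: 0; 0; 0]; [:: a; 0; 0]; [:: b; d; 0]] i) j).

Lemma lt3E X : strict_trig X -> exists a b d, X = lt3 a b d.
Proof.
move=> sX; exists (X 1 0), (X (inord 2) 0), (X (inord 2) 1).
apply/matrixP => -[[|[|[|//]]] ?] -[[|[|[|//]]] ?] //; rewrite !mxE /=; try (by rewrite sX);
  congr (X _ _); apply: val_inj; rewrite /= ?inordK //.
Qed.

Lemma lt3_strict a b d : strict_trig (lt3 a b d).
Proof. by move=> -[[|[|[|//]]] ?] -[[|[|[|//]]] ?] //=; rewrite mxE. Qed.

(** Two strictly triangular matrices of size 3 commute if and only if their
    entries [(a, d)] are proportional.  So the family is contained in the span
    of one matrix with entries [al], [be] and of the corner matrix.  Perturb the
    former by the middle diagonal unit, which commutes with the corner. *)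
Lemma all_asd3 : all_asd R 3.
Proof.
have gd m : (0 < m < 3)%N -> all_asd R m.
  by case: m => [|[|[|]]] // _; [exact: all_asd1|exact: all_asd2].
move=> L cL; apply: asd_strict => // L' _ sL cL'.
have [al [be H]] : exists al be, forall X, X \in L' -> exists k b, X = lt3 (k * al) b (k * be).
  have [[X [XL]]|N] := pselect (exists X, X \in L' /\ (X 1 0 != 0 \/ X (inord 2) 1 != 0)).
    have [a [b [d XE]]] := lt3E (sL X XL).
    have -> : X 1 0 = a by rewrite XE mxE.
    have -> : X (inord 2) 1 = d by rewrite XE mxE /= inordK.
    move=> ad; exists a, d => Y YL; have [a' [b' [d' YE]]] := lt3E (sL Y YL).
    have : d * a' = d' * a.
      have /matrixP/(_ (inord 2) 0) := cL' X Y XL YL.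
      by rewrite XE YE !mxE !big_ord_recl !big_ord0 !mxE /= !inordK //= !(mul0r, mulr0, addr0, add0r).
    move=> E; case: ad => [a0|d0].
      exists (a' / a), b'; rewrite YE; congr lt3; first by rewrite divfK.
      by apply: (mulfI a0); rewrite mulrC -E; field.
    exists (d' / d), b'; rewrite YE; congr lt3; last by rewrite divfK.
    by apply: (mulfI d0); rewrite E; field.
  exists 0, 0 => X XL; have [a [b [d XE]]] := lt3E (sL X XL).
  have a0 : a = 0.
    by apply/eqP/negPn/negP => a0; apply: N; exists X; split => //; left; rewrite XE mxE.
  have d0 : d = 0.
    by apply/eqP/negPn/negP => d0; apply: N; exists X; split => //; right; rewrite XE mxE /= inordK.
  by exists 0, b; rewrite XE a0 d0 mulr0.
have : asd [:: lt3 al 0 be; lt3 0 1 0; 0].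
  apply: (@asd_perturbation _ _ _ _ (delta_mx 1 1) 0 1) => //; rewrite ?(mulmx0, mul0mx) //;
    try exact: lt3_strict.
  - by move=> ? ?; rewrite mxE.
  - by apply/is_trig_mxP => -[[|[|[|//]]] ?] -[[|[|[|//]]] ?] //= _; rewrite mxE.
  - by mx_cases; ring.
  - by mx_cases; ring.
  - by rewrite !mxE /= eq_sym oner_eq0.
move=> /asd_generated; apply => S Sa SL X XL.
have [k [b ->]] := H X XL.
suff -> : lt3 (k * al) b (k * be) = k *: lt3 al 0 be + b *: lt3 0 1 0.
  by apply: subalgL => //; [|apply: subalgZ => //]; apply: SL; rewrite !inE eqxx ?orbT.
by mx_cases; ring.
Qed.

End SmallSizes.

(** * Size four: generators with a nonzero middle entry *)

Section SizeFour.
Variable R : realType.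

Definition mx4 (s : seq (seq R)) : 'M[R]_4 :=
  \matrix_(i < 4, j < 4) nth 0 (nth [::] s i) j.

Definition lt4 (a b c d e f : R) : 'M[R]_4 :=
  mx4 [:: [:: 0; 0; 0; 0]; [:: a; 0; 0; 0]; [:: b; d; 0; 0]; [:: c; e; f; 0]].

Lemma lt4E X : strict_trig X -> exists a b c d e f, X = lt4 a b c d e f.
Proof.
move=> sX; exists (X 1 0), (X (inord 2) 0), (X (inord 3) 0), (X (inord 2) 1),
  (X (inord 3) 1), (X (inord 3) (inord 2)).
apply/matrixP => -[[|[|[|[|//]]]] ?] -[[|[|[|[|//]]]] ?] //; rewrite !mxE /=;
  try (by rewrite sX); congr (X _ _); apply: val_inj; rewrite /= ?inordK //.
Qed.

Lemma lt4_strict a b c d e f : strict_trig (lt4 a b c d e f).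
Proof. by move=> -[[|[|[|[|//]]]] ?] -[[|[|[|[|//]]]] ?] //=; rewrite mxE. Qed.

Lemma strict0 : strict_trig (0 : 'M[R]_4).
Proof. by move=> ? ?; rewrite mxE. Qed.

Lemma lt4M a b c d e f a' b' c' d' e' f' :
  lt4 a b c d e f *m lt4 a' b' c' d' e' f' =
  lt4 0 (d * a') (e * a' + f * b') 0 (f * d') 0.
Proof. by mx_cases; ring. Qed.

Lemma lt4L k a b c d e f a' b' c' d' e' f' :
  k *: lt4 a b c d e f + lt4 a' b' c' d' e' f' =
  lt4 (k * a + a') (k * b + b') (k * c + c') (k * d + d') (k * e + e') (k * f + f').
Proof. by mx_cases; ring. Qed.

Lemma lt4Z k a b c d e f : k *: lt4 a b c d e f =
  lt4 (k * a) (k * b) (k * c) (k * d) (k * e) (k * f).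
Proof. by mx_cases; ring. Qed.

Lemma lt4_inj a b c d e f a' b' c' d' e' f' :
  lt4 a b c d e f = lt4 a' b' c' d' e' f' ->
  [/\ a = a', b = b', c = c' & [/\ d = d', e = e' & f = f']].
Proof.
move=> /matrixP E; split; last split.
- by have := E 1 0; rewrite !mxE.
- by have := E (inord 2) 0; rewrite !mxE /= !inordK.
- by have := E (inord 3) 0; rewrite !mxE /= !inordK.
- by have := E (inord 2) 1; rewrite !mxE /= !inordK.
- by have := E (inord 3) 1; rewrite !mxE /= !inordK.
- by have := E (inord 3) (inord 2); rewrite !mxE /= !inordK.
Qed.

Lemma lt4_comm a b c d e f a' b' c' d' e' f' :
  lt4 a b c d e f *m lt4 a' b' c' d' e' f' = lt4 a' b' c' d' e' f' *m lt4 a b c d e f ->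
  [/\ d * a' = d' * a, e * a' + f * b' = e' * a + f' * b & f * d' = f' * d].
Proof. by rewrite !lt4M => /lt4_inj[_ ? ? [_ ? _]]. Qed.

Lemma all_asd_lt4 m : (0 < m < 4)%N -> all_asd R m.
Proof.
by case: m => [|[|[|[|]]]] // _; [exact: all_asd1|exact: all_asd2|exact: all_asd3].
Qed.

Definition E30 := lt4 0 0 1 0 0 0.

(** A matrix with [d = 1] together with its powers and the corner matrix.  If
    [al] and [be] are nonzero the corner is a multiple of the cube of the
    matrix, which is perturbed by the last diagonal unit.  If one of them
    vanishes the matrix has a kernel vector and a cokernel vector whose product
    is 1; the rank one idempotent that they form commutes with it, and serves to
    perturb the corner. *)
Lemma asd_entry21 al b c e be : (al != 0) || (be != 0) ->
  asd [:: lt4 al b c 1 e be; E30; 0].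
Proof.
have [-> /= be0|al0 _] := eqVneq al 0.
  (* The idempotent has the kernel vector as first column and zeros elsewhere. *)
  have : asd [:: E30; lt4 0 b c 1 e be; 0].
    apply: (@asd_perturbation _ _ _ _ _
      (mx4 [:: [:: 1; 0; 0; 0]; [:: - b; 0; 0; 0]; [:: (e * b - c) / be; 0; 0; 0]; [:: 0; 0; 0; 0]]) 0 1 all_asd_lt4) => //;
      try exact: lt4_strict; try exact: strict0; rewrite ?(mulmx0, mul0mx) //.
    - by trig_cases.
    - by rewrite !lt4M; congr lt4; ring.
    - by mx_cases; field.
    - by rewrite !mxE /= oner_eq0.
  by move=> /asd_generated; apply => S _ SL X; rewrite !inE => /or3P[] /eqP ->; apply: SL; rewrite !inE eqxx ?orbT.
have [->|be0] := eqVneq be 0.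
  (* The idempotent has the cokernel vector as last row and zeros elsewhere. *)
  have : asd [:: E30; lt4 al b c 1 e 0; 0].
    apply: (@asd_perturbation _ _ _ _ _
      (mx4 [:: [:: 0; 0; 0; 0]; [:: 0; 0; 0; 0]; [:: 0; 0; 0; 0]; [:: 0; (e * b - c) / al; - e; 1]]) ord_max 0 all_asd_lt4) => //;
      try exact: lt4_strict; try exact: strict0; rewrite ?(mulmx0, mul0mx) //.
    - by trig_cases.
    - by rewrite !lt4M; congr lt4; ring.
    - by mx_cases; field.
    - by rewrite !mxE /= oner_eq0.
  by move=> /asd_generated; apply => S _ SL X; rewrite !inE => /or3P[] /eqP ->; apply: SL; rewrite !inE eqxx ?orbT.
have : asd [:: lt4 al b c 1 e be; 0; 0].
  apply: (@asd_perturbation _ _ _ _ _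
      (mx4 [:: [:: 0; 0; 0; 0]; [:: 0; 0; 0; 0]; [:: 0; 0; 0; 0]; [:: 0; 0; 0; 1]]) ord_max 0 all_asd_lt4) => //;
      try exact: lt4_strict; try exact: strict0; rewrite ?(mulmx0, mul0mx) //.
  - by trig_cases.
  - by rewrite !mxE /= oner_eq0.
move=> /asd_generated; apply => S Sa SL.
have SN : S (lt4 al b c 1 e be) by apply: SL; rewrite mem_head.
move=> X; rewrite !inE => /or3P[] /eqP -> //; last exact: subalg0.
have -> : E30 = (al * be)^-1 *: (lt4 al b c 1 e be *m (lt4 al b c 1 e be *m lt4 al b c 1 e be)).
  by rewrite !lt4M lt4Z; congr lt4; field; rewrite ?al0 ?be0.
by apply: subalgZ => //; do !apply: subalgM => //.
Qed.

(** When [al = be = 0], adding [t] times the matrix with entries [x], [y] at the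
    places of [al], [be] keeps the triple commuting; the square of the perturbed
    matrix recovers, up to the corner, [t] times the third generator. *)
Lemma asd_entry21_degenerate b c e x y : (x != 0) || (y != 0) ->
  asd [:: lt4 0 b c 1 e 0; E30; lt4 0 x 0 0 y 0].
Proof.
move=> xy; pose t k : R := k.+1%:R^-1.
have t0 : t @ \oo --> (0 : R).
  apply/cvgrPdist_lt => e' e0; near=> k; rewrite sub0r normrN ger0_norm ?invr_ge0 //.
  near: k; exact: near_infty_natSinv_lt (PosNum e0).
apply: (@asd_lim3 _ _ (fun k => lt4 (t k * x) b c 1 e (t k * y)) (fun=> E30) (fun=> lt4 0 x 0 0 y 0)).
- have -> : (fun k => lt4 (t k * x) b c 1 e (t k * y)) =
      (fun k => lt4 0 b c 1 e 0 + t k *: lt4 x 0 0 0 0 y).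
    by apply/funext => k; rewrite addrC lt4L; congr lt4; ring.
  rewrite -[X in _ --> X]addr0 -(scale0r (lt4 x 0 0 0 0 y)).
  by apply: cvgD; [exact: cvg_cst|exact: cvgZl].
- exact: cvg_cst.
- exact: cvg_cst.
move=> k; have tk : t k != 0 by rewrite invr_eq0.
have : asd [:: lt4 (t k * x) b c 1 e (t k * y); E30; 0].
  by apply: asd_entry21; rewrite !mulf_eq0 !negb_or tk.
move=> /asd_generated; apply => S Sa SL.
have SN : S (lt4 (t k * x) b c 1 e (t k * y)) by apply: SL; rewrite mem_head.
have SE : S E30 by apply: SL; rewrite !inE eqxx orbT.
move=> X; rewrite !inE => /or3P[] /eqP -> //.
have -> : lt4 0 x 0 0 y 0 = (t k)^-1 *: (lt4 (t k * x) b c 1 e (t k * y) *m lt4 (t k * x) b c 1 e (t k * y))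
    + (- (e * x + y * b)) *: E30.
  by rewrite lt4M !lt4Z -[X in _ + X]scale1r addrC lt4L; congr lt4; field.
by apply: subalgD => //; apply: subalgZ => //; apply: subalgM.
Unshelve. all: by end_near. Qed.

(** Here all three matrices map the span of two basis vectors into that of the
    other two.  The idempotent is chosen so as to fix the second matrix on both
    sides and to kill the third one. *)
Lemma asd_hom22 b c e p q :
  asd [:: lt4 0 b c 1 e 0; lt4 0 1 p 0 0 0; lt4 0 0 q 0 1 0].
Proof.
apply: (@asd_perturbation _ _ _ _ _
      (mx4 [:: [:: 1; 0; 0; 0]; [:: - q; 0; 0; 0]; [:: 0; 0; 1; 0]; [:: 0; 0; p; 0]]) 0 1 all_asd_lt4) => //;
      try exact: lt4_strict; try (by rewrite !lt4M; congr lt4; ring); try (by mx_cases; ring).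
- by trig_cases.
- by rewrite !mxE /= oner_eq0.
Qed.

End SizeFour.

Section NonzeroMiddleEntry.
Variable R : realType.

(** After scaling and subtracting multiples of [N1], whose normalization is [M],
    the matrices [N2] and [N3] have only the entries [b], [c], [e], subject to
    [be * b = e * al].  If [(al, be)] is nonzero they are combinations of
    [M ^ 2] and the corner; otherwise they are arbitrary, and what matters is
    whether their vectors [(b, e)] are independent. *)
Lemma asd_triple_entry21 (N1 N2 N3 : 'M[R]_4) a b c d e f :
    strict_trig N2 -> strict_trig N3 -> N1 = lt4 a b c d e f -> d != 0 ->
    N1 *m N2 = N2 *m N1 -> N1 *m N3 = N3 *m N1 ->
  asd [:: N1; N2; N3].
Proof.
move=> s2 s3 N1E d0 c12 c13.
pose al := a / d; pose be := f / d; pose b1 := b / d; pose c1 := c / d; pose e1 := e / d.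
pose M := lt4 al b1 c1 1 e1 be.
have NM : N1 = d *: M by rewrite N1E lt4Z; congr lt4; rewrite /al /be /b1 /c1 /e1; field.
have red N : strict_trig N -> N1 *m N = N *m N1 ->
    exists k b' c' e', N = k *: M + lt4 0 b' c' 0 e' 0 /\ be * b' = e' * al.
  move=> /lt4E[a' [b' [c' [d' [e' [f' ->]]]]]]; rewrite N1E => /lt4_comm[E1 E2 E3].
  exists d', (b' - d' * b1), (c' - d' * c1), (e' - d' * e1); split.
    rewrite lt4L; congr lt4; rewrite ?mulr1 ?addr0 /al /be; try ring.
      by apply: (mulfI d0); rewrite E1; field.
    by apply: (mulfI d0); rewrite [d * f']mulrC -E3; field.
  have : d * (be * (b' - d' * b1)) = d * ((e' - d' * e1) * al); last exact: mulfI.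
  rewrite /be /al /b1 /e1.
  apply: (mulfI d0).
  have -> : d * (d * (f / d * (b' - d' * (b / d)))) = d * f * b' - (f * d') * b by field.
  have -> : d * (d * ((e' - d' * (e / d)) * (a / d))) = d * (e' * a) - e * (d' * a) by field.
  rewrite E3 -E1.
  have -> : d * (e' * a) - e * (d * a') = d * (e' * a - e * a') by ring.
  have -> : e' * a - e * a' = f * b' - f' * b.
    by move: E2; lra.
  by ring.
have [k2 [b2 [c2 [e2 [N2E E2]]]]] := red N2 s2 c12.
have [k3 [b3 [c3 [e3 [N3E E3]]]]] := red N3 s3 c13.
(* It suffices to approximate [M] and any two matrices [X], [Y] such that the
   algebra they generate contains the reduced forms of [N2] and [N3]. *)
have conclude (X Y : 'M[R]_4) : asd [:: M; X; Y] ->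
    (forall S, subalg S -> S M -> S X -> S Y -> S (lt4 0 b2 c2 0 e2 0) /\ S (lt4 0 b3 c3 0 e3 0)) ->
    asd [:: N1; N2; N3].
  move=> /asd_generated aM H; apply: aM => S Sa SL.
  have SM : S M by apply: SL; rewrite mem_head.
  have SX : S X by apply: SL; rewrite !inE eqxx orbT.
  have SY : S Y by apply: SL; rewrite !inE eqxx !orbT.
  have [S2 S3] := H S Sa SM SX SY.
  move=> Z; rewrite !inE => /or3P[] /eqP ->.
  - by rewrite NM; exact: subalgZ.
  - by rewrite N2E; exact: subalgL.
  - by rewrite N3E; exact: subalgL.
have [ab|] := boolP ((al != 0) || (be != 0)).
  apply: (conclude _ _ (asd_entry21 b1 c1 e1 ab)) => S Sa SM SE _.
  suff H b' c' e' : be * b' = e' * al -> S (lt4 0 b' c' 0 e' 0) by split; exact: H.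
  move=> E.
  have [m [mb me]] : exists m, b' = m * al /\ e' = m * be.
    have [a0|a0] := eqVneq al 0.
      rewrite a0 eqxx /= in ab; exists (e' / be); rewrite divfK //; split => //.
      by apply: (mulfI ab); rewrite E a0; ring.
    by exists (b' / al); rewrite divfK //; split => //; apply: (mulIf a0); rewrite -E; field.
  have -> : lt4 0 b' c' 0 e' 0 = m *: (M *m M) + (c' - m * (e1 * al + be * b1)) *: (E30 R).
    by rewrite lt4M !lt4Z -[X in _ + X]scale1r addrC lt4L; congr lt4; rewrite ?mb ?me; ring.
  by apply: subalgL => //; [exact: subalgM|exact: subalgZ].
rewrite negb_or !negbK => /andP[/eqP al0 /eqP be0].
have ME : M = lt4 0 b1 c1 1 e1 0 by rewrite /M al0 be0.
have [D0|D0] := eqVneq (b2 * e3 - b3 * e2) 0.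
  have [x [y [xy H]]] : exists x y, ((x != 0) || (y != 0)) /\
      exists m2 m3, [/\ b2 = m2 * x, e2 = m2 * y, b3 = m3 * x & e3 = m3 * y].
    move: D0 => /eqP; rewrite subr_eq0 => /eqP D0.
    have [b20|b20] := eqVneq b2 0; last first.
      exists b2, e2; rewrite b20; split => //; exists 1, (b3 / b2); rewrite !mul1r divfK //.
      by split => //; apply: (mulfI b20); rewrite D0; field.
    have [e20|e20] := eqVneq e2 0; last first.
      exists b2, e2; rewrite e20 orbT; split => //; exists 1, (e3 / e2); rewrite !mul1r divfK //.
      by split => //; apply: (mulIf e20); rewrite -D0 b20; ring.
    have [b30|b30] := boolP ((b3 != 0) || (e3 != 0)).
      by exists b3, e3; split => //; exists 0, 1; rewrite !mul1r !mul0r.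
    move: b30; rewrite negb_or !negbK => /andP[/eqP b30 /eqP e30].
    by exists 1, 0; rewrite oner_eq0; split => //; exists 0, 0; rewrite !mul0r.
  have := asd_entry21_degenerate b1 c1 e1 xy; rewrite -ME => /conclude; apply => S Sa _ SE SXY.
  have [m2 [m3 [-> -> -> ->]]] := H.
  have HH m c' : lt4 0 (m * x) c' 0 (m * y) 0 = m *: lt4 0 x 0 0 y 0 + c' *: (E30 R).
    by rewrite !lt4Z -[X in _ + X]scale1r addrC lt4L; congr lt4; ring.
  by rewrite !HH; split; apply: subalgL => //; exact: subalgZ.
pose D := b2 * e3 - b3 * e2.
have := asd_hom22 b1 c1 e1 ((e3 * c2 - e2 * c3) / D) ((b2 * c3 - b3 * c2) / D).
rewrite -ME => /conclude; apply => S Sa _ SX SY.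
split.
  have -> : lt4 0 b2 c2 0 e2 0 = b2 *: lt4 0 1 ((e3 * c2 - e2 * c3) / D) 0 0 0 +
      e2 *: lt4 0 0 ((b2 * c3 - b3 * c2) / D) 0 1 0.
    rewrite !lt4Z -[X in _ + X]scale1r addrC lt4L; congr lt4; rewrite /D; try ring.
    by field.
  by apply: subalgL => //; exact: subalgZ.
have -> : lt4 0 b3 c3 0 e3 0 = b3 *: lt4 0 1 ((e3 * c2 - e2 * c3) / D) 0 0 0 +
      e3 *: lt4 0 0 ((b2 * c3 - b3 * c2) / D) 0 1 0.
  rewrite !lt4Z -[X in _ + X]scale1r addrC lt4L; congr lt4; rewrite /D; try ring.
  by field.
by apply: subalgL => //; exact: subalgZ.
Qed.
End NonzeroMiddleEntry.

(** * Size four: all middle entries vanish *)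

Section ZeroMiddleEntry.
Variable R : realType.

(** The diagonal unit at place 1 kills the second matrix on both sides, hence
    may be used to perturb the first one. *)
Lemma asd_middle_adapted (a b c e f b' c' f' : R) : f * b' = f' * b ->
  asd [:: lt4 a b c 0 e f; lt4 0 b' c' 0 0 f'; E30 R].
Proof.
move=> E; apply: (@asd_perturbation _ _ _ _ _
  (mx4 [:: [:: 0; 0; 0; 0]; [:: 0; 1; 0; 0]; [:: 0; 0; 0; 0]; [:: 0; 0; 0; 0]]) 1 0 (@all_asd_lt4 R));
  try exact: lt4_strict; try (by rewrite !lt4M; congr lt4; ring).
- by trig_cases.
- by rewrite !lt4M; congr lt4; move: E; lra.
- by mx_cases; ring.
- by mx_cases; ring.
- by rewrite !mxE /= oner_eq0.
Qed.

(** Changes of basis of the two middle coordinates.  With determinant 1 the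
    inverse is explicit. *)
Definition block121 (x y z w : R) : 'M[R]_4 :=
  mx4 [:: [:: 1; 0; 0; 0]; [:: 0; x; y; 0]; [:: 0; z; w; 0]; [:: 0; 0; 0; 1]].

Lemma block121_conj x y z w a b c e f : 
  block121 x y z w *m lt4 a b c 0 e f *m block121 w (- y) (- z) x =
  lt4 (x * a + y * b) (z * a + w * b) c 0 (e * w - f * z) (f * x - e * y).
Proof.
have -> : block121 x y z w *m lt4 a b c 0 e f = lt4 (x * a + y * b) (z * a + w * b) c 0 e f.
  by mx_cases; ring.
by mx_cases; ring.
Qed.

(** The change of basis brings the second matrix into the form of
    [asd_middle_adapted]. *)
Lemma asd_middle (a b c e f a' b' c' e' f' x y z w : R) :
    x * w - y * z = 1 -> e * a' + f * b' = e' * a + f' * b ->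
    x * a' + y * b' = 0 -> e' * w = f' * z ->
  asd [:: lt4 a b c 0 e f; lt4 a' b' c' 0 e' f'; E30 R].
Proof.
move=> D E xab efzw.
have MM : block121 x y z w *m block121 w (- y) (- z) x = 1%:M.
  mx_cases; rewrite ?mulr0 ?mul0r ?mulr1 ?addr0 ?add0r //=; try ring; rewrite -D; ring.
have [Mu _] := mulmx1_unit MM.
have Mi : invmx (block121 x y z w) = block121 w (- y) (- z) x.
  by apply: (can_inj (mulKmx Mu)); rewrite mulmxV.
pose L := [:: lt4 (x * a + y * b) (z * a + w * b) c 0 (e * w - f * z) (f * x - e * y);
   lt4 0 (z * a' + w * b') c' 0 0 (f' * x - e' * y); E30 R].
apply: (@asd_conj _ _ _ L) Mu _ _.
  apply: asd_middle_adapted.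
  have : (x * w - y * z) * (e * a' + f * b') = (x * w - y * z) * (e' * a + f' * b) by rewrite E.
  have X1 : (e * w - f * z) * (x * a' + y * b') = 0 by rewrite xab mulr0.
  have X2 : (e' * w - f' * z) * (x * a + y * b) = 0 by rewrite efzw subrr mul0r.
  by move: X1 X2; lra.
move=> X; rewrite !inE => /or3P[] /eqP ->; rewrite Mi block121_conj.
- by rewrite eqxx.
- by rewrite xab efzw subrr eqxx orbT.
- rewrite !(mulr0, mul0r, addr0, subr0) eqxx !orbT //.
Qed.

(** The first row of the sought matrix is orthogonal to the column [(a, b)] and
    the second one is parallel to the row [(e, f)]; the determinant is then a
    multiple of [e * a + f * b].  When one of the two vectors vanishes it
    imposes no condition and the determinant can be made a sum of squares. *)
Lemma middle_frame (a b e f : R) :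
    (e * a + f * b != 0) \/ (a = 0 /\ b = 0) \/ (e = 0 /\ f = 0) ->
  exists x y z w, [/\ x * w - y * z = 1, x * a + y * b = 0 & e * w = f * z].
Proof.
have sq (u v : R) : ~~ ((u == 0) && (v == 0)) -> u * u + v * v != 0.
  by rewrite -!expr2 paddr_eq0 ?sqr_ge0// !sqrf_eq0.
case=> [s0|[[-> ->]|[-> ->]]].
- exists (b / (e * a + f * b)), (- a / (e * a + f * b)), e, f; split; first by field.
    by field.
  by rewrite mulrC.
- have [/andP[/eqP -> /eqP ->]|ef] := boolP ((e == 0) && (f == 0)).
    by exists 1, 0, 0, 1; split; rewrite ?mul0r; ring.
  have s0 := sq _ _ ef.
  exists (f / (e * e + f * f)), (- e / (e * e + f * f)), e, f; split; first by field.
    by rewrite !mulr0 addr0.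
  by rewrite mulrC.
- have [/andP[/eqP -> /eqP ->]|ab] := boolP ((a == 0) && (b == 0)).
    by exists 1, 0, 0, 1; split; rewrite ?mul0r; ring.
  have s0 := sq _ _ ab.
  exists (b / (a * a + b * b)), (- a / (a * a + b * b)), a, b; split; last by rewrite !mul0r.
    by field.
  by field.
Qed.

(** A symplectically isotropic pair spans a combination adapted to
    [middle_frame].  The quadratic form [e * a + f * b] is nonzero on one of the
    two vectors or on their sum, unless it vanishes with its polar form;
    together with isotropy this makes both [(a, b)] orthogonal to all the
    [(e, f)], so that either a column vanishes or the rows are proportional and
    some combination of them vanishes. *)
Lemma lagrangian_frame (a1 b1 e1 f1 a2 b2 e2 f2 : R) :
    e1 * a2 + f1 * b2 = e2 * a1 + f2 * b1 ->
  exists l m, ((l != 0) || (m != 0)) /\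
    let a := l * a1 + m * a2 in let b := l * b1 + m * b2 in
    let e := l * e1 + m * e2 in let f := l * f1 + m * f2 in
    (e * a + f * b != 0) \/ (a = 0 /\ b = 0) \/ (e = 0 /\ f = 0).
Proof.
move=> E.
have [Q1|Q1] := eqVneq (e1 * a1 + f1 * b1) 0; last first.
  by exists 1, 0; rewrite oner_eq0 /= !mul1r !mul0r !addr0; split => //; left.
have [Q2|Q2] := eqVneq (e2 * a2 + f2 * b2) 0; last first.
  by exists 0, 1; rewrite oner_eq0 orbT /= !mul1r !mul0r !add0r; split => //; left.
have [Q3|Q3] := eqVneq (e1 * a2 + f1 * b2) 0; last first.
  exists 1, 1; rewrite oner_eq0 /= !mul1r; split => //; left.
  have -> : (e1 + e2) * (a1 + a2) + (f1 + f2) * (b1 + b2) = 2 * (e1 * a2 + f1 * b2).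
    by move: Q1 Q2 E; lra.
  by rewrite mulf_neq0 // pnatr_eq0.
have Q4 : e2 * a1 + f2 * b1 = 0 by rewrite -E.
have [/andP[/eqP a10 /eqP b10]|ab] := boolP ((a1 == 0) && (b1 == 0)).
  exists 1, 0; rewrite oner_eq0 /= !mul1r !mul0r !addr0; split => //; right; left.
  by rewrite a10 b10.
have [/andP[/eqP e10 /eqP f10]|ef] := boolP ((e1 == 0) && (f1 == 0)).
  exists 1, 0; rewrite oner_eq0 /= !mul1r !mul0r !addr0; split => //; right; right.
  by rewrite e10 f10.
have D : e1 * f2 - e2 * f1 = 0.
  have X1 : a1 * (e1 * f2 - e2 * f1) = 0.
    have -> : a1 * (e1 * f2 - e2 * f1) = f2 * (e1 * a1 + f1 * b1) - f1 * (e2 * a1 + f2 * b1) by ring.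
    by rewrite Q1 Q4; ring.
  have X2 : b1 * (e1 * f2 - e2 * f1) = 0.
    have -> : b1 * (e1 * f2 - e2 * f1) = e1 * (e2 * a1 + f2 * b1) - e2 * (e1 * a1 + f1 * b1) by ring.
    by rewrite Q1 Q4; ring.
  apply/eqP; move: X1 X2 => /eqP; rewrite mulf_eq0 => /orP[/eqP a10|//] /eqP.
  by rewrite mulf_eq0 => /orP[b10|//]; rewrite a10 b10 eqxx in ab.
have [e10|e10] := eqVneq e1 0.
  have f10 : f1 != 0 by rewrite e10 eqxx in ef.
  exists (- f2), f1; rewrite f10 orbT /=; split => //; right; right; split; last by ring.
  by move: D; lra.
exists (- e2), e1; rewrite e10 orbT /=; split => //; right; right; split; first by ring.
by move: D; lra.
Qed.

Lemma asd_isotropic2 (a b c e f a' b' c' e' f' : R) :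
    e * a' + f * b' = e' * a + f' * b ->
  asd [:: lt4 a b c 0 e f; lt4 a' b' c' 0 e' f'; E30 R].
Proof.
move=> E; have [l [m [lm /middle_frame[x [y [z [w [D xy zw]]]]]]]] := lagrangian_frame E.
pose N := lt4 (l * a + m * a') (l * b + m * b') (l * c + m * c') 0 (l * e + m * e') (l * f + m * f').
have NE : N = l *: lt4 a b c 0 e f + m *: lt4 a' b' c' 0 e' f'.
  by rewrite [m *: _]lt4Z lt4L; congr lt4; ring.
have [l0|l0] := eqVneq l 0.
  have m0 : m != 0 by rewrite l0 eqxx in lm.
  have : asd [:: lt4 a b c 0 e f; N; E30 R].
    by apply: (@asd_middle _ _ _ _ _ _ _ (l * c + m * c') _ _ _ _ _ _ D _ xy zw); rewrite l0 !mul0r !add0r; move: E => /(congr1 ( *%R m)); lra.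
  move=> /asd_generated; apply => S Sa SL X; rewrite !inE => /or3P[] /eqP ->.
  - by apply: SL; rewrite mem_head.
  - have -> : lt4 a' b' c' 0 e' f' = m^-1 *: N.
      by rewrite NE l0 scale0r add0r scalerA mulVf // scale1r.
    by apply: subalgZ => //; apply: SL; rewrite !inE eqxx orbT.
  - by apply: SL; rewrite !inE eqxx !orbT.
have : asd [:: lt4 a' b' c' 0 e' f'; N; E30 R].
  by apply: (@asd_middle _ _ _ _ _ _ _ (l * c + m * c') _ _ _ _ _ _ D _ xy zw); move: E => /(congr1 ( *%R l)); lra.
move=> /asd_generated; apply => S Sa SL.
have S1 : S (lt4 a' b' c' 0 e' f') by apply: SL; rewrite mem_head.
have SN : S N by apply: SL; rewrite !inE eqxx orbT.
move=> X; rewrite !inE => /or3P[] /eqP -> //.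
- have -> : lt4 a b c 0 e f = l^-1 *: N + (- (m / l)) *: lt4 a' b' c' 0 e' f'.
    rewrite NE scalerDr scalerA mulVf // scale1r -addrA scalerA -scalerDl.
    by rewrite [l^-1 * m]mulrC subrr scale0r addr0.
  by apply: subalgL => //; exact: subalgZ.
- by apply: SL; rewrite !inE eqxx !orbT.
Qed.

(** An isotropic subspace of a symplectic space of dimension 4 has dimension at
    most 2: the matrix [M] of the three vectors times its symplectic dual [M']
    vanishes, while both have the same rank. *)
Lemma isotropic3_dependent (v : 'I_3 -> R * R * R * R) :
    let a i := (v i).1.1.1 in let b i := (v i).1.1.2 in
    let e i := (v i).1.2 in let f i := (v i).2 in
    (forall i j, e i * a j + f i * b j = e j * a i + f j * b i) ->
  exists2 l : 'rV[R]_3, l != 0 & [/\ \sum_i l 0 i * a i = 0, \sum_i l 0 i * b i = 0,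
     \sum_i l 0 i * e i = 0 & \sum_i l 0 i * f i = 0].
Proof.
move=> a b e f H.
pose M : 'M[R]_(3, 4) := \matrix_(i < 3, j < 4) nth 0 [:: a i; b i; e i; f i] j.
pose M' : 'M[R]_(4, 3) := \matrix_(j < 4, i < 3) nth 0 [:: e i; f i; - a i; - b i] j.
have MM' : M *m M' = 0.
  apply/matrixP => i j; rewrite !mxE !big_ord_recl big_ord0 !mxE /=.
  by have := H i j; lra.
have rM' : \rank M' = \rank M.
  pose J : 'M[R]_4 := mx4 [:: [:: 0; 0; -1; 0]; [:: 0; 0; 0; -1]; [:: 1; 0; 0; 0]; [:: 0; 1; 0; 0]].
  pose J' : 'M[R]_4 := mx4 [:: [:: 0; 0; 1; 0]; [:: 0; 0; 0; 1]; [:: -1; 0; 0; 0]; [:: 0; -1; 0; 0]].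
  have JJ : J *m J' = 1%:M by mx_cases; rewrite ?mulr0n ?mulr1n; ring.
  have [Ju _] := mulmx1_unit JJ.
  rewrite -[in LHS]mxrank_tr -[RHS](@mxrankMfree _ _ _ _ M J); last by rewrite row_free_unit.
  congr (\rank _); apply/matrixP => i j; rewrite !mxE !big_ord_recl big_ord0 /=.
  rewrite !mxE /=; case: j => -[|[|[|[|//]]]] ? /=; ring.
have : ~~ row_free M.
  apply/negP; rewrite /row_free => /eqP rM.
  by have := mulmx0_rank_max MM'; rewrite rM' rM.
rewrite -kermx_eq0 => /rowV0Pn[l /sub_kermxP lM l0]; exists l => //.
have G (j : 'I_4) : \sum_i l 0 i * M i j = 0 by move/matrixP/(_ 0 j): lM; rewrite !mxE.
split; [apply: etrans (G 0)|apply: etrans (G 1)|apply: etrans (G (inord 2))|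
  apply: etrans (G (inord 3))];
  by apply: eq_bigr => i _; rewrite mxE /= ?inordK.
Qed.

(** A dependence relation between the three isotropic vectors expresses one of
    the matrices through the other two and the corner matrix. *)
Lemma asd_triple_no_entry21 (a b c e f : 'I_3 -> R) (N := fun i => lt4 (a i) (b i) (c i) 0 (e i) (f i)) :
    (forall i j, N i *m N j = N j *m N i) -> asd [:: N 0; N 1; N ord_max].
Proof.
move=> cN.
have E i j : e i * a j + f i * b j = e j * a i + f j * b i by have /lt4_comm[] := cN i j.
have [l l0 [sa sb se sf]] := isotropic3_dependent (v := fun i => (a i, b i, e i, f i)) E.
have [i0 li0] : exists i, l 0 i != 0.
  by apply: contrapT => /forallNP Nl; move/rV0Pn: l0 => [i li]; apply: (Nl i).
have aN i j : asd [:: N i; N j; E30 R] by exact: asd_isotropic2.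
have sumN : \sum_i l 0 i *: N i = (\sum_i l 0 i * c i) *: E30 R.
  move: sa sb se sf; rewrite !big_ord_recl !big_ord0 /= => sa sb se sf.
  rewrite !addr0 /N [in RHS]lt4Z [l 0 (lift ord0 (lift ord0 ord0)) *: _]lt4Z !lt4L.
  by congr lt4; rewrite ?mulr0 ?mulr1 ?addr0 //; [move: sa|move: sb|move: se|move: sf]; lra.
(* [j] and [k] are the two indices other than [i0]. *)
have [j [k jk]] : exists j k, forall i, [|| i == i0, i == j | i == k].
  case: i0 {li0} => [[|[|[|//]]] i3]; [exists 1, ord_max|exists 0, ord_max|exists 0, 1];
    by move=> [[|[|[|m]]] m3].
have /asd_generated := aN j k; apply => S Sa SL.
have Sj : S (N j) by apply: SL; rewrite mem_head.
have Sk : S (N k) by apply: SL; rewrite !inE eqxx orbT.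
have SE : S (E30 R) by apply: SL; rewrite !inE eqxx !orbT.
have Si0 : S (N i0).
  have -> : N i0 = (l 0 i0)^-1 *: ((\sum_i l 0 i * c i) *: E30 R + \sum_(i | i != i0) (- l 0 i) *: N i).
    rewrite -sumN (bigD1 i0) //= -addrA -big_split /= big1 ?addr0.
      by rewrite scalerA mulVf // scale1r.
    by move=> i _; rewrite -scalerDl subrr scale0r.
  apply: subalgZ => //; apply: subalgL => //; apply: (big_ind S).
  - exact: subalg0.
  - by move=> X Y; exact: subalgD.
  - move=> i ii0; apply: subalgZ => //.
    by have := jk i; rewrite (negPf ii0) /= => /orP[] /eqP ->.
suff SN i : S (N i) by move=> X; rewrite !inE => /or3P[] /eqP ->.
by have := jk i; move=> /or3P[] /eqP ->.
Qed.

(** Permuting the triple, a nonzero middle entry may be assumed to be that of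
    the first matrix. *)
Theorem asd_triple (L : seq 'M[R]_4) : size L = 3%N -> commuting_split L -> asd L.
Proof.
move=> sL cL; apply: (asd_strict (@all_asd_lt4 R) cL) => L'; rewrite sL.
case: L' => [|N0 [|N1 [|N2 [|]]]] // _ str cm.
have s0 : strict_trig N0 by apply: str; rewrite !inE eqxx.
have s1 : strict_trig N1 by apply: str; rewrite !inE eqxx orbT.
have s2 : strict_trig N2 by apply: str; rewrite !inE eqxx !orbT.
have perm X Y Z : asd [:: X; Y; Z] -> N0 \in [:: X; Y; Z] -> N1 \in [:: X; Y; Z] ->
    N2 \in [:: X; Y; Z] -> asd [:: N0; N1; N2].
  move=> /asd_generated aL h0 h1 h2; apply: aL => S Sa SL V; rewrite !inE => /or3P[] /eqP -> ; exact: SL.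
have mem i : [|| i == N0, i == N1 | i == N2] -> i \in [:: N0; N1; N2] by rewrite !inE.
have [a0 [b0 [c0 [d0 [e0 [f0 E0]]]]]] := lt4E s0.
have [a1 [b1 [c1 [d1 [e1 [f1 E1]]]]]] := lt4E s1.
have [a2 [b2 [c2 [d2 [e2 [f2 E2]]]]]] := lt4E s2.
have [d00|d00] := eqVneq d0 0; last first.
  by apply: (asd_triple_entry21 s1 s2 E0 d00); apply: cm; apply: mem; rewrite eqxx ?orbT.
have [d10|d10] := eqVneq d1 0; last first.
  apply: (perm N1 N0 N2); rewrite ?inE ?eqxx ?orbT //.
  by apply: (asd_triple_entry21 s0 s2 E1 d10); apply: cm; apply: mem; rewrite eqxx ?orbT.
have [d20|d20] := eqVneq d2 0; last first.
  apply: (perm N2 N0 N1); rewrite ?inE ?eqxx ?orbT //.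
  by apply: (asd_triple_entry21 s0 s1 E2 d20); apply: cm; apply: mem; rewrite eqxx ?orbT.
pose g (x y z : R) (i : 'I_3) := nth 0 [:: x; y; z] i.
have := @asd_triple_no_entry21 (g a0 a1 a2) (g b0 b1 b2) (g c0 c1 c2) (g e0 e1 e2) (g f0 f1 f2).
rewrite /= /g /=; rewrite d00 in E0; rewrite d10 in E1; rewrite d20 in E2.
rewrite -E0 -E1 -E2; apply => i j.
by move: i j => -[[|[|[|//]]] ?] -[[|[|[|//]]] ?] /=; rewrite -?E0 -?E1 -?E2; apply: cm; apply: mem; rewrite eqxx ?orbT.
Qed.
End ZeroMiddleEntry.

(** * The matrix exponential *)

Section Exponential.
Variable R : realType.

Lemma mx_normX n (X : 'M[R]_n) k : `|X ^+ k| <= (n%:R * `|X|) ^+ k.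
Proof.
have nX : 0 <= n%:R * `|X| by rewrite mulr_ge0.
apply: mx_norm_le => [|]; first exact: exprn_ge0.
elim: k => [|k IH] i j.
  by rewrite !expr0 mxE; case: (i == j); rewrite ?normr1// normr0.
rewrite exprS -[X * _]/(X *m _) mxE.
apply: (le_trans (ler_norm_sum _ _ _)).
apply: (@le_trans _ _ (\sum_(l < n) `|X| * (n%:R * `|X|) ^+ k)).
  by apply: ler_sum => l _; rewrite normrM ler_pM // mx_norm_entry.
by rewrite sumr_const card_ord exprS -[leLHS]mulr_natl mulrA.
Qed.

Lemma mx_exprZ n (a : R) (X : 'M[R]_n) k : (a *: X) ^+ k = a ^+ k *: X ^+ k.
Proof.
elim: k => [|k IH]; first by rewrite !expr0 scale1r.
by rewrite !exprS IH -!mulmxE -scalemxAl -scalemxAr scalerA.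
Qed.

(** Remainder of the scalar exponential series, which dominates the remainder of
    all the matrix series below. *)
Definition exp_tail (b : R) N := expR b - series (exp_coeff b) N.

Lemma exp_tail_le (b : R) N M : 0 <= b -> (N <= M)%N ->
  \sum_(N <= j < M) b ^+ j / j`!%:R <= exp_tail b N.
Proof.
move=> b0 NM; rewrite /exp_tail lerBrDl.
have -> : series (exp_coeff b) N + \sum_(N <= j < M) b ^+ j / j`!%:R = series (exp_coeff b) M.
  by rewrite /series /= [RHS](big_cat_nat (leq0n N) NM).
apply: nondecreasing_cvgn_le; last exact: is_cvg_series_exp_coeff.
apply: nondecreasing_series => k _ _; exact: exp_coeff_ge0.
Qed.

Lemma exp_tail_cvg (b : R) : exp_tail b @ \oo --> (0 : R).
Proof.
rewrite -[X in _ --> X](subrr (expR b)); apply: cvgB; first exact: cvg_cst.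
exact: is_cvg_series_exp_coeff.
Qed.

Lemma norm_sum_tail n (Y : 'M[R]_n) (c : nat -> R) b N M :
    (forall j, 0 <= c j <= j`!%:R^-1) -> n%:R * `|Y| <= b -> (N <= M)%N ->
  `|\sum_(N <= j < M) c j *: Y ^+ j| <= exp_tail b N.
Proof.
move=> cj Yb NM; apply: le_trans (ler_norm_sum _ _ _) _.
have Y0 : 0 <= n%:R * `|Y| by rewrite mulr_ge0.
apply: le_trans (exp_tail_le (le_trans Y0 Yb) NM).
apply: ler_sum => j _; rewrite normrZ mulrC.
have /andP[c0 c1] := cj j; rewrite (ger0_norm c0).
apply: ler_pM => //; apply: le_trans (mx_normX _ _) _.
by apply: lerXn2r => //; rewrite nnegrE // (le_trans Y0).
Qed.

Definition exp_part n (Y : 'M[R]_n) N : 'M[R]_n := \sum_(0 <= j < N) j`!%:R^-1 *: Y ^+ j.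

Lemma exp_part_cvg n (Y : 'M[R]_n) : exp_part Y @ \oo --> expmx Y.
Proof. exact: is_cvg_expmx. Qed.

Lemma expmx_part n (Y : 'M[R]_n) N C :
    (forall M, (N <= M)%N -> `|\sum_(N <= j < M) j`!%:R^-1 *: Y ^+ j| <= C) ->
  `|expmx Y - exp_part Y N| <= C.
Proof.
move=> H; have L : (fun M => `|exp_part Y M - exp_part Y N|) @ \oo --> `|expmx Y - exp_part Y N|.
  by apply: cvg_norm; apply: cvgB; [exact: exp_part_cvg|exact: cvg_cst].
apply: (cvgr_to_le L); near=> M.
have NM : (N <= M)%N by near: M; exact: nbhs_infty_ge.
rewrite /exp_part (big_cat_nat (leq0n N) NM) //= addrAC subrr add0r; exact: H.
Unshelve. all: by end_near. Qed.

Lemma expmx_tail n (Y : 'M[R]_n) b N : n%:R * `|Y| <= b ->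
  `|expmx Y - exp_part Y N| <= exp_tail b N.
Proof.
move=> Yb; apply: expmx_part => M NM; apply: norm_sum_tail => // j.
by rewrite invr_ge0 lexx andbT.
Qed.

(** The coefficient of [(m z) ^ j] in [(1 + z) ^ m]. *)
Definition bincoef (m j : nat) : R := 'C(m, j)%:R / m%:R ^+ j.

Lemma bincoefS m j : (0 < m)%N ->
  bincoef m j.+1 = bincoef m j * ((m - j)%:R / m%:R) / j.+1%:R.
Proof.
move=> m0; have m0' : m%:R != 0 :> R by rewrite pnatr_eq0 -lt0n.
have j0 : j.+1%:R != 0 :> R by rewrite pnatr_eq0.
rewrite /bincoef exprS.
have : j.+1%:R * 'C(m, j.+1)%:R = (m - j)%:R * 'C(m, j)%:R :> R.
  by rewrite -!natrM mul_bin_left.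
move=> E; apply: (mulfI j0).
rewrite mulrA E; move: (j.+1%:R) j0 {E} => J j0.
have mj : m%:R ^+ j != 0 :> R by rewrite expf_neq0.
by move: (m%:R ^+ j) mj => mj mj0; field; rewrite j0 m0'.
Qed.

Lemma bincoef_bound m j : (0 < m)%N -> 0 <= bincoef m j <= j`!%:R^-1.
Proof.
move=> m0; elim: j => [|j /andP[IH0 IH1]].
  by rewrite /bincoef bin0 expr0 divr1 ler01 fact0 invr1 lexx.
have q0 : 0 <= (m - j)%:R / m%:R :> R by rewrite divr_ge0.
have q1 : (m - j)%:R / m%:R <= 1 :> R.
  by rewrite ler_pdivrMr ?ltr0n // mul1r ler_nat leq_subr.
rewrite bincoefS // factS natrM invfM.
apply/andP; split; first by rewrite !mulr_ge0 ?invr_ge0.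
rewrite [X in _ <= X]mulrC.
apply: ler_wpM2r; first by rewrite invr_ge0.
by rewrite -[X in _ <= X]mulr1; apply: ler_pM.
Qed.

Lemma bincoef_cvg j : (fun m => bincoef m j) @ \oo --> (j`!%:R^-1 : R).
Proof.
elim: j => [|j IH].
  have -> : (bincoef^~ 0%N) = (fun=> 0`!%:R^-1).
    by apply/funext => m; rewrite /bincoef bin0 expr0 divr1 fact0 invr1.
  exact: cvg_cst.
rewrite factS natrM invfM mulrC.
have L : (fun m : nat => bincoef m j * (1 - j%:R / m%:R) / j.+1%:R) @ \oo -->
    (j`!%:R^-1 : R) / j.+1%:R.
  apply: cvgMl; rewrite -[X in _ --> X]mulr1; apply: cvgM => //.
  rewrite -[X in _ --> X]subr0; apply: cvgB; first exact: cvg_cst.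
  rewrite -(mulr0 j%:R); apply: cvgM; first exact: cvg_cst.
  rewrite -(cvg_shiftS (fun m : nat => m%:R^-1 : R)).
  apply/cvgrPdist_lt => e e0; near=> k; rewrite sub0r normrN ger0_norm ?invr_ge0 //.
  near: k; exact: near_infty_natSinv_lt (PosNum e0).
apply: cvg_trans L; apply: near_eq_cvg; near=> m.
have m0 : (0 < m)%N by near: m; exact: nbhs_infty_gt.
have jm : (j <= m)%N by near: m; exact: nbhs_infty_ge.
by rewrite bincoefS // natrB // mulrBl divff // pnatr_eq0 -lt0n.
Unshelve. all: by end_near. Qed.

(** Euler's formula along any filter.  Expand the power by the binomial formula:
    each coefficient converges to that of the exponential and is bounded by it,
    so the tails are uniformly small.  The functional equation, the determinant
    of the exponential and the one-parameter subgroups of closed groups are all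
    deduced from this formula. *)
Lemma powers_cvg_expmx (T : Type) (F : set_system T) {FF : Filter F} n
    (m : T -> nat) (z : T -> 'M[R]_n) (Y : 'M[R]_n) :
    m @ F --> \oo -> (fun t => (m t)%:R *: z t) @ F --> Y ->
  (fun t => (z t + 1) ^+ m t) @ F --> expmx Y.
Proof.
move=> moo mzY; pose y t := (m t)%:R *: z t.
pose b := n%:R * (`|Y| + 1).
apply/cvgrPdist_lt => e e0.
have e4 : 0 < e / 4 by rewrite divr_gt0.
have [N _ /(_ N (leqnn N)) Ne] := (cvgrPdist_lt _ _).1 (exp_tail_cvg b) _ e4.
(* From order [N] on both tails are below [e / 4]; only [N] terms are left. *)
have {Ne} : exp_tail b N < e / 4.
  by move: Ne; rewrite /= sub0r normrN; apply: le_lt_trans; exact: ler_norm.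
move=> Ne.
have yX j : (fun t => y t ^+ j) @ F --> Y ^+ j.
  elim: j => [|j IH]; first exact: cvg_cst.
  by under eq_fun do rewrite exprS; rewrite exprS; exact: cvg_mulmx.
have part : (fun t => \sum_(0 <= j < N) bincoef (m t) j *: y t ^+ j) @ F --> exp_part Y N.
  rewrite /exp_part; elim: N {Ne} => [|N IH].
    by rewrite big_nil; under eq_fun do rewrite big_nil; exact: cvg_cst.
  rewrite big_nat_recr //; under eq_fun do rewrite big_nat_recr //.
  apply: cvgD => //; apply: cvgZ => //.
  by apply: (@cvg_comp _ _ _ m (bincoef^~ N) _ \oo) => //; exact: bincoef_cvg.
near=> t.
have m0 : (0 < m t)%N by near: t; exact: (cvgnyPge _).1 moo 1%N.
have Nm : (N <= m t)%N by near: t; exact: (cvgnyPge _).1 moo N.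
have yb : n%:R * `|y t| <= b.
  rewrite /b ler_wpM2l // -lerBlDl (le_trans (lerB_dist _ _)) // distrC.
  apply: ltW; near: t; exact: (cvgrPdist_lt _ _).1 mzY _ ltr01.
have Yb : n%:R * `|Y| <= b by rewrite /b ler_wpM2l // lerDl.
have E : (z t + 1) ^+ m t = \sum_(0 <= j < (m t).+1) bincoef (m t) j *: y t ^+ j.
  rewrite exprD1n big_mkord; apply: eq_bigr => j _.
  rewrite /y mx_exprZ scalerA /bincoef divfK ?scaler_nat //.
  by rewrite expf_neq0 // pnatr_eq0 -lt0n.
have H3 : `|exp_part Y N - \sum_(0 <= j < N) bincoef (m t) j *: y t ^+ j| < e / 4.
  by near: t; exact: (cvgrPdist_lt _ _).1 part _ e4.
rewrite E (big_cat_nat (leq0n N) (leqW Nm)) /=.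
move: H3; set S := \sum_(0 <= j < N) _ => H3; set U := \sum_(N <= j < _) _.
have -> : expmx Y - (S + U) = (expmx Y - exp_part Y N) + ((exp_part Y N - S) - U).
  by rewrite opprD !addrA subrK.
have H1 : `|expmx Y - exp_part Y N| < e / 4 by apply: le_lt_trans (expmx_tail N Yb) _.
have H2 : `|U| < e / 4.
  apply: le_lt_trans Ne; apply: norm_sum_tail => //; last exact: leqW.
  by move=> j; exact: bincoef_bound.
apply: le_lt_trans (ler_normD _ _) _.
apply: le_lt_trans (lerD (lexx _) (ler_normB _ _)) _.
by move: H1 H2 H3; lra.
Unshelve. all: by end_near. Qed.

Lemma mx_cvg_unique (T : Type) (F : set_system T) {FF : ProperFilter F} m n
    (f : T -> 'M[R]_(m, n)) (X Y : 'M[R]_(m, n)) : f @ F --> X -> f @ F --> Y -> X = Y.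
Proof. by move=> fX fY; exact: (cvg_unique (@norm_hausdorff R _) fX fY). Qed.

Lemma cvg_invS : (fun k : nat => k.+1%:R^-1 : R) @ \oo --> (0 : R).
Proof.
apply/cvgrPdist_lt => e e0; near=> k; rewrite sub0r normrN ger0_norm ?invr_ge0 //.
near: k; exact: near_infty_natSinv_lt (PosNum e0).
Unshelve. all: by end_near. Qed.

Lemma cvg_succ : succn @ \oo --> \oo.
Proof. by apply/cvgnyPge => A; near=> k; apply: leqW; near: k; exact: nbhs_infty_ge.
Unshelve. all: by end_near. Qed.

Lemma expmx_powers n (X : 'M[R]_n) :
  (fun k : nat => (k.+1%:R^-1 *: X + 1) ^+ k.+1) @ \oo --> expmx X.
Proof.
apply: (powers_cvg_expmx cvg_succ).
have -> : (fun k => k.+1%:R *: (k.+1%:R^-1 *: X)) = (fun=> X); last exact: cvg_cst.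
by apply/funext => k; rewrite scalerA mulfV ?scale1r // pnatr_eq0.
Qed.

(** The product of [1 + X / m] and [1 + Y / m] is [1 + z] with [m * z]
    converging to [X + Y]. *)
Lemma expmxD n (X Y : 'M[R]_n) : X *m Y = Y *m X ->
  expmx (X + Y) = expmx X *m expmx Y.
Proof.
move=> XY; have P := cvg_mulmx (@expmx_powers n X) (@expmx_powers n Y).
apply: (mx_cvg_unique _ (P _)) => {P}.
have -> : (fun t : nat => (t.+1%:R^-1 *: X + 1) ^+ t.+1 *m (t.+1%:R^-1 *: Y + 1) ^+ t.+1) =
   (fun t => ((t.+1%:R^-1 *: (X + Y) + t.+1%:R^-1 *: (t.+1%:R^-1 *: (X *m Y))) + 1) ^+ t.+1).
  apply/funext => t; rewrite -[_ *m _]/(_ * _) -exprMn_comm.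
    congr (_ ^+ _); rewrite scalerDr.
    have -> : t.+1%:R^-1 *: (t.+1%:R^-1 *: (X *m Y)) = (t.+1%:R^-1 *: X) * (t.+1%:R^-1 *: Y).
      by rewrite -mulmxE -scalemxAl -scalemxAr.
    rewrite mulrDl mul1r mulrDr mulr1 [_ * _ + _]addrC -!addrA.
    by congr (_ + _); rewrite addrCA.
  apply: commrD; last exact: commr1.
  apply/commr_sym/commrD; last exact: commr1.
  rewrite /GRing.comm -!mulmxE -!scalemxAl -!scalemxAr XY !scalerA mulrC.
  by [].
apply: (powers_cvg_expmx cvg_succ).
have -> : (fun k : nat => k.+1%:R *: (k.+1%:R^-1 *: (X + Y) + k.+1%:R^-1 *: (k.+1%:R^-1 *: (X *m Y)))) =
    (fun k : nat => (X + Y) + k.+1%:R^-1 *: (X *m Y)).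
  by apply/funext => k; rewrite scalerDr !scalerA mulfV ?pnatr_eq0 // mul1r scale1r.
rewrite -[X in _ --> X]addr0 -(scale0r (X *m Y)).
by apply: cvgD; [exact: cvg_cst|apply: cvgZl; exact: cvg_invS].
Qed.

Lemma expmx0 n : expmx (0 : 'M[R]_n) = 1%:M.
Proof.
apply: (@mx_cvg_unique _ _ _ _ _ _ _ _ (@expmx_powers n 0)).
under eq_fun do rewrite scaler0 add0r expr1n; exact: cvg_cst.
Qed.

Lemma expmxN n (X : 'M[R]_n) : expmx X *m expmx (- X) = 1%:M.
Proof. by rewrite -expmxD ?subrr ?expmx0 // mulmxN mulNmx. Qed.

(** The derivative at 0, from the estimate of the remainder of order 2. *)
Lemma expmx_deriv (T : Type) (F : set_system T) {FF : Filter F} n (r : T -> R) (X : 'M[R]_n) :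
    (forall t, 0 < r t) -> r @ F --> (0 : R) ->
  (fun t => (r t)^-1 *: (expmx (r t *: X) - 1%:M)) @ F --> X.
Proof.
move=> rt0 r0.
pose b := n%:R * `|X|; have b0 : 0 <= b by rewrite mulr_ge0.
have H t : 0 <= t <= 1 -> `|expmx (t *: X) - exp_part (t *: X) 2| <= t ^+ 2 * expR b.
  move=> /andP[t0 t1]; apply: expmx_part => M M2.
  apply: le_trans (ler_norm_sum _ _ _) _.
  apply: (@le_trans _ _ (\sum_(2 <= j < M) t ^+ 2 * (b ^+ j / j`!%:R))).
    rewrite big_seq [leRHS]big_seq; apply: ler_sum => j; rewrite mem_index_iota => /andP[j2 _].
    rewrite mx_exprZ !normrZ ger0_norm ?invr_ge0 // ger0_norm ?exprn_ge0 //.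
    rewrite mulrC mulrA; apply: ler_wpM2r; first by rewrite invr_ge0.
    apply: ler_pM; rewrite ?exprn_ge0 //.
      by rewrite ler_wiXn2l.
    exact: mx_normX.
  rewrite -mulr_sumr; apply: ler_wpM2l; first by rewrite exprn_ge0.
  apply: le_trans (exp_tail_le b0 M2) _.
  rewrite /exp_tail lerBlDr lerDl; apply: sumr_ge0 => j _; exact: exp_coeff_ge0.
have L : (fun t => r t * expR b : R) @ F --> (0 : R).
  by rewrite -(mul0r (expR b)); apply: cvgM; last exact: cvg_cst.
apply/cvgrPdist_le => e e0; near=> k.
have k0 : r k != 0 by rewrite gt_eqF.
have rk0 := ltW (rt0 k).
have rk1 : r k <= 1.
  have : `|0 - r k| <= 1 by near: k; exact: (cvgrPdist_le _ _).1 r0 1 ltr01.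
  by rewrite sub0r normrN ger0_norm.
have -> : X - (r k)^-1 *: (expmx (r k *: X) - 1%:M) =
   - ((r k)^-1 *: (expmx (r k *: X) - exp_part (r k *: X) 2)).
  rewrite /exp_part !big_nat_recr //= big_nil add0r expr0 expr1 fact0 /= invr1 !scale1r.
  by rewrite opprD addrA [in RHS]scalerBr opprB scalerA mulVf // scale1r.
rewrite normrN normrZ ger0_norm ?invr_ge0 //.
apply: (@le_trans _ _ (r k * expR b)).
  have -> : r k * expR b = (r k)^-1 * (r k ^+ 2 * expR b) by field.
  by apply: ler_wpM2l; rewrite ?invr_ge0 //; apply: H; rewrite rk0.
suff : `|0 - r k * expR b| <= e.
  by rewrite sub0r normrN; apply: le_trans; exact: ler_norm.
near: k; exact: (cvgrPdist_le _ _).1 L e e0.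
Unshelve. all: by end_near. Qed.

Lemma expmx_cvg1 (T : Type) (F : set_system T) {FF : Filter F} n (r : T -> R) (X : 'M[R]_n) :
    (forall t, 0 < r t) -> r @ F --> (0 : R) ->
  (fun t => expmx (r t *: X)) @ F --> (1%:M : 'M[R]_n).
Proof.
move=> rt0 r0; have D := @expmx_deriv T F FF n r X rt0 r0.
have -> : (fun t => expmx (r t *: X)) =
    (fun t => 1%:M + r t *: ((r t)^-1 *: (expmx (r t *: X) - 1%:M))).
  by apply/funext => t; rewrite scalerA mulfV ?gt_eqF // scale1r addrC subrK.
rewrite -[X in _ --> X]addr0 -(scale0r X).
by apply: cvgD; [exact: cvg_cst|apply: cvgZ].
Qed.

End Exponential.

(** * Closed subgroups and their Lie algebras *)

Section ClosedSubgroups.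
Variables (R : realType) (n : nat).
Implicit Types G H K : set 'M[R]_n.

(** The fields of [closedSubgroup] as a predicate on sets, so that it applies to
    intersections and to limit groups. *)
Definition is_csg G := [/\ G `<=` SL R n, G 1%:M,
  forall g h, G g -> G h -> G (g *m h),
  forall g, G g -> G (invmx g) & closed G].

Lemma csgP (H : closedSubgroup R n) : is_csg H.
Proof.
split; [exact: csg_subSL|exact: csg_1|exact: csg_mul|exact: csg_inv|exact: csg_closed].
Qed.

Lemma SL_unit (g : 'M[R]_n) : SL R n g -> g \in unitmx.
Proof. by move=> g1; rewrite unitmxE g1 unitr1. Qed.

Lemma csgX G g k : is_csg G -> G g -> G (g ^+ k).
Proof.
move=> [_ G1 GM _ _] Gg; elim: k => [|k IH]; first by rewrite expr0.
by rewrite exprS; exact: GM.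
Qed.

(** The tangent directions at 1 of a closed subgroup belong to its Lie algebra:
    powers of elements close to 1 approximate a one-parameter group. *)
Lemma lie_algebra_dir (T : Type) (U : set_system T) {UU : ProperFilter U} G (g : T -> 'M[R]_n) Z :
    is_csg G -> (forall t, G (g t)) -> (forall t, g t != 1) -> g @ U --> (1 : 'M[R]_n) ->
    (fun t => `|g t - 1|^-1 *: (g t - 1)) @ U --> Z ->
  lie_algebra G Z.
Proof.
move=> cG Gg g1 gU dU.
have pos : forall s, 0 < s -> G (expmx (s *: Z)).
  move=> s s0; pose r t := `|g t - 1|.
  have r0 t : 0 < r t by rewrite normr_gt0 subr_eq0.
  have rU : r @ U --> (0 : R).
    rewrite -(@normr0 _ 'M[R]_n); apply: cvg_norm; rewrite -[X in _ --> X](subrr (1 : 'M[R]_n)).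
    by apply: cvgB => //; exact: cvg_cst.
  (* With this exponent [m t * r t] tends to [s], so Euler's formula applies. *)
  pose m t := Num.truncn (s / r t).
  have mI t : (m t)%:R <= s / r t < (m t).+1%:R.
    by apply: truncn_itv; rewrite divr_ge0 // ltW.
  have mr : (fun t => (m t)%:R * r t) @ U --> s.
    apply/cvgrPdist_lt => e e0; near=> t.
    have re : r t < e.
      have : `|0 - r t| < e by near: t; exact: (cvgrPdist_lt _ _).1 rU e e0.
      by rewrite sub0r normrN ger0_norm // ltW.
    have /andP[m1 m2] := mI t.
    move: m1 m2; rewrite ler_pdivlMr // ltr_pdivrMr // -natr1 mulrDl mul1r => m1 m2.
    by rewrite ger0_norm; move: m1 m2 re; lra.
  have moo : m @ U --> \oo.
    apply/cvgnyPge => A.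
    have e0 : 0 < s / A.+1%:R by rewrite divr_gt0.
    near=> t; have re : r t < s / A.+1%:R.
      have : `|0 - r t| < s / A.+1%:R by near: t; exact: (cvgrPdist_lt _ _).1 rU _ e0.
      by rewrite sub0r normrN ger0_norm // ltW.
    have /andP[_ m2] := mI t.
    have : A.+1%:R < (m t).+1%:R :> R.
      by apply: lt_trans m2; rewrite ltr_pdivlMr // mulrC -ltr_pdivlMr.
    by rewrite ltr_nat ltnS => /ltnW.
  have P : (fun t => ((g t - 1) + 1) ^+ m t) @ U --> expmx (s *: Z).
    apply: powers_cvg_expmx => //.
    have -> : (fun t => (m t)%:R *: (g t - 1)) =
        (fun t => ((m t)%:R * r t) *: (`|g t - 1|^-1 *: (g t - 1))).
      by apply/funext => t; rewrite scalerA -mulrA mulfV ?mulr1 // gt_eqF // r0.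
    exact: cvgZ.
  have [_ _ _ _ clG] := cG.
  apply: (closed_cvg G clG _ _ P).
  by apply: filterE => t; rewrite subrK; exact: csgX.
have [sG G1 _ GI _] := cG.
move=> s; have [s0|s0|<-] := ltgtP 0 s; first exact: pos.
  have E := expmxN ((- s) *: Z).
  have Gs : G (expmx (- s *: Z)) by apply: pos; rewrite oppr_gt0.
  have -> : expmx (s *: Z) = invmx (expmx (- s *: Z)).
    apply: (can_inj (mulKmx (SL_unit (sG _ Gs)))).
    by rewrite mulmxV ?(SL_unit (sG _ Gs)) // -E -scaleNr opprK.
  exact: GI.
by rewrite scale0r expmx0.
Unshelve. all: by end_near. Qed.

(** The factor 2 spares the compactness argument needed for an exact minimum. *)
Lemma near_min (A : set 'M[R]_n) (p : 'M[R]_n) : closed A -> A !=set0 ->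
  exists2 x, A x & forall y, A y -> `|x - p| <= 2 * `|y - p|.
Proof.
move=> cA [a Aa]; pose D := [set `|y - p| | y in A].
have hD : has_inf D.
  by split; [exists `|a - p|, a|exists 0 => _ [y _ <-]].
have lD y : A y -> inf D <= `|y - p| by move=> Ay; apply: ge_inf hD.2 _ _; exists y.
have D0 : 0 <= inf D by apply: lb_le_inf hD.1 _ => _ [y _ <-].
have [D00|D00] := eqVneq (inf D) 0; last first.
  have Dp : 0 < inf D by rewrite lt_def D00.
  have [_ [x Ax <-] xD] := inf_adherent Dp hD.
  exists x => // y Ay; apply: le_trans (ltW xD) _.
  by have := lD y Ay; lra.
exists p; last by move=> y Ay; rewrite subrr normr0 mulr_ge0.
apply: cA => B /nbhs_ballP[e /= e0 eB].
have [_ [x Ax <-] xD] := inf_adherent e0 hD.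
exists x; split => //; apply: eB; rewrite -ball_normE /= distrC.
by move: xD; rewrite D00 add0r.
Qed.

(** If elements [h_k] of [H] outside [K] converge to 1, multiply each by an
    element of [K] that nearly minimizes the distance to 1.  The products [x_k]
    have a limit direction [Z], which lies in the Lie algebra of [H], hence of
    [K].  Multiplying [x_k] by the element [exp (- |x_k - 1| Z)] of [K] brings
    it closer to 1 by more than the allowed factor. *)
Lemma csg_open H K : is_csg H -> is_csg K -> K `<=` H -> lie_algebra H `<=` lie_algebra K ->
  exists2 e, 0 < e & forall h, H h -> `|h - 1| < e -> K h.
Proof.
move=> cH cK KH LHK; apply: contrapT => N.
have [sH H1 HM HI clH] := cH; have [sK K1 KM KI clK] := cK.
have /choice[h hP] : forall k : nat, exists h, [/\ H h, `|h - 1| < k.+1%:R^-1 & ~ K h].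
  move=> k; apply: contrapT => Nk; apply: N; exists k.+1%:R^-1; rewrite ?invr_gt0 //.
  by move=> h Hh hk; apply: contrapT => nKh; apply: Nk; exists h.
have hu k : h k \in unitmx by have [/sH/SL_unit] := hP k.
(* The coset [h_k K] is closed and does not contain 1. *)
pose A k := [set h k *m c | c in K].
have clA k : closed (A k).
  have -> : A k = (mulmx (invmx (h k)) : 'M[R]_n -> 'M[R]_n) @^-1` K.
    apply/seteqP; split=> [_ [c Kc <-]|x Kx] /=; first by rewrite mulKmx.
    by exists (invmx (h k) *m x); rewrite ?mulKVmx.
  apply: preimage_closed => // x _.
  by apply: (@cvg_mulmx R _ (nbhs x) _ _ _ _ (fun=> invmx (h k)) id); [exact: cvg_cst|exact: cvg_id].
have /choice[x xP] : forall k, exists x, A k x /\ forall y, A k y -> `|x - 1| <= 2 * `|y - 1|.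
  move=> k; have [|x Ax xm] := near_min 1 (clA k); last by exists x.
  by exists (h k *m 1%:M), 1%:M.
have xH k : H (x k).
  by have [[c Kc <-] _] := xP k; apply: HM; [have [] := hP k|exact: KH].
have x1 k : x k != 1.
  apply/eqP => xk; have [[c Kc hc] _] := xP k; have [_ _] := hP k; apply.
  have -> : h k = invmx c; last exact: KI.
  have cu := SL_unit (sK _ Kc).
  by rewrite -[h k](mulmxK cu) hc xk mul1mx.
have xb k : `|x k - 1| <= 2 * k.+1%:R^-1.
  have [_ xm] := xP k; apply: le_trans (xm (h k) _) _; first by exists 1%:M; rewrite ?mulmx1.
  by apply: ler_wpM2l => //; have [_ /ltW] := hP k.
have [U [UU ooU]] := @ultraFilterLemma nat \oo _.
have rU : (fun k => `|x k - 1|) @ U --> (0 : R).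
  have L : (fun k => `|x k - 1|) @ \oo --> (0 : R).
    have L2 : (fun k : nat => 2 * k.+1%:R^-1 : R) @ \oo --> (0 : R).
      by rewrite -(mulr0 2); apply: cvgM; [exact: cvg_cst|exact: cvg_invS].
    apply: (squeeze_cvgr _ (cvg_cst 0) L2).
    by apply: filterE => k; rewrite normr_ge0 xb.
  by move=> B /L; exact: ooU.
have r0 k : 0 < `|x k - 1| by rewrite normr_gt0 subr_eq0.
have xU : x @ U --> (1 : 'M[R]_n).
  apply/cvgrPdist_lt => e e0; near=> k; rewrite distrC.
  have : `|0 - `|x k - 1| | < e by near: k; exact: (cvgrPdist_lt _ _).1 rU e e0.
  by rewrite sub0r normrN normr_id.
pose d k := `|x k - 1|^-1 *: (x k - 1).
have [|Z dZ] := @ultra_mx_cvg R nat U UU n n d 1.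
  by apply: filterE => k; rewrite /d normrZ ger0_norm ?invr_ge0 // mulVf ?gt_eqF.
have LZ : lie_algebra K Z by apply: LHK; exact: (@lie_algebra_dir nat U _ H x Z cH xH x1 xU dZ).
(* [x_k exp (- r Z) - 1], divided by [r = |x_k - 1|], tends to [Z - Z = 0]. *)
pose w k := `|x k - 1|^-1 *: (x k *m expmx (`|x k - 1| *: - Z) - 1).
have wU : w @ U --> (0 : 'M[R]_n).
  have -> : w = (fun k => d k *m expmx (`|x k - 1| *: - Z) +
      `|x k - 1|^-1 *: (expmx (`|x k - 1| *: - Z) - 1%:M)).
    apply/funext => k; rewrite /w /d -scalemxAl -scalerDr mulmxBl mul1mx.
    by rewrite addrA subrK.
  have FU : Filter U by apply: filter_filter.
  have D1 := @expmx_deriv R nat U FU n (fun k => `|x k - 1|) (- Z) r0 rU.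
  have D2 := @expmx_cvg1 R nat U FU n (fun k => `|x k - 1|) (- Z) r0 rU.
  have D3 := @cvg_mulmx R nat U FU n n n d _ Z 1%:M dZ D2.
  have -> : (0 : 'M[R]_n) = Z *m 1%:M - Z by rewrite mulmx1 subrr.
  exact: (cvgD D3 D1).
have w2 k : 1 <= 2 * `|w k|.
  have [[c Kc hc] xm] := xP k.
  have := xm (x k *m expmx (`|x k - 1| *: - Z)) _.
  have -> : `|w k| = `|x k - 1|^-1 * `|x k *m expmx (`|x k - 1| *: - Z) - 1|.
    by rewrite /w normrZ ger0_norm // invr_ge0.
  rewrite mulrCA ler_pdivlMl // mulr1; apply.
  exists (c *m expmx (`|x k - 1| *: - Z)); last by rewrite mulmxA hc.
  by apply: KM => //; rewrite scalerN -scaleNr; exact: LZ.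
have [k] : exists k, `|0 - w k| < 2^-1.
  have : \forall k \near U, `|0 - w k| < 2^-1.
    by apply: (cvgrPdist_lt _ _).1 wU _ _; rewrite invr_gt0.
  exact: filter_ex.
by have := w2 k; rewrite sub0r normrN; lra.
Unshelve. all: by end_near. Qed.

(** [K] is closed and open in [H]. *)
Theorem csg_eq H K : is_csg H -> is_csg K -> K `<=` H -> lie_algebra H `<=` lie_algebra K ->
  connected H -> K = H.
Proof.
move=> cH cK KH LHK connH; have [e e0 eK] := csg_open cH cK KH LHK.
have [sH H1 HM HI clH] := cH; have [sK K1 KM KI clK] := cK.
apply: connH; first by exists 1%:M.
  pose C := [set h' : 'M[R]_n | exists2 k, K k & `|invmx k *m h' - 1| < e].
  exists C.
    rewrite openE => h' [k Kk kh]; rewrite /interior.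
    have L : (fun x : 'M[R]_n => `|invmx k *m x - 1|) @ h' --> `|invmx k *m h' - 1|.
      have L0 : (fun x : 'M[R]_n => invmx k *m x) @ h' --> invmx k *m h'.
        by apply: (@cvg_mulmx R _ (nbhs h') _ _ _ _ (fun=> invmx k) id); [exact: cvg_cst|exact: cvg_id].
      exact: (cvg_norm (cvgB L0 (cvg_cst (1 : 'M[R]_n)))).
    have NN : \forall x \near h', `|invmx k *m x - 1| < e by exact: (cvgr_lt _ L).
    by apply: (filterS _ NN) => x xe; exists k.
  apply/seteqP; split=> [k Kk|h' [Hh' [k Kk kh]]].
    by split; [exact: KH|exists k => //; rewrite mulVmx ?subrr ?normr0 //; exact/SL_unit/sK].
  have -> : h' = k *m (invmx k *m h') by rewrite mulKVmx //; exact/SL_unit/sK.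
  by apply: KM => //; apply: eK => //; apply: HM => //; apply/HI/KH.
by exists K => //; rewrite setIidr.
Qed.

(** A closed cone that contains [exp (t X) - 1] for all [t] contains the
    derivative [X]. *)
Lemma lie_mem (S : set 'M[R]_n) X : closed S -> (forall a Y, S Y -> S (a *: Y)) ->
  (forall t, S (expmx (t *: X) - 1%:M)) -> S X.
Proof.
move=> clS SZ SX.
apply: (closed_cvg S clS _ _ (@expmx_deriv R nat \oo _ n (fun k => k.+1%:R^-1) X _ (@cvg_invS R))).
  by apply: filterE => k; exact: SZ.
by move=> k; rewrite invr_gt0.
Qed.

End ClosedSubgroups.

(** * The limit algebra *)

Section Pivots.
Variable R : realType.

Lemma det_id_col n (i0 : 'I_n) (b : 'cV[R]_n) :
  \det (\matrix_(i, j) if j == i0 then b i 0 else (1%:M : 'M[R]_n) i j) = b i0 0.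
Proof.
set M := \matrix_(i, j) _.
rewrite (expand_det_col M i0).
transitivity (\sum_i b i 0 * ((1%:M : 'M[R]_n) i0 i)).
  apply: eq_bigr => i _; rewrite mxE eqxx; congr (_ * _).
  have -> : cofactor M i i0 = cofactor (1%:M : 'M[R]_n) i i0.
    rewrite /cofactor; congr (_ * \det _); apply/matrixP => k l; rewrite !mxE.
    by rewrite -(inj_eq val_inj) /= eq_sym (negPf (neq_bump _ _)).
  have : \adj (1%:M : 'M[R]_n) = 1%:M.
    by have := mul_mx_adj (1%:M : 'M[R]_n); rewrite mul1mx det1.
  by move/matrixP/(_ i0 i); rewrite mxE.
rewrite (bigD1 i0) //= big1 ?addr0; first by rewrite mxE eqxx mulr1.
by move=> i /negPf ii0; rewrite mxE eq_sym ii0 mulr0.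
Qed.

(** Take for [S] the columns of a minor of maximal absolute value, and normalize
    it to the identity.  By Cramer's rule the entries are quotients of another
    minor by the maximal one. *)
Lemma pivot_basis n N (A : 'M[R]_(n, N)) : row_free A ->
  exists (S : {ffun 'I_n -> 'I_N}) (C : 'M[R]_n), [/\ C \in unitmx,
    colsub S (C *m A) = 1%:M & forall i j, `|(C *m A) i j| <= 1].
Proof.
move=> fA.
have fA' : row_full A^T by rewrite /row_full mxrank_tr.
pose F (S : {ffun 'I_n -> 'I_N}) := `|\det (colsub S A)|.
pose S0 : {ffun 'I_n -> 'I_N} := fullrankfun fA'.
have FS0 : 0 < F S0.
  rewrite normr_gt0 -unitfE -unitmxE -unitmx_tr.
  have -> : (colsub S0 A)^T = rowsub S0 A^T by apply/matrixP => i j; rewrite !mxE.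
  exact: fullrowsub_unit.
case: (@arg_maxP _ R _ S0 predT F erefl) => S _ Smax.
have Su : colsub S A \in unitmx.
  by rewrite unitmxE unitfE -normr_gt0; apply: lt_le_trans FS0 (Smax _ isT).
pose C := invmx (colsub S A); exists S, C.
have CA : colsub S (C *m A) = 1%:M by rewrite -mulmx_colsub mulVmx.
split; [by rewrite unitmx_inv|by []|move=> i j].
pose S' : {ffun 'I_n -> 'I_N} := [ffun k => if k == i then j else S k].
have E : colsub S' A = colsub S A *m colsub S' (C *m A).
  by rewrite mulmx_colsub /C mulKVmx.
have : F S' <= F S := Smax S' isT.
rewrite /F E det_mulmx normrM.
rewrite ger_pMr; last by apply: lt_le_trans FS0 (Smax _ isT).
suff -> : colsub S' (C *m A) = \matrix_(i1, j1) (if j1 == i then col j (C *m A) i1 0 else (1%:M : 'M[R]_n) i1 j1).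
  by rewrite det_id_col mxE.
apply/matrixP => k l; rewrite [LHS]mxE [RHS]mxE ffunE; case: (l == i); first by rewrite [RHS]mxE.
by move/matrixP/(_ k l): CA; rewrite [LHS]mxE.
Qed.
End Pivots.

Section LimitAlgebra.
Variables (R : realType) (T : Type) (U : set_system T) (n : nat).
Context {UU : UltraFilter U}.
Variable P : T -> 'M[R]_n.
Hypothesis Pu : forall t, P t \in unitmx.
Let V := dlim U P.

Lemma dlim_comm X Y : V X -> V Y -> X *m Y = Y *m X.
Proof.
move=> [d dX] [e eY].
have FU : Filter U by apply: filter_filter.
apply: (mx_cvg_unique (@cvg_mulmx R T U FU _ _ _ _ _ _ _ dX eY)).
under eq_fun do rewrite dconjM //.
have -> : (fun t => dconj (P t) (\row_i (d t 0 i * e t 0 i))) =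
          (fun t => dconj (P t) (e t) *m dconj (P t) (d t)).
  apply/funext => t; rewrite dconjM //; congr dconj; apply/rowP => i.
  by rewrite !mxE mulrC.
exact: cvg_mulmx.
Qed.

Lemma dconj_eig (Q : 'M[R]_n) (d : 'rV[R]_n) i : Q \in unitmx ->
  row i Q *m dconj Q d = d 0 i *: row i Q.
Proof.
move=> Qu; rewrite /dconj !mulmxA -row_mul mulmxV // row1.
rewrite -rowE row_diag_mx -scalemxAl -rowE //.
Qed.

Lemma eig_bound (X : 'M[R]_n) (v : 'rV[R]_n) a : v != 0 -> v *m X = a *: v ->
  `|a| <= n%:R * `|X|.
Proof.
move=> v0 vX; have v1 : 0 < `|v| by rewrite normr_gt0.
rewrite -(ler_pM2r v1) -normrZ -vX; apply: mx_norm_le; first by rewrite !mulr_ge0.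
move=> i j; rewrite mxE; apply: le_trans (ler_norm_sum _ _ _) _.
apply: (@le_trans _ _ (\sum_(l < n) `|v| * `|X|)).
  by apply: ler_sum => l _; rewrite normrM ler_pM // mx_norm_entry.
by rewrite sumr_const card_ord -[leLHS]mulr_natl [`|v| * _]mulrC mulrA.
Qed.

Lemma row_unit_neq0 (Q : 'M[R]_n) i : Q \in unitmx -> row i Q != 0.
Proof.
move=> Qu; apply/eqP => Qi; have := congr1 (mulmx^~ (invmx Q)) Qi.
rewrite /= -row_mul mulmxV // mul0mx row1 => /matrixP/(_ 0 i)/eqP.
by rewrite !mxE !eqxx oner_eq0.
Qed.

(** The eigenvalues [d t] are bounded, so they converge along the ultrafilter;
    the limit matrix is annihilated by the product over the limit
    eigenvalues. *)
Lemma dlim_eigenvalues (d : T -> 'rV[R]_n) (X : 'M[R]_n) :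
  (fun t => dconj (P t) (d t)) @ U --> X ->
  exists2 dd : 'rV[R]_n, d @ U --> dd & split_eval X [seq dd 0 i | i <- enum 'I_n] = 0.
Proof.
move=> dX.
have [|dd ddU] := @ultra_mx_cvg R T U UU 1 n d (n%:R * (`|X| + 1)).
  near=> t.
  have Xt : `|dconj (P t) (d t)| <= `|X| + 1.
    rewrite -lerBlDl (le_trans (lerB_dist _ _)) // distrC.
    by apply: ltW; near: t; exact: (cvgrPdist_lt _ _).1 dX _ ltr01.
  apply: mx_norm_le; first by rewrite mulr_ge0 // addr_ge0.
  move=> i j; rewrite ord1.
  apply: le_trans (eig_bound (row_unit_neq0 j (Pu t)) (dconj_eig (d t) j (Pu t))) _.
  exact: ler_wpM2l.
exists dd => //.
have E t : split_eval (dconj (P t) (d t)) [seq d t 0 i | i <- enum 'I_n] = 0.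
  have PD : P t *m dconj (P t) (d t) = diag_mx (d t) *m P t.
    by rewrite /dconj !mulmxA mulmxV // mul1mx.
  have D0 : split_eval (diag_mx (d t)) [seq d t 0 i | i <- enum 'I_n] = 0.
    move: (d t); clear; case: n => [|m] d; first by rewrite thinmx0.
    have := char_poly_trig (diag_mx_is_trig d).
    rewrite split_evalE big_map big_enum /=.
    under [in X in X -> _]eq_bigr do rewrite mxE eqxx mulr1n.
    by move=> <-; exact: Cayley_Hamilton.
  apply: (can_inj (mulKmx (Pu t))).
  by rewrite (split_eval_intertwine _ PD) D0 mul0mx mulmx0.
apply: (@mx_cvg_unique R T U _ n n (fun t => split_eval (dconj (P t) (d t)) [seq d t 0 i | i <- enum 'I_n])).
  elim: (enum 'I_n) => [|i r IH] /=; first exact: cvg_cst.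
  apply: cvg_mulmx => //; apply: cvgB => //; apply: cvg_scalar_mx.
  exact: (cvg_mxP _ _).1 ddU 0 i.
have -> : (fun t => split_eval (dconj (P t) (d t)) [seq d t 0 i | i <- enum 'I_n]) = (fun=> 0).
  exact/funext.
exact: cvg_cst.
Unshelve. all: by end_near. Qed.

Lemma dlim_split X : V X -> split_mx X.
Proof. by move=> [d /dlim_eigenvalues[dd _ Xdd]]; exists [seq dd 0 i | i <- enum 'I_n]. Qed.

Let A t : 'M[R]_(n, n * n) := \matrix_i mxvec (dconj (P t) (delta_mx 0 i)).

Let AE t (d : 'rV[R]_n) : mxvec (dconj (P t) d) = d *m A t.
Proof.
rewrite mulmx_sum_row {1}[d]matrix_sum_delta big_ord1.
have lin (I : Type) (r : seq I) (f : I -> 'rV[R]_n) (c : I -> R) :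
    dconj (P t) (\sum_(i <- r) c i *: f i) = \sum_(i <- r) c i *: dconj (P t) (f i).
  elim: r => [|i r IH]; first by rewrite !big_nil /dconj linear0 mulmx0 mul0mx.
  by rewrite !big_cons dconj_lin IH.
rewrite lin linear_sum; apply: eq_bigr => i _.
by rewrite linearZ /= rowK.
Qed.

Let Afree t : row_free (A t).
Proof.
rewrite -kermx_eq0; apply/rowV0P => v /sub_kermxP; rewrite -AE => /eqP.
rewrite mxvec_eq0 => /eqP /(congr1 (fun X => P t *m X *m invmx (P t))).
rewrite /dconj !mulmxA mulmxV // mul1mx mulmxK // mulmx0 mul0mx => /matrixP D.
by apply/rowP => i; have := D i i; rewrite !mxE eqxx mulr1n.
Qed.

(** Pivot bases of the algebras [P_t^-1 D P_t] are bounded and, the places of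
    the pivots being constant along the ultrafilter, converge to a family with
    an identity submatrix, which is therefore free.  It spans the limit, because
    the coordinates of a matrix in a pivot basis are some of its entries. *)
Theorem dlim_basis : exists2 B : 'M[R]_(n, n * n), row_free B &
  forall X, V X <-> (mxvec X <= B)%MS.
Proof.
have /choice[S SP] : forall t, exists S : {ffun 'I_n -> 'I_(n * n)}, exists C : 'M[R]_n,
    [/\ C \in unitmx, colsub S (C *m A t) = 1%:M & forall i j, `|(C *m A t) i j| <= 1].
  by move=> t; have [S [C H]] := pivot_basis (Afree t); exists S, C.
have /choice[C CP] := SP.
pose B t := C t *m A t.
have [|B0 BU] := @ultra_mx_cvg R T U UU _ _ B 1.
  by apply: filterE => t; apply: mx_norm_le => // i j; have [_ _] := CP t; apply.
have [S0 US0] := ultra_fin S.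
have FU : Filter U by apply: filter_filter.
have sub_cvg p (f : T -> 'M[R]_(p, n * n)) (f0 : 'M[R]_(p, n * n)) : f @ U --> f0 ->
    (fun t => colsub (S t) (f t)) @ U --> colsub S0 f0.
  move=> ff; have L : (fun t => colsub S0 (f t)) @ U --> colsub S0 f0.
    apply/cvg_mxP => i j; rewrite mxE; under eq_fun do rewrite mxE.
    exact: (cvg_mxP _ _).1 ff i (S0 j).
  apply: cvg_trans L; apply: near_eq_cvg.
  by apply: (@filterS _ U _ _ _ _ US0) => t /= ->.
have SB : colsub S0 B0 = 1%:M.
  apply: (@mx_cvg_unique R T U _ n n (fun t => colsub (S t) (B t))); first exact: sub_cvg.
  have -> : (fun t => colsub (S t) (B t)) = (fun=> 1%:M).
    by apply/funext => t; have [] := CP t.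
  exact: cvg_cst.
exists B0.
  rewrite -kermx_eq0; apply/rowV0P => v /sub_kermxP vB.
  by rewrite -[v]mulmx1 -SB mulmx_colsub vB; apply/rowP => j; rewrite !mxE.
move=> X; split=> [[d dX]|/submxP[c Xc]].
  have XB : (fun t => mxvec (dconj (P t) (d t))) @ U --> mxvec X.
    apply/cvg_mxP => i k; rewrite ord1; case/mxvec_indexP: k => i1 j1.
    rewrite mxvecE; under eq_fun do rewrite mxvecE.
    exact: (cvg_mxP _ _).1.
  pose c t := d t *m invmx (C t).
  have cB t : mxvec (dconj (P t) (d t)) = c t *m B t.
    by have [Cu _ _] := CP t; rewrite AE /c /B mulmxA mulmxKV.
  have cU : c @ U --> colsub S0 (mxvec X).
    have -> : c = (fun t => colsub (S t) (mxvec (dconj (P t) (d t)))).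
      by apply/funext => t; have [_ CS _] := CP t; rewrite cB -mulmx_colsub CS mulmx1.
    exact: sub_cvg.
  apply/submxP; exists (colsub S0 (mxvec X)).
  apply: (mx_cvg_unique XB).
  under eq_fun do rewrite cB.
  exact: cvg_mulmx.
exists (fun t => c *m C t).
have L : (fun t => c *m B t) @ U --> mxvec X.
  by rewrite Xc; apply: cvg_mulmx => //; exact: cvg_cst.
apply/cvg_mxP => i j; have := (cvg_mxP _ _).1 L 0 (mxvec_index i j).
have -> : (fun t => (c *m B t) 0 (mxvec_index i j)) =
    (fun t => dconj (P t) (c *m C t) i j).
  by apply/funext => t; rewrite /B mulmxA -AE mxvecE.
by rewrite mxvecE => H; exact: H.
Qed.

End LimitAlgebra.

Section Auxiliary.
Variable R : realType.

Lemma trig_mul_diag n (A B : 'M[R]_n) i : is_trig_mx A -> is_trig_mx B ->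
  (A *m B) i i = A i i * B i i.
Proof.
move=> /is_trig_mxP tA /is_trig_mxP tB; rewrite mxE (bigD1 i) //= big1 ?addr0 //.
move=> k ki; have [ik|] := ltnP i k; first by rewrite tA ?mul0r.
by rewrite leq_eqVlt (inj_eq val_inj) (negPf ki) /= => ki'; rewrite tB ?mulr0.
Qed.

Lemma split_eval_eig n (X : 'M[R]_n) (v : 'rV[R]_n) a s : v *m X = a *: v ->
  v *m split_eval X s = (\prod_(c <- s) (a - c)) *: v.
Proof.
move=> vX; elim: s => [|c s IH] /=; first by rewrite big_nil scale1r mulmx1.
by rewrite big_cons mulmxA mulmxBr vX mul_mx_scalar -scalerBl -scalemxAl IH scalerA.
Qed.

Lemma closed_filter (T : topologicalType) (A : set T) :
  (forall (F : set_system T) x, ProperFilter F -> F A -> F --> x -> A x) -> closed A.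
Proof.
move=> H x; rewrite closureEcvg => -[G GP [Gx AG]].
by apply: (H G) => //; apply: AG.
Qed.

(** The [n]-th root, continuous on positive numbers. *)
Definition rootn n (x : R) := expR (ln x / n%:R).

Lemma rootnX n x : (0 < n)%N -> 0 < x -> rootn n x ^+ n = x.
Proof.
move=> n0 x0; rewrite /rootn -expRM_natl mulrC divfK ?lnK //.
by rewrite pnatr_eq0 -lt0n.
Qed.

Lemma rootn_gt0 n x : 0 < rootn n x.
Proof. exact: expR_gt0. Qed.

Lemma rootn1 n : rootn n 1 = 1.
Proof. by rewrite /rootn ln1 mul0r expR0. Qed.

Lemma cvg_rootn (T : Type) (F : set_system T) {FF : Filter F} n (f : T -> R) (a : R) :
  0 < a -> f @ F --> a -> (fun t => rootn n (f t)) @ F --> rootn n a.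
Proof.
move=> a0 fa; rewrite /rootn; apply: continuous_cvg; first exact: continuous_expR.
apply: cvgM; last exact: cvg_cst.
by apply: continuous_cvg => //; exact: continuous_ln.
Qed.
End Auxiliary.

(** * The limit group *)

Section LimitGroup.
Variables (R : realType) (T : Type) (U : set_system T) (n : nat).
Context {UU : UltraFilter U}.
Variable P : T -> 'M[R]_n.
Hypothesis Pu : forall t, P t \in unitmx.
Hypothesis n0 : (0 < n)%N.
Let V := dlim U P.

Let FU : Filter U. Proof. by apply: filter_filter. Qed.

(** Triangularize a basis of the limit algebra. *)
Lemma dlim_trig : exists2 Q : 'M[R]_n, Q \in unitmx &
  forall X, V X -> is_trig_mx (Q *m X *m invmx Q).
Proof.
have [B fB VB] := dlim_basis Pu.
pose L := [seq vec_mx (row i B) | i <- enum 'I_n].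
have LV X : X \in L -> V X.
  by move=> /mapP[i _ ->]; apply/VB; rewrite vec_mxK; exact: row_sub.
have [|Q Qu QL] := @commuting_split_trigonalizable _ _ L.
  by split=> [X Y /LV VX /LV VY|X /LV VX]; [exact: dlim_comm VX VY|exact: dlim_split VX].
exists Q => // X /VB/submxP[c Xc].
have -> : X = \sum_i c 0 i *: vec_mx (row i B).
  apply: (can_inj mxvecK); rewrite Xc mulmx_sum_row linear_sum; apply: eq_bigr => i _.
  by rewrite linearZ /= vec_mxK.
rewrite mulmx_sumr mulmx_suml; apply: (big_ind (fun X : 'M[R]_n => is_trig_mx X)).
- exact: mx0_is_trig.
- by move=> X1 X2 t1 t2; rewrite -[X2]scale1r; exact: trigD.
- move=> i _; rewrite -scalemxAr -scalemxAl -[_ *: _]add0r; apply: trigD; first exact: mx0_is_trig.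
  by apply: QL; apply/mapP; exists i; rewrite ?mem_enum.
Qed.

Variable Q : 'M[R]_n.
Hypothesis Qu : Q \in unitmx.
Hypothesis QV : forall X, V X -> is_trig_mx (Q *m X *m invmx Q).

(** The diagonal entries in a basis that triangularizes the limit algebra; on
    this algebra they are characters. *)
Definition joint_eig (X : 'M[R]_n) i := (Q *m X *m invmx Q) i i.

Definition posgrp : set 'M[R]_n :=
  [set h | [/\ V h, \det h = 1 & forall i, 0 < joint_eig h i]].

Let Vs : subalg V. Proof. exact: dlim_subalg. Qed.

Lemma det_conj (X : 'M[R]_n) : \det (Q *m X *m invmx Q) = \det X.
Proof.
rewrite !det_mulmx mulrAC -det_mulmx mulmxV // det1 mul1r //.
Qed.

Lemma joint_eig_lin a X Y i : joint_eig (a *: X + Y) i = a * joint_eig X i + joint_eig Y i.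
Proof. by rewrite /joint_eig mulmxDr mulmxDl -scalemxAr -scalemxAl !mxE. Qed.

Lemma joint_eig1 i : joint_eig 1%:M i = 1.
Proof. by rewrite /joint_eig mulmx1 mulmxV // mxE eqxx. Qed.

Lemma joint_eigM X Y i : V X -> V Y -> joint_eig (X *m Y) i = joint_eig X i * joint_eig Y i.
Proof.
move=> VX VY; rewrite -trig_mul_diag ?QV // /joint_eig; congr (fun_of_matrix _ i i).
by rewrite !mulmxA -(mulmxA _ (invmx Q) Q) mulVmx // mulmx1.
Qed.

Lemma det_joint_eig X : V X -> \det X = \prod_i joint_eig X i.
Proof. by move=> VX; rewrite -det_conj det_trig ?QV. Qed.

Lemma joint_eigenvector X i : V X -> exists2 v : 'rV[R]_n, v != 0 & v *m X = joint_eig X i *: v.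
Proof.
move=> VX; have [v v0 vX] := eigenvector_trig i (QV VX).
exists (v *m Q).
  by apply: contraNneq v0 => vQ; rewrite -[v](mulmxK Qu) vQ mul0mx.
move: vX; rewrite !mulmxA => /(congr1 (mulmx^~ Q)); rewrite mulmxKV // => ->.
by rewrite scalemxAl.
Qed.

Lemma cvg_joint_eig (S : Type) (F : set_system S) {FF : Filter F} (f : S -> 'M[R]_n) (X : 'M[R]_n) i :
  f @ F --> X -> (fun s => joint_eig (f s) i) @ F --> joint_eig X i.
Proof.
move=> fX; have L : (fun s => Q *m f s *m invmx Q) @ F --> Q *m X *m invmx Q.
  by apply: cvg_mulmx; [apply: cvg_mulmx => //; exact: cvg_cst|exact: cvg_cst].
exact: ((cvg_mxP _ _).1 L i i).
Qed.

Lemma dlim_closed : closed V.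
Proof.
have [B fB VB] := dlim_basis Pu.
apply: closed_filter => F X FP FV FX; apply/VB; rewrite submxE; apply/eqP.
have FF : Filter F by apply: filter_filter.
have L1 : (fun Y : 'M[R]_n => mxvec Y) @ F --> mxvec X.
  apply/cvg_mxP => i k; rewrite ord1; case/mxvec_indexP: k => i1 j1.
  rewrite mxvecE; under eq_fun do rewrite mxvecE.
  exact: ((@cvg_mxP R _ F FF n n id X).1 FX i1 j1).
have L2 : (fun Y : 'M[R]_n => mxvec Y *m cokermx B) @ F --> mxvec X *m cokermx B.
  by apply: cvg_mulmx => //; exact: cvg_cst.
apply: (mx_cvg_unique L2); apply: (@cvg_trans _ ((fun=> 0) @ F)); last exact: cvg_cst.
apply: near_eq_cvg; apply: (@filterS _ F _ _ _ _ FV) => Y /VB.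
by rewrite submxE => /eqP.
Qed.

Definition posrow (d : 'rV[R]_n) := (forall i, 0 < d 0 i) /\ \prod_i d 0 i = 1.

Lemma det_dconj (S : 'M[R]_n) d : S \in unitmx -> \det (dconj S d) = \prod_i d 0 i.
Proof.
by move=> Su; rewrite /dconj !det_mulmx mulrAC -det_mulmx mulVmx // det1 mul1r det_diag.
Qed.

(** The limit of the Cartan subgroups.  The limits of the eigenvalues of the
    approximants of [h] are eigenvalues of [h], so if the latter are positive
    the former are eventually positive, and a rescaling by the [n]-th root of
    the determinant makes the approximants elements of the Cartan subgroups.
    Conversely the eigenvalues of a limit of positive matrices are nonnegative,
    and nonzero as the determinant is 1. *)
Lemma posgrp_limP h : posgrp h <->
  exists2 d : T -> 'rV[R]_n, (forall t, posrow (d t)) & (fun t => dconj (P t) (d t)) @ U --> h.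
Proof.
split=> [[[d dh] h1 hp]|[d dp dh]].
  have [dd dU _] := dlim_eigenvalues Pu dh.
  have ddp j : 0 < dd 0 j.
    have D0 : \det (h - (dd 0 j)%:M) = 0.
      have L : (fun t => \det (dconj (P t) (d t) - (d t 0 j)%:M)) @ U --> \det (h - (dd 0 j)%:M).
        apply: cvg_det; apply: cvgB => //; apply: cvg_scalar_mx; exact: (cvg_mxP _ _).1 dU 0 j.
      have E : (fun t => \det (dconj (P t) (d t) - (d t 0 j)%:M)) = (fun=> 0).
        apply/funext => t; apply/eqP/det0P; exists (row j (P t)); first exact: row_unit_neq0.
        by rewrite mulmxBr dconj_eig // mul_mx_scalar subrr.
      move: L; rewrite E => L; apply: (cvg_unique (@norm_hausdorff R R) L); exact: cvg_cst.
    have [S1 SL SM] := Vs.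
    have Vh : V h by exists d.
    have VX : V (h - (dd 0 j)%:M).
      by rewrite -scalemx1 -scaleNr addrC; apply: SL.
    move: D0; rewrite (det_joint_eig VX) => /eqP/prodf_eq0[i _].
    have -> : joint_eig (h - (dd 0 j)%:M) i = joint_eig h i - dd 0 j.
      by rewrite -scalemx1 -scaleNr addrC joint_eig_lin joint_eig1 mulr1 addrC.
    by rewrite subr_eq0 => /eqP <-.
  pose c t := (rootn n (\prod_i d t 0 i))^-1.
  (* The constant row 1 is a default value for the indices at which some
     eigenvalue of the approximant is not yet positive. *)
  have [e eP] : exists e : T -> 'rV[R]_n, forall t, posrow (e t) /\
      ((forall i, 0 < d t 0 i) -> e t = c t *: d t).
    have /choice[e eP] : forall t, exists e : 'rV[R]_n, posrow e /\
      ((forall i, 0 < d t 0 i) -> e = c t *: d t).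
      move=> t; have [dp|ndp] := pselect (forall i, 0 < d t 0 i); last first.
        exists (const_mx 1); split => //; split=> [i|]; first by rewrite mxE.
        by rewrite big1 // => i _; rewrite mxE.
      exists (c t *: d t); split => //.
      have D0 : 0 < \prod_i d t 0 i by apply: prodr_gt0.
      split=> [i|]; first by rewrite mxE mulr_gt0 // invr_gt0 rootn_gt0.
      under eq_bigr do rewrite mxE.
      rewrite big_split /= prodr_const card_ord exprVn rootnX // mulVf //.
      by rewrite gt_eqF.
    by exists e.
  exists e; first by move=> t; have [] := eP t.
  have cU : c @ U --> (1 : R).
    rewrite -[X in _ --> X]invr1; apply: cvgV; first exact: oner_neq0.
    rewrite -[X in _ --> X](rootn1 R n); apply: cvg_rootn => //.
    have := cvg_det dh.
    have -> : (fun t => \det (dconj (P t) (d t))) = (fun t => \prod_i d t 0 i).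
      by apply/funext => t; rewrite det_dconj.
    by rewrite h1 => H; exact: H.
  have L : (fun t => c t *: dconj (P t) (d t)) @ U --> h.
    by rewrite -[h]scale1r; apply: cvgZ.
  apply: cvg_trans L; apply: near_eq_cvg.
  near=> t; have [_ ->] := eP t.
    have := dconj_lin (P t) (c t) (d t) 0; rewrite !addr0 => ->.
    by rewrite /dconj linear0 mulmx0 mul0mx addr0.
  near: t; apply: filter_forall => i.
  exact: (cvgr_gt _ ((cvg_mxP _ _).1 dU 0 i)).
have Vh : V h by exists d.
have h1 : \det h = 1.
  apply: (cvg_unique (@norm_hausdorff R R) (cvg_det dh)).
  have -> : (fun t => \det (dconj (P t) (d t))) = (fun=> 1).
    by apply/funext => t; rewrite det_dconj //; have [] := dp t.
  exact: cvg_cst.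
split => // i.
have [dd dU hdd] := dlim_eigenvalues Pu dh.
have dd0 j : 0 <= dd 0 j.
  apply: (cvgr_to_ge ((cvg_mxP _ _).1 dU 0 j)).
  by apply: filterE => t; have [/(_ j)/ltW] := dp t.
rewrite lt_def; apply/andP; split.
  apply/eqP => di; have := det_joint_eig Vh; rewrite h1 (bigD1 i) //= di mul0r.
  by move/eqP; rewrite oner_eq0.
have [v v0 vh] := joint_eigenvector i Vh.
have := split_eval_eig [seq dd 0 i | i <- enum 'I_n] vh.
rewrite hdd mulmx0 => /esym/eqP; rewrite scaler_eq0 (negPf v0) orbF big_map.
rewrite prodf_seq_eq0 => /hasP[j _ /=]; rewrite subr_eq0 => /eqP ->.
exact: dd0.
Unshelve. all: by end_near. Qed.

Lemma invmx_adj (X : 'M[R]_n) : \det X = 1 -> invmx X = \adj X.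
Proof. by move=> X1; rewrite /invmx unitmxE X1 unitr1 invr1 scale1r. Qed.

Lemma dlim_expmx X : V X -> V (expmx X).
Proof.
move=> VX; have [V1 VL VM] := Vs.
apply: (closed_cvg V dlim_closed _ _ (@expmx_powers R n X)).
apply: filterE => k; have VY : V (k.+1%:R^-1 *: X + 1) by exact: (VL _ _ 1%:M VX V1).
elim: {2}(k.+1) => [|m IH]; first by rewrite expr0.
by rewrite exprS -mulmxE; exact: VM.
Qed.

Lemma posgrp_csg : is_csg posgrp.
Proof.
have [V1 VL VM] := Vs; split.
- by move=> h [].
- by split; rewrite ?det1 // => i; rewrite joint_eig1.
- move=> g h [Vg g1 gp] [Vh h1 hp]; split; first exact: VM.
    by rewrite det_mulmx g1 h1 mulr1.
  by move=> i; rewrite joint_eigM // mulr_gt0.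
- move=> h hG; have [_ h1 _] := hG; move/posgrp_limP: hG => [d dp dh].
  apply/posgrp_limP; exists (fun t => \row_i (d t 0 i)^-1) => [t|].
    have [d0 d1] := dp t; split=> [i|]; first by rewrite mxE invr_gt0.
    by under eq_bigr do rewrite mxE; rewrite prodfV d1 invr1.
  rewrite invmx_adj //.
  have -> : (fun t => dconj (P t) (\row_i (d t 0 i)^-1)) = (fun t => \adj (dconj (P t) (d t))).
    apply/funext => t; have [d0 d1] := dp t.
    have D1 : \det (dconj (P t) (d t)) = 1 by rewrite det_dconj.
    have Du : dconj (P t) (d t) \in unitmx by rewrite unitmxE D1 unitr1.
    rewrite -invmx_adj //; apply: (can_inj (mulKmx Du)); rewrite mulmxV // dconjM //.
    rewrite -(dconj1 (Pu t)); congr dconj; apply/rowP => i; rewrite !mxE mulfV //.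
    by rewrite gt_eqF.
  exact: cvg_adj.
apply: closed_filter => F X FP FG FX.
have FF : Filter F by apply: filter_filter.
have VX : V X.
  apply: (closed_cvg V dlim_closed _ _ FX).
  by apply: (@filterS _ F _ _ _ _ FG) => Y [].
have X1 : \det X = 1.
  apply: (cvg_unique (@norm_hausdorff R R) (@cvg_det R _ F FF n id X FX)).
  apply: (@cvg_trans _ ((fun=> 1) @ F)); last exact: cvg_cst.
  by apply: near_eq_cvg; apply: (@filterS _ F _ _ _ _ FG) => Y [].
split => // i; rewrite lt_def; apply/andP; split.
  apply/eqP => di; have := det_joint_eig VX; rewrite X1 (bigD1 i) //= di mul0r.
  by move/eqP; rewrite oner_eq0.
apply: (cvgr_to_ge (@cvg_joint_eig _ F FF id X i FX)).
by apply: (@filterS _ F _ _ _ _ FG) => Y [_ _ /(_ i)/ltW].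
Qed.

Lemma posgrp_comm g h : posgrp g -> posgrp h -> g *m h = h *m g.
Proof. by move=> [Vg _ _] [Vh _ _]; exact: dlim_comm Vg Vh. Qed.

(** The derivative at 0 of the product of the [1 + t x_i]. *)
Lemma cvg_prod_deriv (S : Type) (F : set_system S) {FF : Filter F} (I : Type) (r : seq I)
    (x : I -> R) (t : S -> R) : t @ F --> (0 : R) -> (forall s, t s != 0) ->
  (fun s => (t s)^-1 * (\prod_(i <- r) (t s * x i + 1) - 1)) @ F --> \sum_(i <- r) x i.
Proof.
move=> t0 tn0; elim: r => [|i r IH].
  rewrite big_nil; under eq_fun do rewrite big_nil subrr mulr0; exact: cvg_cst.
rewrite big_cons.
have -> : (fun s => (t s)^-1 * (\prod_(j <- i :: r) (t s * x j + 1) - 1)) =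
   (fun s => x i * \prod_(j <- r) (t s * x j + 1) +
      (t s)^-1 * (\prod_(j <- r) (t s * x j + 1) - 1)).
  by apply/funext => s; rewrite big_cons; field.
apply: cvgD => //; rewrite -[X in _ --> X]mulr1; apply: cvgM; first exact: cvg_cst.
have E1 : (1 : R) = \prod_(j <- r) (0 * x j + 1).
  by rewrite big1 // => j _; rewrite mul0r add0r.
rewrite [X in _ --> X]E1.
have H j : (fun s => t s * x j + 1) @ F --> 0 * x j + 1.
  by apply: cvgD; [apply: cvgM => //; exact: cvg_cst|exact: cvg_cst].
have L := @cvg_prodr R S F FF I r predT (fun j s => t s * x j + 1) (fun j => 0 * x j + 1) H.
exact: L.
Qed.

(** The determinant of the exponential is the exponential of the trace, stated
    in size 1 so that Euler's formula can be applied on both sides. *)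
Lemma det_expmx X : V X -> (\det (expmx X))%:M = expmx ((\tr X)%:M : 'M[R]_1).
Proof.
move=> VX.
pose w (k : nat) := \det (k.+1%:R^-1 *: X + 1) - 1.
have detX (A : 'M[R]_n) k : \det (A ^+ k) = \det A ^+ k.
  elim: k => [|k IH]; first by rewrite !expr0 det1.
  by rewrite !exprS -mulmxE det_mulmx IH.
have scX (a : R) k : (a%:M : 'M[R]_1) ^+ k = (a ^+ k)%:M.
  elim: k => [|k IH]; first by rewrite !expr0.
  by rewrite !exprS IH -mulmxE -scalar_mxM.
have L1 : (fun k : nat => ((w k)%:M + 1 : 'M[R]_1) ^+ k.+1) @ \oo --> ((\det (expmx X))%:M : 'M[R]_1).
  have -> : (fun k : nat => ((w k)%:M + 1 : 'M[R]_1) ^+ k.+1) =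
      (fun k : nat => (\det ((k.+1%:R^-1 *: X + 1) ^+ k.+1))%:M).
    apply/funext => k; rewrite detX -scX; congr (_ ^+ _).
    have -> : (1 : 'M[R]_1) = 1%:M by [].
    by rewrite -raddfD /= /w subrK.
  by apply: cvg_scalar_mx; apply: cvg_det; exact: expmx_powers.
apply: (mx_cvg_unique L1); apply: (powers_cvg_expmx cvg_succ).
have -> : (fun t : nat => t.+1%:R *: ((w t)%:M : 'M[R]_1)) = (fun t => (t.+1%:R * w t)%:M).
  by apply/funext => t; rewrite scale_scalar_mx.
apply: cvg_scalar_mx.
have -> : \tr X = \sum_i joint_eig X i.
  have -> : \sum_i joint_eig X i = \tr (Q *m X *m invmx Q) by [].
  by rewrite mxtrace_mulC mulmxA mulVmx // mul1mx.
have -> : (fun t : nat => t.+1%:R * w t) =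
    (fun t : nat => (t.+1%:R^-1)^-1 * (\prod_i (t.+1%:R^-1 * joint_eig X i + 1) - 1)).
  apply/funext => t; rewrite invrK /w det_joint_eig.
    by congr (_ * (_ - _)); apply: eq_bigr => i _; rewrite joint_eig_lin joint_eig1.
  by have [V1 VL VM] := Vs; exact: (VL _ _ 1%:M VX V1).
by apply: cvg_prod_deriv; [exact: cvg_invS|move=> s; rewrite invr_eq0].
Qed.

Lemma tr0_of_det X : V X -> (forall t, \det (expmx (t *: X)) = 1) -> \tr X = 0.
Proof.
move=> VX LX; have : [set 0] ((\tr X)%:M : 'M[R]_1).
  apply: lie_mem.
  - exact: (accessible_closed_set1 (hausdorff_accessible (@norm_hausdorff R 'M[R]_1))).
  - by move=> a Y ->; rewrite /= scaler0.
  - move=> t /=; have -> : t *: ((\tr X)%:M : 'M[R]_1) = (\tr (t *: X))%:M.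
      by rewrite scale_scalar_mx mxtraceZ.
    have VtX : V (t *: X) by exact: subalgZ.
    by rewrite -(det_expmx VtX) LX subrr.
by move/matrixP/(_ 0 0); rewrite !mxE eqxx mulr1n.
Qed.

(** For [X] traceless in the limit algebra, the eigenvalues of [exp (t X)] are
    positive because this matrix is the square of [exp (t X / 2)], which is in
    the algebra. *)
Lemma lie_posgrp : lie_algebra posgrp = [set X | V X /\ \tr X = 0].
Proof.
have [V1 VL VM] := Vs.
have VZ a X : V X -> V (a *: X) by exact: subalgZ.
apply/seteqP; split=> X.
  move=> LX; have VX : V X.
    apply: (@lie_mem R n V X dlim_closed VZ) => t.
    by have [Ve _ _] := LX t; rewrite addrC -scaleN1r; apply: VL.
  split=> //; apply: tr0_of_det => // t; by have [] := LX t.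
move=> [VX trX] t.
have E (s : R) : V (expmx (s *: X)) by apply: dlim_expmx; exact: VZ.
split=> //.
  have := det_expmx (VZ t X VX); rewrite mxtraceZ trX mulr0 raddf0 expmx0.
  by move/matrixP/(_ 0 0); rewrite !mxE.
move=> i.
have -> : expmx (t *: X) = expmx ((t / 2) *: X) *m expmx ((t / 2) *: X).
  by rewrite -expmxD // -scalerDl -splitr.
rewrite joint_eigM // -expr2 exprn_even_gt0 //=.
apply/eqP => d0; have := joint_eig1 i; rewrite -(expmxN ((t / 2) *: X)) -scaleNr joint_eigM //.
by rewrite d0 mul0r => /esym/eqP; rewrite oner_eq0.
Qed.

(** The segment from 1 to [h] has positive eigenvalues; dividing by the [n]-th
    root of the determinant gives a path in the group. *)
Lemma posgrp_connected : connected posgrp.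
Proof.
have [V1 VL VM] := Vs.
pose w (h : 'M[R]_n) (s : R) := s *: (h - 1%:M) + 1%:M.
pose g h s := (rootn n (\det (w h s)))^-1 *: w h s.
have Vw h s : V h -> V (w h s).
  by move=> Vh; apply: (VL) => //; rewrite addrC -scaleN1r; exact: VL.
have dgw h s i : joint_eig (w h s) i = (1 - s) + s * joint_eig h i.
  have dgB : joint_eig (h - 1%:M) i = joint_eig h i - 1.
    by rewrite -scaleN1r addrC joint_eig_lin joint_eig1; ring.
  by rewrite joint_eig_lin joint_eig1 dgB; ring.
have wp h s : posgrp h -> 0 <= s <= 1 -> forall i, 0 < joint_eig (w h s) i.
  move=> [Vh _ hp] /andP[s0 s1] i; rewrite dgw.
  have [->|s1'] := eqVneq s 1; first by rewrite subrr add0r mul1r.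
  have : 0 <= s * joint_eig h i by rewrite mulr_ge0 // ltW.
  have : s < 1 by rewrite lt_def eq_sym s1' s1.
  lra.
have dw h s : posgrp h -> 0 <= s <= 1 -> 0 < \det (w h s).
  by move=> hG s01; have [Vh _ _] := hG; rewrite (det_joint_eig (Vw _ _ Vh)); apply: prodr_gt0 => i _; exact: wp.
have cw h s : w h @ s --> w h s.
  apply: cvgD; last exact: cvg_cst.
  by apply: (@cvgZl _ _ _ _ _ id); exact: cvg_id.
have gG h s : posgrp h -> 0 <= s <= 1 -> posgrp (g h s).
  move=> hG s01; have [Vh _ _] := hG; split.
  - by apply: subalgZ => //; exact: Vw.
  - by rewrite /g detZ exprVn rootnX ?dw // mulVf // gt_eqF // dw.
  - move=> i; rewrite /g -[_ *: w h s]addr0 joint_eig_lin.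
    have -> : joint_eig 0 i = 0 by rewrite /joint_eig mulmx0 mul0mx mxE.
    by rewrite addr0 mulr_gt0 ?invr_gt0 ?rootn_gt0 //; exact: wp.
have -> : posgrp = \bigcup_(h in posgrp) (g h @` `[0, 1]%classic).
  apply/seteqP; split=> [h hG|_ [h hG [s /= s01 <-]]]; last by apply: gG => //; rewrite in_itv in s01.
  exists h => //; exists 1; first by rewrite /= in_itv /= ler01 lexx.
  have [_ h1 _] := hG.
  by rewrite /g /w scale1r subrK h1 rootn1 invr1 scale1r.
apply: bigcup_connected.
  exists 1%:M => h hG; exists 0; first by rewrite /= in_itv /= lexx ler01.
  by rewrite /g /w scale0r add0r det1 rootn1 invr1 scale1r.
move=> h hG; apply: connected_continuous_connected; first exact: segment_connected.
apply: continuous_in_subspaceT => s; rewrite inE /= in_itv /= => s01.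
apply: cvgZ; last exact: cw.
apply: cvgV; first by rewrite gt_eqF // rootn_gt0.
apply: cvg_rootn; first exact: dw.
by apply: cvg_det; exact: cw.
Qed.

End LimitGroup.

(** * Borel and Cartan subgroups *)

Section BorelAndCartan.
Variables (R : realType) (n : nat).

(** The permutation matrix that reverses the basis, which exchanges upper and
    lower triangular matrices. *)
Definition revmx : 'M[R]_n := \matrix_(i, j) (i == rev_ord j)%:R.

Lemma mul_revmx m (Y : 'M[R]_(m, n)) i j : (Y *m revmx) i j = Y i (rev_ord j).
Proof.
rewrite mxE (bigD1 (rev_ord j)) //= mxE eqxx mulr1 big1 ?addr0 //.
by move=> k /negPf kj; rewrite mxE kj mulr0.
Qed.

Lemma mul_revmxl m (Y : 'M[R]_(n, m)) i j : (revmx *m Y) i j = Y (rev_ord i) j.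
Proof.
rewrite mxE (bigD1 (rev_ord i)) //= mxE rev_ordK eqxx mul1r big1 ?addr0 //.
move=> k ki; rewrite mxE (_ : (i == rev_ord k) = false) ?mul0r //.
by apply: contraNF ki => /eqP ->; rewrite rev_ordK.
Qed.

Lemma revmxK : revmx *m revmx = 1%:M.
Proof. by apply/matrixP => i j; rewrite mul_revmx !mxE rev_ordK. Qed.

Lemma rev_trig (Y : 'M[R]_n) : is_trig_mx (revmx *m Y *m revmx) <->
  forall i j : 'I_n, (j < i)%N -> Y i j = 0.
Proof.
split=> [/is_trig_mxP tY i j ji|H].
  have := tY (rev_ord i) (rev_ord j); rewrite mul_revmx mul_revmxl !rev_ordK; apply.
  by apply: ltn_sub2l => //; exact: leq_ltn_trans ji (ltn_ord i).
apply/is_trig_mxP => i j ij; rewrite mul_revmx mul_revmxl; apply: H.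
by apply: ltn_sub2l => //; exact: leq_ltn_trans ij (ltn_ord j).
Qed.

Lemma split_mx_upper (Y : 'M[R]_n) : (forall i j : 'I_n, (j < i)%N -> Y i j = 0) -> split_mx Y.
Proof.
move=> /rev_trig/split_mx_trig; apply: (@split_mx_sub _ _ _ revmx).
  by rewrite !mulmxA revmxK mul1mx.
by rewrite row_free_unit; case/mulmx1_unit: revmxK.
Qed.

(** Multiply the first column by the inverse of the determinant. *)
Lemma SL_scale (g : 'M[R]_n) : (0 < n)%N -> g \in unitmx ->
  exists2 d : 'rV[R]_n, (forall i, d 0 i != 0) & SL R n (g *m diag_mx d).
Proof.
case: n g => // m g _ gu; exists (\row_i (if i == 0 then (\det g)^-1 else 1)).
  move=> i; rewrite mxE; case: (i == 0); rewrite ?oner_eq0 // invr_eq0.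
  by rewrite -unitfE -unitmxE.
rewrite /SL /= det_mulmx det_diag (bigD1 0) //= mxE eqxx big1 ?mulr1.
  by rewrite mulfV // -unitfE -unitmxE.
by move=> i /negPf i0; rewrite mxE i0.
Qed.

Lemma diag_unit (d : 'rV[R]_n) : (forall i, d 0 i != 0) -> diag_mx d \in unitmx.
Proof. by move=> d0; rewrite unitmxE det_diag unitfE; apply/prodf_neq0 => i _. Qed.

Lemma invmx_diag (d : 'rV[R]_n) : (forall i, d 0 i != 0) ->
  invmx (diag_mx d) = diag_mx (\row_i (d 0 i)^-1).
Proof.
move=> d0; apply: (can_inj (mulKmx (diag_unit d0))); rewrite mulmxV ?diag_unit //.
rewrite mulmx_diag -diag_const_mx; congr diag_mx; apply/rowP => i.
by rewrite !mxE mulfV.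
Qed.

Lemma borel_of_trig (Q : 'M[R]_n) : (0 < n)%N -> Q \in unitmx ->
  exists2 g, SL R n g & forall X, \det X = 1 -> is_trig_mx (Q *m X *m invmx Q) ->
    conjmx_set g (upper_triangular R n) X.
Proof.
move=> n0 Qu; have [Ju _] := mulmx1_unit revmxK.
have [|d d0 gSL] := @SL_scale (invmx Q *m revmx) n0.
  by rewrite unitmx_mul unitmx_inv Qu.
move Eg: (invmx Q *m revmx *m diag_mx d) gSL => g gSL; exists g => // X X1 tX.
have gu := SL_unit gSL.
exists (invmx g *m X *m g); last first.
  by rewrite -!mulmxA mulmxV // mulmx1 mulKVmx.
split; first by rewrite /SL /= !det_mulmx mulrAC -det_mulmx mulVmx // det1 mul1r.
have -> : invmx g *m X *m g = invmx (diag_mx d) *m (revmx *m (Q *m X *m invmx Q) *m revmx) *m diag_mx d.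
  rewrite -Eg !invmx_mul ?unitmx_mul ?unitmx_inv ?Qu ?diag_unit // invmxK.
  have -> : invmx revmx = revmx.
    by apply: (can_inj (mulKmx Ju)); rewrite mulmxV // revmxK.
  by rewrite !mulmxA.
rewrite invmx_diag // => i j ji; rewrite mul_mx_diag mxE mul_diag_mx mxE.
suff -> : (revmx *m (Q *m X *m invmx Q) *m revmx) i j = 0 by rewrite mulr0 mul0r.
rewrite mul_revmx mul_revmxl; move/is_trig_mxP: tX; apply.
by apply: ltn_sub2l => //; exact: leq_ltn_trans ji (ltn_ord i).
Qed.

Lemma cartan_conjE (P : 'M[R]_n) (d : 'rV[R]_n) : P \in unitmx -> (forall i, d 0 i != 0) ->
  conjmx_set (invmx P *m diag_mx d) (posdiag R n) = [set dconj P e | e in posrow (R := R) (n := n)].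
Proof.
move=> Pu d0; have Du := diag_unit d0.
have E e : invmx P *m diag_mx d *m diag_mx e *m invmx (invmx P *m diag_mx d) = dconj P e.
  rewrite invmx_mul ?unitmx_inv // invmxK /dconj !mulmxA; congr (_ *m _).
  by rewrite -!mulmxA (mulmxA _ (diag_mx e)) diag_mxC -mulmxA mulmxV // mulmx1.
apply/seteqP; split=> [_ [a [/diag_mxP[e ->] [ap a1]] <-]|_ [e [e0 e1] <-]].
  exists e; last by rewrite E.
  by split=> [i|]; [have := ap i; rewrite mxE eqxx|rewrite -det_diag].
exists (diag_mx e); last exact: E.
split; first exact: diag_mx_is_diag.
by split=> [i|]; [rewrite mxE eqxx; exact: e0|rewrite det_diag].
Qed.

Lemma Cartan_dconj (L : closedSubgroup R n) : Cartan R n L ->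
  exists2 P, P \in unitmx & csg_set L = [set dconj P e | e in posrow (R := R) (n := n)].
Proof.
move=> [g gSL ->]; have gu := SL_unit gSL.
exists (invmx g); first by rewrite unitmx_inv.
rewrite -(@cartan_conjE _ (const_mx 1)) ?unitmx_inv //; last by move=> i; rewrite mxE oner_eq0.
by rewrite invmxK diag_const_mx mulmx1.
Qed.

(** This is the limit group of a constant family, indexed by a point. *)
Lemma is_csg_cartan (P : 'M[R]_n) : (0 < n)%N -> P \in unitmx ->
  is_csg [set dconj P e | e in posrow (R := R) (n := n)].
Proof.
move=> n0 Pu; pose U := principal_filter tt.
have UU : UltraFilter U by exact: principal_filter_ultra.
have Pu' (t : unit) : P \in unitmx by [].
have [Q Qu QV] := @dlim_trig R unit U n UU (fun=> P) Pu'.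
have -> : [set dconj P e | e in posrow (R := R) (n := n)] = posgrp U (fun=> P) Q.
  apply/seteqP; split=> [_ [e pe <-]|h].
    by apply/(posgrp_limP Pu' n0 Qu QV); exists (fun=> e) => //; exact: cvg_cst.
  move/(posgrp_limP Pu' n0 Qu QV) => [d dp dh]; exists (d tt) => //.
  apply: (mx_cvg_unique _ dh).
  have -> : (fun t => dconj P (d t)) = (fun=> dconj P (d tt)) by apply/funext => -[].
  exact: cvg_cst.
exact: (posgrp_csg Pu' n0 Qu QV).
Qed.

Lemma cartan_exists (P : 'M[R]_n) : (0 < n)%N -> P \in unitmx ->
  exists2 L : closedSubgroup R n, Cartan R n L &
    csg_set L = [set dconj P e | e in posrow (R := R) (n := n)].
Proof.
move=> n0 Pu; have [sSL s1 sM sI sC] := is_csg_cartan n0 Pu.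
exists (ClosedSubgroup sSL s1 sM sI sC) => //=.
have Piu : invmx P \in unitmx by rewrite unitmx_inv.
have [d d0 gSL] := SL_scale n0 Piu.
by exists (invmx P *m diag_mx d) => //=; rewrite cartan_conjE.
Qed.
End BorelAndCartan.

(** * Dimensions of Lie algebras *)

Section Dimension.
Variable R : realType.

Lemma vspace_of_rows n N (B : 'M[R]_(N, n * n)) (V : set 'M[R]_n) : row_free B ->
  (forall X, V X <-> (mxvec X <= B)%MS) ->
  exists2 W : {vspace 'M[R]_n}, [set` W] = V & \dim W = N.
Proof.
move=> fB VB.
have [b bE] : exists b : N.-tuple 'M[R]_n, forall i : 'I_N, b`_i = vec_mx (row i B).
  by exists [tuple vec_mx (row i B) | i < N] => i; rewrite -tnth_nth tnth_mktuple.
have sumE (k : 'I_N -> R) : mxvec (\sum_(i < N) k i *: b`_i) = (\row_i k i) *m B.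
  rewrite mulmx_sum_row linear_sum; apply: eq_bigr => i _.
  by rewrite bE linearZ /= mxE vec_mxK.
exists <<b>>%VS; last first.
  rewrite (eqP (_ : free b)) ?size_tuple //; apply/freeP => k k0 i.
  have : (\row_i k i) *m B = 0 by rewrite -sumE k0 linear0.
  move/(congr1 (mulmx^~ (pinvmx B))); rewrite mul0mx mulmxKp // => /rowP/(_ i).
  by rewrite !mxE.
apply/seteqP; split=> X /=.
  by move=> Xb; apply/VB; rewrite (coord_span Xb) (sumE (fun i => coord b i X)) submxMl.
move/VB => /submxP[c Xc].
have -> : X = \sum_(i < N) c 0 i *: b`_i.
  apply: (can_inj mxvecK); rewrite sumE Xc; congr (_ *m _).
  by apply/rowP => i; rewrite mxE.
apply: memv_suml => i _; apply: memvZ; apply: memv_span; by apply: mem_nth; rewrite size_tuple.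
Qed.

(** The trace with values in [R^o], for which linear maps have kernels and
    images as vector spaces. *)
Definition tracef n (X : 'M[R]_n) : R^o := \tr X.
Lemma tracef_linear n : linear (@tracef n).
Proof. by move=> a X Y; rewrite /tracef linearP. Qed.
HB.instance Definition _ n := GRing.isLinear.Build R 'M[R]_n R^o *:%R (@tracef n) (@tracef_linear n).

Lemma dim_traceless n (W : {vspace 'M[R]_n}) : (0 < n)%N -> 1%:M \in W ->
  exists2 W0 : {vspace 'M[R]_n}, [set` W0] = [set X | X \in W /\ \tr X = 0] & \dim W0 = (\dim W).-1.
Proof.
move=> n0 W1; pose f := linfun (@tracef n).
exists (W :&: lker f)%VS.
  apply/seteqP; split=> X /=.
    by rewrite memv_cap memv_ker lfunE => /andP[-> /eqP].
  by move=> [XW X0]; rewrite memv_cap memv_ker lfunE XW; apply/eqP.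
have := limg_ker_dim f W.
suff -> : \dim (f @: W) = 1%N by rewrite addn1 => <-.
apply/eqP; rewrite eqn_leq; apply/andP; split.
  by apply: leq_trans (dimvS (subvf _)) _; rewrite dimvf.
rewrite lt0n dimv_eq0; apply/eqP => fW.
have : f 1%:M \in (f @: W)%VS by exact: memv_img.
by rewrite fW memv0 lfunE /= /tracef mxtrace1 pnatr_eq0 eqn0Ngt n0.
Qed.
End Dimension.

(** * Limits in the Chabauty topology *)

Section ChabautyLimits.
Variables (R : realType) (n : nat).

(** Otherwise a compact neighbourhood of [h] would avoid [H], hence avoid [L]
    for [L] close to [H]. *)
Lemma chabauty_lim_mem (U : set_system (closedSubgroup R n)) (H : closedSubgroup R n)
    (x : closedSubgroup R n -> 'M[R]_n) h : ProperFilter U -> U --> H ->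
  (\forall L \near U, csg_set L (x L)) -> x @ U --> h -> csg_set H h.
Proof.
move=> UP UH Lx xh; apply: contrapT => nHh.
have FU : Filter U by apply: filter_filter.
have [K cK hK] := mx_compact_ball h.
have : nbhs h (~` H) by apply: open_nbhs_nbhs; split => //; exact/closed_openC/csg_closed.
move=> /nbhs_ballP[e /= e0 eH].
pose C := K `&` closed_ball h (e / 2).
have cC : compact C by apply: (compact_closedI cK); exact: closed_ball_closed.
have HC : H `&` C = set0.
  rewrite -subset0 => y [Hy [_ yh]]; apply: (eH y) => //.
  by apply: closed_ball_subset yh; rewrite ?divr_gt0// gtr_pMr// invf_lt1// ltr1n.
have UC : \forall L \near U, csg_set L `&` C = set0.
  by apply: ((chabauty_cvg_subbaseP _ FU).1 UH [set L : closedSubgroup R n | L `&` C = set0]) => //; left; exists C.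
have xC : \forall L \near U, C (x L).
  have x1 : \forall L \near U, ball h 1 (x L) by apply: xh; exact: nbhsx_ballx.
  have x2 : \forall L \near U, ball h (e / 2) (x L) by apply: xh; apply: nbhsx_ballx; rewrite divr_gt0.
  apply: (@filterS2 _ U _ _ _ _ _ x1 x2) => L xL1 xL2; split; first exact: hK.
  exact: subset_closure.
have : \forall L \near U, False.
  apply: (@filterS3 _ U _ _ _ _ _ _ Lx UC xC) => L Lx' LC Cx.
  by have : (csg_set L `&` C) (x L) by []; rewrite LC.
by move=> /filter_ex[].
Qed.

(** Choose in each [L] a point whose distance to [h] is nearly minimal. *)
Lemma chabauty_lim_ex (U : set_system (closedSubgroup R n)) (H : closedSubgroup R n) h :
    ProperFilter U -> U --> H -> csg_set H h ->
  exists2 x : closedSubgroup R n -> 'M[R]_n, (forall L, csg_set L (x L)) & x @ U --> h.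
Proof.
move=> UP UH Hh.
have FU : Filter U by apply: filter_filter.
have /choice[x xP] : forall L : closedSubgroup R n, exists x, csg_set L x /\
    forall y, csg_set L y -> `|x - h| <= 2 * `|y - h|.
  move=> L; have [|x Lx xm] := near_min h (@csg_closed _ _ L); last by exists x.
  by exists 1%:M; exact: csg_1.
exists x => [L|]; first by have [] := xP L.
apply/cvgrPdist_lt => e e0.
have e2 : 0 < e / 2 by rewrite divr_gt0.
have : \forall L \near U, (csg_set L `&` ball h (e / 2)) !=set0.
  apply: ((chabauty_cvg_subbaseP _ FU).1 UH
    [set L : closedSubgroup R n | L `&` ball h (e / 2) !=set0]).
    by right; exists (ball h (e / 2)) => //=; exact: ball_open.
  by exists h; split => //; exact: ballxx.
apply: filterS => L [y [Ly]]; rewrite -ball_normE /= distrC => yh.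
have [_ /(_ y Ly) xm] := xP L.
by rewrite distrC; apply: le_lt_trans xm _; rewrite mulrC -ltr_pdivlMr.
Qed.
End ChabautyLimits.

(** * The two inclusions *)

Section Inclusions.
Variable R : realType.

Lemma posgrp_calA n T (U : set_system T) (UU : UltraFilter U) (P : T -> 'M[R]_n)
    (Pu : forall t, P t \in unitmx) (n0 : (0 < n)%N) Q (Qu : Q \in unitmx)
    (QV : forall X, dlim U P X -> is_trig_mx (Q *m X *m invmx Q)) (H : closedSubgroup R n) :
  csg_set H = posgrp U P Q -> calA R n H.
Proof.
move=> HE; split; rewrite ?HE.
- exact: (posgrp_connected Pu n0 Qu QV).
- by move=> g h; exact: posgrp_comm.
- have [B fB VB] := dlim_basis Pu.
  have [W WV dW] := vspace_of_rows fB VB.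
  have WE X : X \in W <-> dlim U P X by rewrite -WV.
  have W1 : 1%:M \in W by apply/WE; have [] : subalg (dlim U P) by exact: dlim_subalg.
  have [W0 W0E dW0] := dim_traceless n0 W1.
  exists W0; last by rewrite dW0 dW.
  rewrite W0E (lie_posgrp Pu Qu QV).
  by apply/seteqP; split=> X [/WE].
have [g gSL gB] := borel_of_trig n0 Qu.
by exists g => // h [Vh h1 _]; apply: gB => //; exact: QV.
Qed.

(** An ultrafilter of Cartan subgroups that converges to [H] gives a family [P],
    indexed by the subgroups themselves, whose limit group is [H]. *)
Lemma closure_Cartan_sub n : (0 < n)%N -> closure (Cartan R n) `<=` calA R n.
Proof.
move=> n0 H; rewrite closureEcvg => -[G GP [GH CG]].
have [U [UU GU]] := ultraFilterLemma GP.
have FU : Filter U by apply: filter_filter.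
have UP : ProperFilter U by exact: ultra_proper.
have UH : U --> H by move=> A /GH; exact: GU.
have UC : U (Cartan R n) by apply: GU; apply: CG.
have /choice[P PP] : forall L : closedSubgroup R n, exists P : 'M[R]_n, P \in unitmx /\
    (Cartan R n L -> csg_set L = [set dconj P e | e in posrow (R := R) (n := n)]).
  move=> L; have [CL|nCL] := pselect (Cartan R n L); last by exists 1%:M; rewrite unitmx1.
  by have [P Pu LP] := Cartan_dconj CL; exists P.
have Pu L : P L \in unitmx by have [] := PP L.
have [Q Qu QV] := dlim_trig Pu.
apply: (posgrp_calA UU Pu n0 Qu QV).
apply/seteqP; split=> h.
  move=> Hh; have [x Lx xh] := chabauty_lim_ex UP UH Hh.
  have /choice[d dP] : forall L, exists e, posrow e /\ (Cartan R n L -> x L = dconj (P L) e).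
    move=> L; have [CL|nCL] := pselect (Cartan R n L).
      have [_ /(_ CL) LE] := PP L; have := Lx L; rewrite LE => -[e pe eE].
      by exists e; split=> // _; rewrite eE.
    exists (const_mx 1); split => //; split=> [i|]; first by rewrite mxE.
    by rewrite big1 // => i _; rewrite mxE.
  apply/(posgrp_limP Pu n0 Qu QV); exists d; first by move=> L; have [] := dP L.
  apply: cvg_trans xh; apply: near_eq_cvg.
  by apply: (@filterS _ U _ _ _ _ UC) => L CL; have [_ ->] := dP L.
move/(posgrp_limP Pu n0 Qu QV) => [d dp dh].
apply: (chabauty_lim_mem UP UH _ dh).
apply: (@filterS _ U _ _ _ _ UC) => L CL; have [_ /(_ CL) ->] := PP L.
by exists (d L).
Qed.

(** For a fixed matrix, commuting with it is a closed linear condition; apply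
    [lie_mem] twice, once for each factor. *)
Lemma lie_algebra_comm n (H : closedSubgroup R n) X Y :
  (forall g h, csg_set H g -> csg_set H h -> g *m h = h *m g) ->
  lie_algebra H X -> lie_algebra H Y -> X *m Y = Y *m X.
Proof.
move=> cH LX LY.
have key (Z e : 'M[R]_n) : (forall t, expmx (t *: Z) *m e = e *m expmx (t *: Z)) ->
    Z *m e = e *m Z.
  move=> Ze; apply: (@lie_mem R n [set W | W *m e = e *m W] Z).
  - apply: closed_filter => F W FP FS FW /=.
    have FF : Filter F by apply: filter_filter.
    have L1 : (fun Y : 'M[R]_n => Y *m e) @ F --> W *m e.
      by apply: (@cvg_mulmx R _ F FF _ _ _ id (fun=> e)) => //; exact: cvg_cst.
    have L2 : (fun Y : 'M[R]_n => e *m Y) @ F --> e *m W.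
      by apply: (@cvg_mulmx R _ F FF _ _ _ (fun=> e) id) => //; exact: cvg_cst.
    apply: (mx_cvg_unique L1); apply: cvg_trans L2; apply: near_eq_cvg.
    by apply: (@filterS _ F _ _ _ _ FS) => W' /= ->.
  - by move=> a W /= WE; rewrite -scalemxAl WE scalemxAr.
  - by move=> t /=; rewrite mulmxBl mulmxBr mul1mx mulmx1 Ze.
apply: (key X Y) => t; apply/esym/key => s.
exact: cH (LY s) (LX t).
Qed.

(** Being triangular in the basis [g] is a closed linear condition, so it passes
    from the group to its Lie algebra. *)
Lemma lie_algebra_split n (H : set 'M[R]_n) g X : SL R n g ->
  H `<=` conjmx_set g (upper_triangular R n) -> lie_algebra H X -> split_mx X.
Proof.
move=> gSL HB LX; have gu := SL_unit gSL.
pose S := [set W : 'M[R]_n | forall i j : 'I_n, (j < i)%N -> (invmx g *m W *m g) i j = 0].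
have SX : S X.
  apply: lie_mem.
  - apply: closed_filter => F W FP FS FW i j ji.
    have FF : Filter F by apply: filter_filter.
    have L1 : (fun Y : 'M[R]_n => invmx g *m Y *m g) @ F --> invmx g *m W *m g.
      apply: (@cvg_mulmx R _ F FF _ _ _ (fun Y => invmx g *m Y) (fun=> g)); last exact: cvg_cst.
      by apply: (@cvg_mulmx R _ F FF _ _ _ (fun=> invmx g) id) => //; exact: cvg_cst.
    have L2 := (@cvg_mxP R _ F FF n n _ _).1 L1 i j.
    apply: (cvg_unique (@norm_hausdorff R R) L2).
    apply: (@cvg_trans _ ((fun=> 0) @ F)); last exact: cvg_cst.
    apply: near_eq_cvg; apply: (@filterS _ F _ _ _ _ FS) => Y SY; exact/esym/SY.
  - move=> a W SW i j ji; rewrite -scalemxAr -scalemxAl mxE SW ?mulr0 //.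
  - move=> t i j ji; have [b [_ bu] bE] := HB _ (LX t).
    rewrite mulmxBr mulmxBl mulmx1 mulVmx // -bE !mulmxA mulVmx // mul1mx mulmxKV //.
    by rewrite !mxE bu // -val_eqE /= gtn_eqF // subr0.
apply: (@split_mx_sub _ _ _ g (invmx g *m X *m g) X).
- by rewrite !mulmxA mulmxV // mul1mx.
- by rewrite row_free_unit.
- exact: split_mx_upper.
Qed.

Lemma calA_asd (H : closedSubgroup R 4) : calA R 4 H ->
  exists (W : {vspace 'M[R]_4}) (P : nat -> 'M[R]_4), [/\ [set` W] = lie_algebra H,
    \dim W = 3%N, forall k, P k \in unitmx & forall X, X \in W -> dlim \oo P X].
Proof.
move=> [_ cH [W WE dW] [g gSL gB]].
have WL X : X \in W -> lie_algebra H X by rewrite -WE.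
pose L := vbasis W : seq 'M[R]_4.
have [||P Pu LP] := @asd_triple R L.
- by rewrite size_tuple.
- split=> [X Y XL YL|X XL].
    by apply: (lie_algebra_comm cH); apply: WL; exact: vbasis_mem.
  by apply: (lie_algebra_split gSL gB); apply: WL; exact: vbasis_mem.
exists W, P; split => // X XW.
have Sa : subalg (dlim \oo P) by exact: dlim_subalg.
rewrite (coord_vbasis XW); apply: (big_ind (dlim \oo P)).
- exact: subalg0.
- by move=> Y Z; exact: subalgD.
- move=> i _; apply: subalgZ => //; apply: LP.
  by apply: mem_nth; rewrite size_tuple.
Qed.

Lemma dlim_sub T (F G : set_system T) n (P : T -> 'M[R]_n) : F `<=` G -> dlim F P `<=` dlim G P.
Proof. by move=> FG X [d dX]; exists d => A /dX; exact: FG. Qed.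

Lemma is_csgI n (G K : set 'M[R]_n) : is_csg G -> is_csg K -> is_csg (G `&` K).
Proof.
move=> [Gs G1 GM GI Gc] [Ks K1 KM KI Kc]; split.
- by move=> x [/Gs].
- by split.
- by move=> x y [? ?] [? ?]; split; [exact: GM|exact: KM].
- by move=> x [? ?]; split; [exact: GI|exact: KI].
- exact: closedI.
Qed.

(** The traceless part of the limit algebra contains [W] and has the same
    dimension, so [H], the limit group and their intersection have the same Lie
    algebra. *)
Lemma calA_posgrp (H : closedSubgroup R 4) : calA R 4 H ->
  exists (U : set_system nat) (P : nat -> 'M[R]_4) Q, [/\ UltraFilter U, \oo `<=` U,
    forall k, P k \in unitmx, Q \in unitmx &
    (forall X, dlim U P X -> is_trig_mx (Q *m X *m invmx Q)) /\ csg_set H = posgrp U P Q].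
Proof.
move=> HA; have [W [P [WE dW Pu WP]]] := calA_asd HA.
have [connH _ _ _] := HA.
have [U [UU ooU]] := @ultraFilterLemma nat \oo _.
have [Q Qu QV] := @dlim_trig R nat U 4 UU P Pu.
exists U, P, Q; split => //; split => //.
have WV X : X \in W -> dlim U P X by move=> /WP; exact: dlim_sub.
have HS := @csg_subSL _ _ H.
have tr0 X : X \in W -> \tr X = 0.
  move=> XW; apply: (tr0_of_det Pu Qu QV (WV X XW)) => t.
  by apply: HS; move: t; have : lie_algebra H X by rewrite -WE.
have [B fB VB] := dlim_basis (U := U) Pu.
have [V VE dV] := vspace_of_rows fB VB.
have VP X : X \in V <-> dlim U P X by rewrite -VE.
have V1 : 1%:M \in V by apply/VP; have [] : subalg (dlim U P) by exact: dlim_subalg.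
have [V0 V0E dV0] := dim_traceless (ltn0Sn 3) V1.
have lieE : lie_algebra (posgrp U P Q) = lie_algebra H.
  rewrite (lie_posgrp Pu Qu QV) -WE.
  have -> : W = V0.
    apply/eqP; rewrite eqEdim dV0 dV dW leqnn andbT; apply/subvP => X XW.
    have : [set` V0] X by rewrite V0E; split; [apply/VP; exact: WV|exact: tr0].
    by [].
  by rewrite V0E; apply/seteqP; split=> X [/VP].
have cP : is_csg (posgrp U P Q) by exact: (posgrp_csg Pu (ltn0Sn 3) Qu QV).
have cH := csgP H.
have cK := is_csgI cH cP.
have lieI : lie_algebra H `<=` lie_algebra (csg_set H `&` posgrp U P Q).
  by move=> X XH t; split; [exact: XH|move: t; change (lie_algebra (posgrp U P Q) X); rewrite lieE].
have E1 : csg_set H `&` posgrp U P Q = csg_set H.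
  by apply: csg_eq => //; exact: subIsetl.
have E2 : csg_set H `&` posgrp U P Q = posgrp U P Q.
  apply: (csg_eq cP cK (@subIsetr _ _ _)); first by rewrite lieE.
  exact: (posgrp_connected Pu (ltn0Sn 3) Qu QV).
by rewrite -E1 E2.
Qed.

(** The Cartan subgroups of the bases [P k] converge to the limit group along
    [U]: for a compact set that meets these subgroups, points of intersection
    have a limit, which is in the limit group; an open set that meets the limit
    group meets the subgroups because each element of this group is a limit of
    their elements. *)
Lemma calA_sub_closure : calA R 4 `<=` closure (Cartan R 4).
Proof.
move=> H /calA_posgrp[U [P [Q [UU ooU Pu Qu [QV HE]]]]].
have FU : Filter U by apply: filter_filter.
have n0 := ltn0Sn 3.
have /choice[L LP] : forall k, exists L : closedSubgroup R 4, Cartan R 4 L /\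
    csg_set L = [set dconj (P k) e | e in posrow (R := R) (n := 4)].
  by move=> k; have [L CL LE] := cartan_exists n0 (Pu k); exists L.
rewrite closureEcvg; exists (L @ U); first exact: fmap_proper_filter.
split; last by move=> A CA; apply: (@filterE _ U) => k; apply: CA; have [] := LP k.
apply/(chabauty_cvg_subbaseP _ _) => S [[K cK <-] /= HK|[A oA <-] /= [h [Hh Ah]]].
  have [//|NK] := in_ultra_setVsetC [set k | L k `&` K = set0] UU.
  have /choice[x xP] : forall k, exists x : 'M[R]_4 * 'rV[R]_4, posrow x.2 /\
      (~ (L k `&` K = set0) -> K x.1 /\ x.1 = dconj (P k) x.2).
    move=> k; have [LK|NLK] := pselect (L k `&` K = set0).
      exists (0, const_mx 1); split=> //; split=> [i|]; first by rewrite mxE.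
      by rewrite big1 // => i _; rewrite mxE.
    have [y [Ly Ky]] : (L k `&` K) !=set0 by apply/set0P/eqP.
    by move: Ly; have [_ ->] := LP k => -[e pe eE]; exists (y, e).
  move: cK; rewrite compact_ultra => /(_ _ (ultra_fmap (fun k => (x k).1) UU))[|h [Kh xh]].
    by apply: (@filterS _ U _ _ _ _ NK) => k nk; have [_ /(_ nk)[]] := xP k.
  have : (csg_set H `&` K) h.
    split => //; rewrite HE; apply/(posgrp_limP Pu n0 Qu QV).
    exists (fun k => (x k).2); first by move=> k; have [] := xP k.
    apply: cvg_trans xh; apply: near_eq_cvg.
    by apply: (@filterS _ U _ _ _ _ NK) => k nk; have [_ /(_ nk)[]] := xP k.
  by rewrite HK.
move: Hh; rewrite HE => /(posgrp_limP Pu n0 Qu QV)[d dp dh].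
have NA : \forall k \near U, A (dconj (P k) (d k)) by apply: dh; exact: open_nbhs_nbhs.
apply: (@filterS _ U _ _ _ _ NA) => k Ak; exists (dconj (P k) (d k)); split => //.
by have [_ ->] := LP k; exists (d k).
Qed.

End Inclusions.

Theorem mainTheorem5 (R : realType) : closure (Cartan R 4) = calA R 4.
Proof.
apply/seteqP; split; last exact: calA_sub_closure.
exact: closure_Cartan_sub.
Qed.
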